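(* Let $(\mathsf M,g;\rho)$ be a $C^1$-compact singular manifold with wedge ends and $\boldsymbol\beta$-removable singularities. Then there is a constant $C>0$ such that every $u\in W^1_2(\mathsf M)$ satisfies $$\|u\|_2\le C\,\big\||\nabla u|_g\big\|_2 .$$
   Context: **Singular manifolds.** For positive functions or metrics, $f\sim h$ means $h/c\le f\le ch$ for some constant $c\ge 1$; $\mathbf 1$ is the constant function one. Let $Q^m$ be the unit cube at the origin in $\mathbb R^m$, $g_m$ the Euclidean metric, and $\|u\|_{l,\infty}:=\max_{|\alpha|\le l}\|\partial^\alpha u\|_\infty$. An $m$-dimensional Riemannian manifold $(N,h)$ with separable topology is uniformly regular if it has an atlas $(O_\kappa,\varphi_\kappa)_{\kappa}$ (orientation preserving if $N$ is oriented), with $\psi_\kappa:=\varphi_\kappa^{-1}$, such that: $\varphi_\kappa(O_\kappa)=Q^m$; for some $r\in(0,1)$ the sets $\psi_\kappa(rQ^m)$ cover $N$; there is a bound on the number of coordinate patches with nonempty common intersection; $\|\varphi_\eta\circ\psi_\kappa\|_{l,\infty}\le c(l)$ whenever $O_\kappa\cap O_\eta\ne\emptyset$; $\psi_\kappa^*h\sim g_m$ uniformly in $\kappa$; and $\|\psi_\kappa^*h\|_{l,\infty}\le c(l)$, for all $l\in\mathbb N_0$. For $\rho\in C^\infty(\mathsf M,(0,\infty))$, $(\mathsf M,g;\rho)$ is a singular manifold (and $\rho$ a singularity function) if $(\mathsf M,g/\rho^2)$ is uniformly regular with such an atlas for which in addition $\|\psi_\kappa^*\rho\|_{l,\infty}\le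 c(l)\rho_\kappa$ with $\rho_\kappa:=\rho(\psi_\kappa(0))$, and $\rho\sim\rho_\kappa$ on $O_\kappa$ uniformly in $\kappa$. The prefix ''$C^k$-'' means that $\rho\in C^k$ and that the bounds of order $l$ are required only for $l\le k$. Standing assumption: $\rho\le 1$. **Cusps and wedges.** Let $J=(0,1]$. $\mathscr C(J)$ is the set of $R\in C^\infty(J,(0,\infty))$ with $R(1)=1$, $R(0):=\lim_{t\to0}R(t)=0$, $\int_J dt/R(t)=\infty$, and $\|\partial_t^kR\|_\infty<\infty$ for $k\ge1$. For a compact closed submanifold $(B,g_B)$ of some $\mathbb R^{\bar d}$, $P(R,B):=\{(t,R(t)y):t\in J,y\in B\}\subset\mathbb R^{1+\bar d}$, and $\phi_P:P(R,B)\to J\times B$, $(t,R(t)y)\mapsto(t,y)$. For a compact connected Riemannian manifold $(\Gamma,g_\Gamma)$ without boundary, $W(R,B,\Gamma):=P(R,B)\times\Gamma$. **Compact singular manifold with wedge ends and $\boldsymbol\beta$-removable singularities.** $(\mathsf M,g;\rho)$ is called so, with $\boldsymbol\beta=(\beta_1,\dots,\beta_k)$, if: (i) there are a compact $m$-dimensional uniformly regular Riemannian manifold $(\mathscr M,g)$ (it may have a boundary) and disjoint compact connected codimension-one submanifolds $\Sigma_1,\dots,\Sigma_k$ contained in the interior of $\mathscr M$; put $V:=\mathscr M\setminus\bigcup_j\Sigma_j$, $\mathsf d_j:=\mathrm{dist}_{\mathscr M}(\cdot,\Sigma_j)$, and let $\mathscr B_{j,r}$ be the intersection with $V$ of the closed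 distance ball of radius $r$ around $\Sigma_j$; $\rho=\mathsf d_j^{\beta_j}$ in $\mathscr B_{j,r}$ for some $\beta_j\ge1$ and some $r\in(0,\delta)$, where $\delta<\mathrm{diam}(\mathscr M)$ and $\mathscr B_{i,\delta}\cap\mathscr B_{j,\delta}=\emptyset$ for $i\neq j$, and $\rho\sim\mathbf 1$ elsewhere on $V$. (ii) There are finitely many disjoint $m$-dimensional wedges $W_1,\dots,W_{n}$ with diffeomorphisms $f_i:W_i\to W(R_i,B_i,\Gamma_i)$, $R_i\in\mathscr C(J)$; with $\mathscr G_{i,r}:=f_i^{-1}(\phi_{P_i}^{-1}((0,r]\times B_i)\times\Gamma_i)$, one has $\rho=f_i^*(\phi_{P_i}^*(R_i\otimes\mathbf 1_{B_i})\otimes\mathbf 1_{\Gamma_i})$ in $\mathscr G_{i,r}$ for some $r\in(0,1]$ and $\rho\sim\mathbf 1$ elsewhere on $W_i$. (iii) $V,W_1,\dots,W_{n}$ cover $\mathsf M$ and $V\cap W_i\subset\partial V\cap\partial W_i$. (iv) $g|_{W_i}=f_i^*(\phi_{P_i}^*(dt^2+g_{B_i})+g_{\Gamma_i})$, where $\phi_{P_i}$ is the map $\phi_P$ for $P_i=P(R_i,B_i)$. **Spaces.** $\mathcal D(\mathsf M)$: smooth compactly supported complex functions on $\mathsf M$. $\|\cdot\|_2$ is the $L_2(\mathsf M)$ norm with respect to the Riemannian measure $\mu_g$. $W^1_2(\mathsf M)$ is the closure of $\mathcal D(\mathsf M)$ with respect to $\|u\|_{1,2}=(\|u\|_2^2+\||\nabla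 u|_g\|_2^2)^{1/2}$.
   Formalization: The compact manifold containing the Σ_j is assumed connected, and either k≥1, or there is at least one wedge and M is connected; without such a condition constants on a closed manifold (k=n=0, ρ=1) violate the inequality. *)

(* Defs.v *)
From HB Require Import structures.
From mathcomp Require Import all_boot all_order all_algebra complex.
From mathcomp Require Import all_classical all_reals all_analysis.

Set Implicit Arguments.
Unset Strict Implicit.
Unset Printing Implicit Defensive.

Import Order.TTheory GRing.Theory Num.Theory numFieldNormedType.Exports.

Local Open Scope classical_set_scope.
Local Open Scope ring_scope.

(** Orders of differentiability: [None] stands for infinity. *)
Definition lek (l : nat) (k : option nat) : Prop :=
  if k is Some k0 then (l <= k0)%N else True.

(** Iterated partial derivative along the coordinate directions listed in [s]. *)
Definition pder (R : realType) (m : nat) (s : seq 'I_m) (f : 'rV[R]_m -> R) :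
    'rV[R]_m -> R :=
  foldr (fun i (h : 'rV[R]_m -> R) x => 'D_(delta_mx 0 i : 'rV[R]_m) h x) f s.

Definition Ck_open (R : realType) (m : nat) (k : option nat)
    (U : set 'rV[R]_m) (f : 'rV[R]_m -> R) : Prop :=
  forall (s : seq 'I_m) (x : 'rV[R]_m), U x -> lek (size s) k ->
    {for x, continuous (pder s f)} /\
    (lek (size s).+1 k ->
     forall i, derivable (pder s f) x (delta_mx 0 i : 'rV[R]_m)).

(** On arbitrary sets (e.g. relatively open subsets of a half-space), C^k means
    that the function extends, locally around each point of the set, to a C^k
    function on an open set. *)
Definition Ck_on (R : realType) (m : nat) (k : option nat)
    (A : set 'rV[R]_m) (f : 'rV[R]_m -> R) : Prop :=
  forall x, A x -> exists (U : set 'rV[R]_m) (F : 'rV[R]_m -> R),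
    [/\ open U, U x, Ck_open k U F & forall y, U y -> A y -> F y = f y].

(** Iterated one-dimensional integrals; by Tonelli this is the integral against
    m-dimensional Lebesgue measure of a nonnegative Borel function. *)
Fixpoint lebint (R : realType) (m : nat) : ('rV[R]_m -> \bar R) -> \bar R :=
  match m with
  | 0 => fun f => f 0
  | m'.+1 => fun f =>
      (\int[@lebesgue_measure R]_(t in setT)
        lebint (fun y : 'rV[R]_m' => f (row_mx (t%:M : 'rV[R]_1) y)))%E
  end.

Definition halfspace (R : realType) (m : nat) : set 'rV[R]_m :=
  [set x | forall i : 'I_m, val i = 0%N -> 0 <= x 0 i].

Definition cube (R : realType) (m : nat) (r : R) : set 'rV[R]_m :=
  [set x | forall i, `|x 0 i| < r].

(** The values of [cmap] outside [cdom] and of [cinv] outside [cimg] are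
    irrelevant. *)
Record chart (R : realType) (X : Type) (m : nat) := Chart {
  cdom : set X;
  cmap : X -> 'rV[R]_m;
  cinv : 'rV[R]_m -> X }.

Definition cimg (R : realType) (X : Type) (m : nat) (c : chart R X m) :
  set 'rV[R]_m := cmap c @` cdom c.

Definition is_chart (R : realType) (X : topologicalType) (m : nat)
    (c : chart R X m) : Prop :=
  [/\ open (cdom c),
      forall p, cdom c p -> cinv c (cmap c p) = p,
      {within cdom c, continuous (cmap c)},
      {within cimg c, continuous (cinv c)} &
      exists2 U : set 'rV[R]_m, open U &
        cimg c = U \/ cimg c = U `&` @halfspace R m].

Definition transition (R : realType) (X : Type) (m : nat) (c c' : chart R X m) :
  'rV[R]_m -> 'rV[R]_m := fun x => cmap c' (cinv c x).

Definition smooth_compat (R : realType) (X : Type) (m : nat)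
    (c c' : chart R X m) : Prop :=
  forall j, Ck_on None (cmap c @` (cdom c `&` cdom c'))
                  (fun x => transition c c' x 0 j).

(** A smooth m-manifold: nonempty, Hausdorff, second countable, with a maximal
    smooth atlas and a preferred chart around every point. *)
Record manifold (R : realType) (m : nat) := Manifold {
  car :> ptopologicalType;
  atlas : set (chart R car m);
  chart_at : car -> chart R car m;
  manifold_hausdorff : hausdorff_space car;
  manifold_countable : @second_countable car;
  atlas_chart : forall c, atlas c -> is_chart c;
  atlas_chart_at : forall p, atlas (chart_at p);
  dom_chart_at : forall p, cdom (chart_at p) p;
  atlas_compat : forall c c', atlas c -> atlas c' -> smooth_compat c c';
  atlas_maximal : forall c, is_chart c ->
    (forall c', atlas c' -> smooth_compat c c' /\ smooth_compat c' c) ->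
    atlas c }.

Definition minterior (R : realType) (m : nat) (M : manifold R m) : set M :=
  [set p | (cimg (chart_at p))° (cmap (chart_at p) p)].

Arguments minterior {R m} M _.

Definition mboundary (R : realType) (m : nat) (M : manifold R m) : set M :=
  ~` minterior M.
Arguments mboundary {R m} M _.

Definition Ck_fun (R : realType) (m : nat) (M : manifold R m) (k : option nat)
    (A : set M) (u : M -> R) : Prop :=
  forall c, atlas c -> Ck_on k (cmap c @` (A `&` cdom c)) (u \o cinv c).

Definition smooth_map (R : realType) (m n : nat) (M : manifold R m)
    (N : manifold R n) (A : set M) (f : M -> N) : Prop :=
  {within A, continuous f} /\
  forall (c : chart R M m) (c' : chart R N n), atlas c -> atlas c' -> forall j,
    Ck_on None (cmap c @` (A `&` cdom c `&` f @^-1` cdom c'))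
          (fun x => cmap c' (f (cinv c x)) 0 j).

(** Embedded hypersurface without boundary, contained in the interior. *)
Definition hypersurface (R : realType) (m : nat) (M : manifold R m)
    (S : set M) : Prop :=
  forall p, S p -> exists (c : chart R M m) (i : 'I_m),
    [/\ atlas c, cdom c p, open (cimg c) &
        forall q, cdom c q -> (S q <-> cmap c q 0 i = 0)].

(** A metric is given by its Gram matrices [g c x], [c] in the atlas and [x] in
    [cimg c].  The transformation law is only imposed at interior points, where
    Jacobians are determined; it extends to the boundary by continuity. *)
Definition gram (R : realType) (m : nat) (M : manifold R m) : Type :=
  chart R M m -> 'rV[R]_m -> 'M[R]_m.

Definition qform (R : realType) (m : nat) (G : 'M[R]_m) (v : 'rV[R]_m) : R :=
  (v *m G *m v^T) 0 0.

(** In the row-vector convention of the library, [v *m 'J f x] is the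
    differential of [f] at [x] applied to [v]. *)
Definition pullback (R : realType) (m n : nat) (f : 'rV[R]_m -> 'rV[R]_n)
    (G : 'rV[R]_n -> 'M[R]_n) (x : 'rV[R]_m) : 'M[R]_m :=
  'J f x *m G (f x) *m ('J f x)^T.

Definition is_metric (R : realType) (m : nat) (M : manifold R m)
    (g : gram M) : Prop :=
  [/\ forall c, atlas c -> forall i j, Ck_on None (cimg c) (fun x => g c x i j),
      forall c x, atlas c -> cimg c x -> (g c x)^T = g c x,
      forall c x v, atlas c -> cimg c x -> v != 0 -> 0 < qform (g c x) v &
      forall c c' x, atlas c -> atlas c' -> (cimg c)° x -> cdom c' (cinv c x) ->
        g c x = pullback (transition c c') (g c') x].

(** [joins g p q l]: some piecewise C^1 curve from [p] to [q] has length [l].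
    The curve is cut into finitely many pieces, each inside one chart. *)
Inductive joins (R : realType) (m : nat) (M : manifold R m) (g : gram M)
    (p : M) : M -> \bar R -> Prop :=
| joins_refl : joins g p p 0%E
| joins_step (q : M) (l : \bar R) (c : chart R M m) (gam : R -> 'rV[R]_m) :
    joins g p q l -> atlas c ->
    (forall t, derivable gam t 1) -> continuous (derive1 gam) ->
    (forall t, 0 <= t <= 1 -> cimg c (gam t)) ->
    cinv c (gam 0) = q ->
    joins g p (cinv c (gam 1))
      (l + \int[@lebesgue_measure R]_(t in `[0%R, 1%R])
             (Num.sqrt (qform (g c (gam t)) (derive1 gam t)))%:E)%E.

Definition mdist (R : realType) (m : nat) (M : manifold R m) (g : gram M)
    (p : M) (S : set M) : \bar R :=
  ereal_inf [set l | exists2 q, S q & joins g p q l].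

Definition mdiam (R : realType) (m : nat) (M : manifold R m) (g : gram M) :
    \bar R :=
  ereal_sup [set l | exists p q : M, l = mdist g p [set q]].

Notation borel M := (g_sigma_algebraType (@open (car M))).

(** These conditions determine the Riemannian measure on the Borel sets,
    since countably many chart domains cover the manifold. *)
Definition is_riemannian_measure (R : realType) (m : nat) (M : manifold R m)
    (g : gram M) (mu : {measure set (borel M) -> \bar R}) : Prop :=
  forall c, atlas c -> forall A : set (borel M), measurable A -> A `<=` cdom c ->
    mu A = lebint (fun x : 'rV[R]_m =>
             (\1_(cmap c @` A) x * Num.sqrt (\det (g c x)))%:E).

(** All partial derivatives of order at most [l] are bounded by [C] on [A];
    on a half-cube one evaluates them in its interior, which is dense. *)
Definition pder_bounded (R : realType) (m : nat) (l : nat) (C : R)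
    (A : set 'rV[R]_m) (f : 'rV[R]_m -> R) : Prop :=
  forall (s : seq 'I_m) (x : 'rV[R]_m), (size s <= l)%N -> A° x ->
    `|pder s f x| <= C.

(** Charts around boundary points are normalized to half-cubes. *)
Definition uniform_atlas (R : realType) (m : nat) (M : manifold R m)
    (k : option nat) (g : gram M) (K : set (chart R M m)) : Prop :=
  [/\ (forall c, K c -> atlas c /\
         (cimg c = cube 1 \/ cimg c = cube 1 `&` @halfspace R m)) /\
      (exists r : R, [/\ 0 < r, r < 1 & forall p : M,
         exists c, [/\ K c, cdom c p & cube r (cmap c p)]]),
      exists N : nat, forall f : 'I_N.+1 -> chart R M m, injective f ->
        (forall i, K (f i)) -> ~ exists p, forall i, cdom (f i) p,
      forall l, lek l k -> exists C : R, forall c c', K c -> K c' -> forall j,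
        pder_bounded l C (cmap c @` (cdom c `&` cdom c'))
          (fun x => transition c c' x 0 j),
      exists2 C : R, 1 <= C & forall c x v, K c -> cimg c x ->
        C^-1 * qform 1%:M v <= qform (g c x) v <= C * qform 1%:M v &
      forall l, lek l k -> exists C : R, forall c, K c -> forall i j,
        pder_bounded l C (cimg c) (fun x => g c x i j)].

Definition uniformly_regular (R : realType) (m : nat) (M : manifold R m)
    (k : option nat) (g : gram M) : Prop :=
  exists K, uniform_atlas k g K.

Definition rescale (R : realType) (m : nat) (M : manifold R m)
    (g : gram M) (rho : M -> R) : gram M :=
  fun c x => (rho (cinv c x)) ^- 2 *: g c x.

Definition Ck_singular_manifold (R : realType) (m : nat) (M : manifold R m)
    (k : option nat) (g : gram M) (rho : M -> R) : Prop :=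
  [/\ is_metric g, forall p, 0 < rho p, Ck_fun k setT rho &
   exists K : set (chart R M m),
   [/\ uniform_atlas k (rescale g rho) K,
       forall l, lek l k -> exists C : R, forall c, K c ->
         pder_bounded l (C * rho (cinv c 0)) (cimg c) (rho \o cinv c) &
       exists2 C : R, 1 <= C & forall c p, K c -> cdom c p ->
         C^-1 * rho (cinv c 0) <= rho p <= C * rho (cinv c 0)]].

Definition cusp_function (R : realType) (X : R -> R) : Prop :=
  [/\ (exists F : R -> R, (forall t, 0 < t <= 1 -> F t = X t) /\
         forall n t, 0 < t -> derivable (derive1n n F) t 1) /\
      (forall t, 0 < t <= 1 -> 0 < X t),
      X 1 = 1,
      X t @[t --> 0^'+] --> 0,
      (\int[@lebesgue_measure R]_(t in `]0%R, 1%R]) ((X t)^-1)%:E = +oo)%E &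
      forall n, (0 < n)%N -> exists C : R, forall t, 0 < t < 1 ->
        `|derive1n n X t| <= C].

(** Smooth embedding of a compact manifold in Euclidean space; a compact
    submanifold is given through its inclusion map. *)
Definition embedding (R : realType) (b d : nat) (B : manifold R b)
    (e : B -> 'rV[R]_d) : Prop :=
  [/\ injective e,
      forall j, Ck_fun None setT (fun y => e y 0 j) &
      forall c x, atlas c -> cimg c x -> \rank ('J (e \o cinv c) x) = b].

(** [cusp_param X e] is the inverse of the map phi_P onto (0,1] x B. *)
Definition cusp_param (R : realType) (d : nat) (B : Type) (X : R -> R)
    (e : B -> 'rV[R]_d) (t : R) (y : B) : 'rV[R]_(1 + d) :=
  row_mx (t%:M : 'rV[R]_1) (X t *: e y).

Definition cusp (R : realType) (d : nat) (B : Type) (X : R -> R)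
    (e : B -> 'rV[R]_d) : set 'rV[R]_(1 + d) :=
  [set v | exists t y, 0 < t <= 1 /\ v = cusp_param X e t y].

(** Coordinate expression of a map defined on R x B x G. *)
Definition coord3 (R : realType) (b q m : nat) (B : manifold R b)
    (G : manifold R q) (M : manifold R m) (h : R * B * G -> M)
    (cB : chart R B b) (cG : chart R G q) (c : chart R M m) :
    'rV[R]_(1 + (b + q)) -> 'rV[R]_m :=
  fun x => cmap c (h (lsubmx x 0 0, cinv cB (lsubmx (rsubmx x)),
                      cinv cG (rsubmx (rsubmx x)))).

Definition dom3 (R : realType) (b q m : nat) (B : manifold R b)
    (G : manifold R q) (M : manifold R m) (h : R * B * G -> M)
    (cB : chart R B b) (cG : chart R G q) (c : chart R M m) :
    set 'rV[R]_(1 + (b + q)) :=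
  [set x | [/\ 0 < lsubmx x 0 0 <= 1, cimg cB (lsubmx (rsubmx x)),
     cimg cG (rsubmx (rsubmx x)) &
     cdom c (h (lsubmx x 0 0, cinv cB (lsubmx (rsubmx x)),
                cinv cG (rsubmx (rsubmx x))))]].

Record wedge_end (R : realType) (m : nat) (M : manifold R m) (g : gram M)
    (rho : M -> R) := WedgeEnd {
  wset :> set M;
  wprofile : R -> R;
  wbdim : nat;
  wambient : nat;
  wgdim : nat;
  wbase : manifold R wbdim;
  wbase_gram : gram wbase;
  wemb : wbase -> 'rV[R]_wambient;
  wfib : manifold R wgdim;
  wfib_gram : gram wfib;
  wmap : M -> 'rV[R]_(1 + wambient) * wfib;
  winv : 'rV[R]_(1 + wambient) * wfib -> M;

  wprofileP : cusp_function wprofile;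
  wbaseP : [/\ compact [set: wbase], mboundary wbase = set0,
               is_metric wbase_gram & embedding wemb];
  wfibP : [/\ compact [set: wfib], connected [set: wfib],
              mboundary wfib = set0 & is_metric wfib_gram];
  wdim : m = (1 + (wbdim + wgdim))%N;

  (** [wmap] is a diffeomorphism from the wedge onto P(R,B) x Gamma, with inverse
      [winv]; the smooth structure of P(R,B) is read through phi_P. *)
  wmap_bij : [/\ forall p, wset p -> cusp wprofile wemb (wmap p).1,
     forall v z, cusp wprofile wemb v -> wset (winv (v, z)),
     forall p, wset p -> winv (wmap p) = p &
     forall v z, cusp wprofile wemb v -> wmap (winv (v, z)) = (v, z)];
  wmap_smooth : (forall j, Ck_fun None wset (fun p => (wmap p).1 0 j)) /\
     smooth_map wset (fun p => (wmap p).2);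
  wparam := fun a : R * wbase * wfib =>
     winv (cusp_param wprofile wemb a.1.1 a.1.2, a.2);
  wparam_smooth :
     {within [set a : R * wbase * wfib | 0 < a.1.1 <= 1], continuous wparam} /\
     forall cB cG c, atlas cB -> atlas cG -> atlas c -> forall j,
       Ck_on None (dom3 wparam cB cG c)
             (fun x => coord3 wparam cB cG c x 0 j);

  (** The wedge is a full-dimensional submanifold: its interior is open. *)
  wedge_open : open (wparam @` [set a | 0 < a.1.1 < 1]);

  wedge_metric : forall cB cG c x, atlas cB -> atlas cG -> atlas c ->
     dom3 wparam cB cG c x -> lsubmx x 0 0 < 1 ->
     pullback (coord3 wparam cB cG c) (g c) x =
       block_mx 1%:M 0 0
         (block_mx (wbase_gram cB (lsubmx (rsubmx x))) 0
                   0 (wfib_gram cG (rsubmx (rsubmx x))));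

  wedge_rho : exists r : R, [/\ 0 < r <= 1,
     forall t y z, 0 < t <= r -> rho (wparam (t, y, z)) = wprofile t &
     exists2 C : R, 1 <= C & forall t y z, r < t <= 1 ->
       C^-1 <= rho (wparam (t, y, z)) <= C] }.

(** The compact manifold with the hypersurfaces removed, embedded
    isometrically in [M] through [cincl] (with inverse [cproj]). *)
Record removable_core (R : realType) (m : nat) (M : manifold R m) (g : gram M)
    (rho : M -> R) (k : nat) (beta : 'I_k -> R) := RemovableCore {
  core : manifold R m;
  core_gram : gram core;
  csing : 'I_k -> set core;
  cincl : core -> M;
  cproj : M -> core;

  coreP : [/\ is_metric core_gram, compact [set: core],
              connected [set: core] & uniformly_regular None core_gram];
  csingP : forall j, [/\ csing j !=set0, compact (csing j),
     connected (csing j), hypersurface (csing j) &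
     csing j `<=` minterior core];
  csing_disjoint : forall i j, i != j -> csing i `&` csing j = set0;
  creg := [set p | forall j, ~ csing j p];

  cincl_diffeo : [/\ forall p, creg p -> cproj (cincl p) = p,
     smooth_map creg cincl & smooth_map (cincl @` creg) cproj];
  cincl_open : open (cincl @` (creg `&` minterior core));
  core_metric : forall (c : chart R core m) (c' : chart R M m) x,
     atlas c -> atlas c' ->
     (cimg c)° x -> creg (cinv c x) -> cdom c' (cincl (cinv c x)) ->
     pullback (fun y => cmap c' (cincl (cinv c y))) (g c') x = core_gram c x;

  beta_ge1 : forall j, 1 <= beta j;
  core_rho : exists delta r : R,
     [/\ (delta%:E < mdiam core_gram)%E, 0 < r < delta,
         forall i j p, i != j -> creg p ->
           ~ ((mdist core_gram p (csing i) <= delta%:E)%E /\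
              (mdist core_gram p (csing j) <= delta%:E)%E),
         forall j p, creg p -> (mdist core_gram p (csing j) <= r%:E)%E ->
           rho (cincl p) = (fine (mdist core_gram p (csing j))) `^ (beta j) &
         exists2 C : R, 1 <= C & forall p, creg p ->
           (forall j, (r%:E < mdist core_gram p (csing j))%E) ->
           C^-1 <= rho (cincl p) <= C] }.

Arguments wparam {R m M g rho} w a.
Arguments cincl {R m M g rho k beta} r _.
Arguments creg {R m M g rho k beta} r _.

(** C^k-compact singular manifold with wedge ends and beta-removable
    singularities.  Without removable singularities, at least one wedge has to be
    attached to the (then closed) core: this is the last condition. *)
Record compact_singular_manifold (R : realType) (m : nat) (M : manifold R m)
    (k : option nat) (g : gram M) (rho : M -> R) (ns : nat) (beta : 'I_ns -> R) :=
  CompactSingularManifold {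
  csm_singular : Ck_singular_manifold k g rho;
  csm_rho_le1 : forall p, rho p <= 1;
  csm_core : removable_core g rho beta;
  csm_nwedges : nat;
  csm_wedge : 'I_csm_nwedges -> wedge_end g rho;
  csm_disjoint : forall i j, i != j ->
    wset (csm_wedge i) `&` wset (csm_wedge j) = set0;
  csm_cover : forall p, (cincl csm_core @` creg csm_core) p \/
    exists i, wset (csm_wedge i) p;
  csm_meet : forall i p, creg csm_core p ->
    wset (csm_wedge i) (cincl csm_core p) ->
    mboundary (core csm_core) p /\
    exists y z, cincl csm_core p = wparam (csm_wedge i) (1, y, z);
  csm_ends : (0 < ns)%N \/ ((0 < csm_nwedges)%N /\ connected [set: M]) }.

(** Vector fields, in coordinates. *)
Definition vfield (R : realType) (m : nat) (M : manifold R m) : Type :=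
  chart R M m -> 'rV[R]_m -> 'rV[R]_m.

Definition is_measurable_vfield (R : realType) (m : nat) (M : manifold R m)
    (w : vfield M) : Prop :=
  (forall c c' x, atlas c -> atlas c' -> (cimg c)° x -> cdom c' (cinv c x) ->
     w c' (transition c c' x) = w c x *m 'J (transition c c') x) /\
  (forall c i, atlas c ->
     measurable_fun (cdom c : set (borel M))
       (fun p : borel M => w c (cmap c p) 0 i)).

Definition vfield_sub (R : realType) (m : nat) (M : manifold R m)
    (v w : vfield M) : vfield M := fun c x => v c x - w c x.

Definition grad (R : realType) (m : nat) (M : manifold R m) (g : gram M)
    (u : M -> R) : vfield M :=
  fun c x => (\row_i 'D_(delta_mx 0 i : 'rV[R]_m) (u \o cinv c) x)
             *m invmx (g c x).

(** Pointwise length of the complex field [v + i w].  It is set to 0 on the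
    boundary, a null set where the derivatives in [grad] are not two-sided. *)
Definition vfield_norm (R : realType) (m : nat) (M : manifold R m) (g : gram M)
    (v w : vfield M) (p : M) : R :=
  let c := chart_at p in
  let x := cmap c p in
  \1_(minterior M) p *
  Num.sqrt (qform (g c x) (v c x) + qform (g c x) (w c x)).

Definition cabs (R : realType) (z : R[i]) : R :=
  Num.sqrt ((complex.Re z) ^+ 2 + (complex.Im z) ^+ 2).

Definition L2norm (R : realType) (m : nat) (M : manifold R m)
    (mu : {measure set (borel M) -> \bar R}) (u : M -> R[i]) : \bar R :=
  Lnorm mu 2%:E (fun p : borel M => (cabs (u p))%:E).

Definition L2norm_vfield (R : realType) (m : nat) (M : manifold R m) (g : gram M)
    (mu : {measure set (borel M) -> \bar R}) (v w : vfield M) : \bar R :=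
  Lnorm mu 2%:E (fun p : borel M => (vfield_norm g v w p)%:E).

Definition Re_part (R : realType) (T : Type) (u : T -> R[i]) : T -> R :=
  fun p => complex.Re (u p).
Definition Im_part (R : realType) (T : Type) (u : T -> R[i]) : T -> R :=
  fun p => complex.Im (u p).

Definition test_function (R : realType) (m : nat) (M : manifold R m)
    (u : M -> R[i]) : Prop :=
  [/\ Ck_fun None setT (Re_part u), Ck_fun None setT (Im_part u) &
      compact (closure [set p | u p != 0])].

(** [W12 g mu u v w]: [u] is in the closure of the test functions for the norm
    of W^1_2, and [v + i w] is its gradient, i.e. the L_2 limit of the gradients
    of approximating test functions (unique almost everywhere, as the gradient
    is closable). *)
Definition W12 (R : realType) (m : nat) (M : manifold R m) (g : gram M)
    (mu : {measure set (borel M) -> \bar R}) (u : M -> R[i]) (v w : vfield M) :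
    Prop :=
  [/\ measurable_fun [set: borel M] (Re_part u : borel M -> R),
      measurable_fun [set: borel M] (Im_part u : borel M -> R),
      is_measurable_vfield v, is_measurable_vfield w &
      exists phi : nat -> M -> R[i],
      [/\ forall n, test_function (phi n),
          (fun n => L2norm mu (fun p => u p - phi n p)) @ \oo --> 0%E &
          (fun n => L2norm_vfield g mu
             (vfield_sub v (grad g (Re_part (phi n))))
             (vfield_sub w (grad g (Im_part (phi n))))) @ \oo --> 0%E]].

(* Main.v *)
Require Import Defs.
From HB Require Import structures.
From mathcomp Require Import all_boot all_order all_algebra complex finmap.
From mathcomp Require Import ring lra.
From mathcomp Require Import all_classical all_reals all_analysis measurable_realfun.

Set Implicit Arguments.
Unset Strict Implicit.
Unset Printing Implicit Defensive.

Import Order.TTheory GRing.Theory Num.Theory numFieldNormedType.Exports.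
Local Open Scope classical_set_scope.
Local Open Scope ring_scope.

(** By density it suffices to find [C] with [\int f^2 <= C \int |grad f|^2] for
    real test functions [f].  Call a set [S] good if [\int_S f^2] is bounded in
    this way; finite unions of good sets are good, so by compactness only local
    questions remain.  The local tool is a Poincare inequality on a convex set
    [Q] of [R^m]: [\int_Q h^2] is controlled by [\int_Q |grad h|^2] and by
    [\int_U h^2] for any neighbourhood [U] in [Q] of a point of [Q].

    Test functions have compact support, on which [rho] is bounded below, so they
    vanish near the removed hypersurfaces and near the cusp of each wedge.  In a
    chart across such an end one extends [f] by zero to the other side; then
    [h = 0] on some [U], and the ends are good.  Near any other point the same
    inequality, with [U] inside a good set, shows that the set of points with a
    good neighbourhood is open and closed; connectedness of the core (or of [M])
    propagates goodness from the ends to everything else. *)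

(** * Calculus in coordinates *)

Section RowVectors.
Context {R : realType}.

(** The constant has to be chosen before the test function, whereas the neighbourhood of an end on
    which [f] vanishes shrinks as [f] varies. Continuing [f] by zero across the end removes this
    conflict: the region beyond the end is fixed, and so is the constant that it yields. This works
    because the metric stays comparable with the Euclidean one up to the end. Across a removed
    hypersurface it is the smooth metric of the core; on a wedge it is the product of [dt^2] with
    the metrics of base and fibre, in which the cusp profile does not appear, so that the cusp is a
    cylinder of finite length. Measure and metric are given only in charts of the maximal atlas of
    [M]. That coordinates of the core and of the wedges belong to it has to be proved from
    maximality; for a wedge, smoothness of the inverse comes from nondegeneracy of the product
    metric. Boundary points are a second obstacle: Jacobians and gradients are controlled only at
    interior points, so interiority is shown to be independent of the chart, and the boundary face
    is discarded as a null set. *)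

Lemma coord_le_norm m (x : 'rV[R]_m) i : `|x 0 i| <= `|x|.
Proof.
rewrite [leRHS]/Num.Def.normr/= mx_normrE.
exact: (le_bigmax _ (fun k : 'I_1 * 'I_m => `|x k.1 k.2|) (ord0, i)).
Qed.

Lemma rV_norm_le m (x : 'rV[R]_m) (e : R) :
  0 <= e -> (forall i, `|x 0 i| <= e) -> `|x| <= e.
Proof.
move=> e0 xe; rewrite [leLHS]/Num.Def.normr/= mx_normrE.
apply: bigmax_le => //= -[i j] _ /=; rewrite ord1; exact: xe.
Qed.

Lemma nbhs_cubeP m (x : 'rV[R]_m) (A : set 'rV[R]_m) :
  nbhs x A <-> exists2 r : R, 0 < r &
    forall y : 'rV[R]_m, (forall i, `|y 0 i - x 0 i| < r) -> A y.
Proof.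
split.
  move=> /nbhs_ballP[r /= r0 rA]; exists (r / 2); first by rewrite divr_gt0.
  move=> y yx; apply: rA; rewrite -ball_normE /= distrC.
  apply: (@le_lt_trans _ _ (r / 2)); last by rewrite ltr_pdivrMr// ltr_pMr// ltr1n.
  apply: rV_norm_le => [|i]; first by rewrite divr_ge0// ltW.
  by rewrite !mxE; exact/ltW/yx.
move=> [r r0 rA]; apply/nbhs_ballP; exists r => //= y.
rewrite -ball_normE /= distrC => yx; apply: rA => i.
have := coord_le_norm (y - x) i; rewrite !mxE => /le_lt_trans; exact.
Qed.

Lemma differentiable_approx m (f : 'rV[R]_m -> R) (df : {linear 'rV[R]_m -> R}) x :
  continuous df ->
  (forall e : R, 0 < e ->
     \forall h \near (0 : 'rV[R]_m), `|f (h + x) - f x - df h| <= e * `|h|) ->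
  differentiable f x.
Proof.
move=> dfc H.
apply/diffP => /=.
(* The differential is selected by a choice operator, so it meets its specification as soon as one
   continuous linear map does; [df] is that witness. *)
apply: (@getPex _ (fun (df : {linear 'rV[R]_m -> R}) => continuous df /\
  forall y, f y = f (lim (nbhs x)) + df (y - lim (nbhs x))
                  +o_(y \near x) (y - lim (nbhs x)))).
exists df; split=> // y; rewrite lim_id //; move: y; apply: eqaddoEx.
suff E : f = (fun z => f x + df (z - x)) +o_x (fun z => z - x).
  by move=> z; rewrite [in LHS]E.
apply/eqaddoP => e e0.
have /nbhs_ballP[r /= r0 rH] := H e e0.
apply/nbhs_ballP; exists r => //= z xz; have := rH (z - x).
rewrite !fctE /= subrK opprD addrA; apply.
by move: xz; rewrite -!ball_normE /= sub0r normrN distrC.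
Qed.

Lemma is_derive_line m (f : 'rV[R]_m -> R) (y v : 'rV[R]_m) (t : R) :
  derivable f (y + t *: v) v ->
  is_derive t 1 (fun s : R => f (y + s *: v)) ('D_v f (y + t *: v)).
Proof.
move=> dv.
have E : (fun h : R => h^-1 *: (((fun s : R => f (y + s *: v)) \o shift t) (h *: 1) -
           f (y + t *: v))) =
         (fun h : R => h^-1 *: ((f \o shift (y + t *: v)) (h *: v) - f (y + t *: v))).
  apply/funext => h /=; congr (_ *: (f _ - _)).
  by rewrite scalerDl addrCA; congr (_ *: _ + _); exact: mulr1.
by split; [rewrite /derivable E | rewrite /derive E].
Qed.

(** Bounding the intermediate point by the absolute value of [b] treats increments of both signs at
    once, as is needed for the coordinates of an arbitrary displacement. *)
Lemma MVT_from0 (f df : R -> R) (b : R) :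
  (forall t : R, `|t| <= `|b| -> is_derive t 1 f (df t)) ->
  exists2 c, `|c| <= `|b| & f b - f 0 = df c * b.
Proof.
move=> H.
have cf a c : (forall t : R, t \in `[a, c]%R -> is_derive t 1 f (df t)) ->
    {within `[a, c], continuous f}.
  move=> K; apply: derivable_within_continuous => t /K dt; exact: ex_derive.
have [b0|b0] := leP 0 b.
  have K (t : R) : t \in `[0, b]%R -> is_derive t 1 f (df t).
    by rewrite in_itv /= => /andP[t0 tb]; apply: H; rewrite !ger0_norm.
  have [c] := MVT_segment b0 (fun t ht => K t (subset_itv_oo_cc ht)) (cf _ _ K).
  rewrite in_itv /= subr0 => /andP[c0 cb] E.
  by exists c => //; rewrite !ger0_norm.
have K (t : R) : t \in `[b, 0]%R -> is_derive t 1 f (df t).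
  rewrite in_itv /= => /andP[t0 tb]; apply: H.
  by rewrite (ltr0_norm b0) (ler0_norm tb) lerN2.
have [c] := MVT_segment (ltW b0) (fun t ht => K t (subset_itv_oo_cc ht)) (cf _ _ K).
rewrite in_itv /= sub0r => /andP[c0 cb] E.
exists c; first by rewrite (ltr0_norm b0) (ler0_norm cb) lerN2.
by rewrite -opprB E mulrN opprK.
Qed.

Definition pd m (i : 'I_m) (f : 'rV[R]_m -> R) : 'rV[R]_m -> R :=
  fun x => 'D_(delta_mx 0 i : 'rV[R]_m) f x.

Lemma continuous_rV (T : topologicalType) m (F : T -> 'rV[R]_m) (t : T) :
  (forall i, {for t, continuous (fun s => F s 0 i)}) -> {for t, continuous F}.
Proof.
move=> H; apply/cvgrPdist_lt => e e0.
have : \forall s \near t, forall i, `|F t 0 i - F s 0 i| < e / 2.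
  by apply: filter_forall => i; have /cvgrPdist_lt := H i; apply; rewrite divr_gt0.
apply: filterS => s Hs.
apply: (@le_lt_trans _ _ (e / 2)); last by rewrite ltr_pdivrMr// ltr_pMr// ltr1n.
apply: rV_norm_le => [|i]; first by rewrite divr_ge0// ltW.
by rewrite !mxE; exact/ltW/Hs.
Qed.

(** Packaged below as a linear map, so that a row of partial derivatives can be offered as a
    candidate differential. *)
Definition lform m (D : 'rV[R]_m) (h : 'rV[R]_m) : R := \sum_i h 0 i * D 0 i.

Lemma lform_linear m (D : 'rV[R]_m) : linear (lform D).
Proof.
move=> a u v; rewrite /lform scaler_sumr -big_split /=; apply: eq_bigr => i _.
by rewrite !mxE mulrDl -mulrA.
Qed.

HB.instance Definition _ m (D : 'rV[R]_m) :=
  GRing.isLinear.Build R 'rV[R]_m R *:%R (lform D) (@lform_linear m D).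

Lemma lform_continuous m (D : 'rV[R]_m) : continuous (lform D).
Proof.
move=> h.
have : continuous (fun h : 'rV[R]_m => \sum_i h 0 i * D 0 i).
  apply: continuous_big => [|i _]; first exact: add_continuous.
  by move=> k; apply: continuousM; [exact: coord_continuous|exact: cst_continuous].
exact.
Qed.

Lemma C1_differentiable m (f : 'rV[R]_m -> R) (x : 'rV[R]_m) :
  (\forall y \near x, forall i, derivable f y (delta_mx 0 i : 'rV[R]_m)) ->
  (forall i, {for x, continuous (pd i f)}) ->
  differentiable f x /\ forall h, 'd f x h = \sum_i h 0 i * pd i f x.
Proof.
move=> df cf.
have L : differentiable f x.
  apply: (@differentiable_approx _ _ (lform (\row_i pd i f x))).
    exact: lform_continuous.
  move=> e e0.
  (* The divisor [m.+1] also covers dimension zero; the [m] errors then add up to at most [e] times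
     the norm of [h]. *)
  have e1 : 0 < e / m.+1%:R by rewrite divr_gt0.
  have : \forall y \near x, forall i, derivable f y (delta_mx 0 i : 'rV[R]_m) /\
      `|pd i f x - pd i f y| <= e / m.+1%:R.
    apply: (@filter_forall _ _ (fun (i : 'I_m) y => derivable f y (delta_mx 0 i : 'rV[R]_m) /\
      `|pd i f x - pd i f y| <= e / m.+1%:R) (nbhs x) (nbhs_filter x)) => i.
    apply: filterI; first by apply: filterS df => y; exact.
    by have /cvgrPdist_le := cf i; apply.
  move=> /nbhs_cubeP[r r0 rH]; apply/nbhs_cubeP; exists r => // h hr.
  (* [tr k] keeps the first [k] coordinates of [h]. Along the points [x + tr k] the increment of [f]
     telescopes, and each term changes a single coordinate, where the one-variable mean value
     theorem applies. *)
  pose tr (k : nat) : 'rV[R]_m := \row_j (if (j < k)%N then h 0 j else 0).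
  have trS (k : 'I_m) : tr k.+1 = tr k + h 0 k *: delta_mx 0 k.
    apply/rowP => j; rewrite !mxE /= ltnS leq_eqVlt.
    have [->|jk] := eqVneq j k; first by rewrite !eqxx ltnn /= mulr1 add0r.
    by rewrite [(j : nat) == k](negbTE jk) /= mulr0 addr0.
  have tr0 : tr 0%N = 0 by apply/rowP => j; rewrite !mxE.
  have trm : tr m = h by apply/rowP => j; rewrite !mxE ltn_ord.
  have step (k : 'I_m) : exists2 c : R, `|c - pd k f x| <= e / m.+1%:R &
      f (x + tr k.+1) - f (x + tr k) = c * h 0 k.
    have K (t : R) : `|t| <= `|h 0 k| -> forall i,
        `|(x + tr k + t *: delta_mx 0 k : 'rV[R]_m) 0 i - x 0 i| < r.
      move=> th i; rewrite !mxE /=; have -> (a b c : R) : a + b + c - a = b + c by ring.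
      have hri := hr i; rewrite mxE subr0 in hri.
      have [ik|ik] := eqVneq i k.
        subst i; rewrite ltnn add0r mulr1; exact: le_lt_trans hri.
      rewrite mulr0 addr0; case: ifP => // _; by rewrite normr0.
    have [|c ch E] := @MVT_from0 (fun t => f (x + tr k + t *: delta_mx 0 k))
       (fun t => pd k f (x + tr k + t *: delta_mx 0 k)) (h 0 k).
      move=> t th; apply: is_derive_line.
      by have [] := rH _ (K _ th) k.
    exists (pd k f (x + tr k + c *: delta_mx 0 k)).
      by rewrite distrC; have [] := rH _ (K _ ch) k.
    by rewrite -E scale0r addr0 trS addrA.
  have -> : f (h + x) - f x = \sum_(0 <= k < m) (f (x + tr k.+1) - f (x + tr k)).
    by rewrite [h + x]addrC (telescope_sumr (fun k => f (x + tr k))) // trm tr0 addr0.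
  rewrite big_mkord /lform -sumrB.
  apply: (@le_trans _ _ (\sum_(i < m) e / m.+1%:R * `|h|)).
    apply: le_trans (ler_norm_sum _ _ _) _; apply: ler_sum => k _.
    have [c ce ->] := step k; rewrite mxE [X in _ - X]mulrC -mulrBl normrM.
    by apply: ler_pM => //; exact: coord_le_norm.
  rewrite sumr_const card_ord -mulrnAl; apply: ler_wpM2r => //.
  rewrite -mulr_natr mulrAC ler_pdivrMr // ler_pM2l // ler_nat //.
split=> // h.
rewrite [in LHS](_ : h = \sum_i h 0 i *: delta_mx 0 i); last first.
  by rewrite [LHS]row_sum_delta.
rewrite linear_sum; apply: eq_bigr => i _.
by rewrite linearZ /pd deriveE.
Qed.

End RowVectors.

(** * Chain rule, Jacobians and functions of class C^k *)

Section Calculus.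
Context {R : realType}.

Definition C1at m (f : 'rV[R]_m -> R) (x : 'rV[R]_m) : Prop :=
  (\forall y \near x, forall i, derivable f y (delta_mx 0 i : 'rV[R]_m)) /\
  (forall i, {for x, continuous (pd i f)}).

Definition drow m (f : 'rV[R]_m -> R) (x : 'rV[R]_m) : 'rV[R]_m := \row_i pd i f x.

Lemma C1at_diff m (f : 'rV[R]_m -> R) x : C1at f x -> differentiable f x.
Proof. by move=> [H1 H2]; have [] := C1_differentiable H1 H2. Qed.

Lemma diff_drow m (f : 'rV[R]_m -> R) x h : differentiable f x ->
  'd f x h = \sum_i h 0 i * pd i f x.
Proof.
move=> L.
rewrite [in LHS](_ : h = \sum_i h 0 i *: delta_mx 0 i); last first.
  by rewrite [LHS]row_sum_delta.
rewrite linear_sum; apply: eq_bigr => i _.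
by rewrite linearZ /pd deriveE.
Qed.

Lemma differentiable_rV m n (F : 'rV[R]_m -> 'rV[R]_n) x :
  (forall j, differentiable (fun y => F y 0 j) x) -> differentiable F x.
Proof.
move=> H.
have -> : F = \sum_j (fun y => F y 0 j *: (delta_mx 0 j : 'rV[R]_n)).
  by apply/funext => y; rewrite fct_sumE [LHS]row_sum_delta.
by apply: differentiable_sum => j; apply: differentiableZl.
Qed.

Lemma differentiable_comp_coord m n (F : 'rV[R]_m -> 'rV[R]_n) x j :
  differentiable F x -> differentiable (fun y => F y 0 j) x.
Proof.
move=> dF; apply: (@differentiable_comp _ _ _ _ F (fun z : 'rV[R]_n => z 0 j)) => //.
exact: differentiable_coord.
Qed.

Lemma jacobianE m n (F : 'rV[R]_m -> 'rV[R]_n) x i j : differentiable F x ->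
  ('J F x) i j = pd i (fun y => F y 0 j) x.
Proof.
move=> dF; have := deriveEjacobian (delta_mx 0 i) dF.
rewrite -rowE => /(congr1 (fun z : 'rV[R]_n => z 0 j)).
rewrite derive_mx; last exact: diff_derivable.
by rewrite !mxE => <-.
Qed.

Lemma pd_comp m n (f : 'rV[R]_n -> R) (F : 'rV[R]_m -> 'rV[R]_n) x i :
  differentiable F x -> differentiable f (F x) ->
  pd i (fun y => f (F y)) x = \sum_j pd i (fun y => F y 0 j) x * pd j f (F x).
Proof.
move=> dF df; rewrite /pd deriveE; last exact: (@differentiable_comp _ _ _ _ F f).
rewrite [X in 'd X x](_ : _ = f \o F) // diff_comp //=.
rewrite diff_drow //; apply: eq_bigr => j _; congr (_ * _).
rewrite -deriveE // derive_mx ?mxE //; exact: diff_derivable.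
Qed.

Lemma drow_comp m n (f : 'rV[R]_n -> R) (F : 'rV[R]_m -> 'rV[R]_n) x :
  differentiable F x -> differentiable f (F x) ->
  drow (fun y => f (F y)) x = drow f (F x) *m ('J F x)^T.
Proof.
move=> dF df; apply/rowP => i; rewrite [LHS]mxE pd_comp // [RHS]mxE.
apply: eq_bigr => j _.
by rewrite [X in _ = X * _]mxE [X in _ = _ * X]mxE jacobianE // mulrC.
Qed.

Lemma jacobian_comp m n p (F : 'rV[R]_m -> 'rV[R]_n) (G : 'rV[R]_n -> 'rV[R]_p) x :
  differentiable F x -> differentiable G (F x) ->
  'J (fun y => G (F y)) x = 'J F x *m 'J G (F x).
Proof.
move=> dF dG; apply/matrixP => i k.
have dGF : differentiable (fun y => G (F y)) x by exact: (@differentiable_comp _ _ _ _ F G).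
rewrite jacobianE // [RHS]mxE (pd_comp _ dF (f := fun z => G z 0 k)); last first.
  exact: differentiable_comp_coord.
by apply: eq_bigr => j _; rewrite !jacobianE.
Qed.

Lemma jacobian_id m (x : 'rV[R]_m) : 'J (fun y : 'rV[R]_m => y) x = 1%:M.
Proof.
have dI : differentiable (fun y : 'rV[R]_m => y) x by [].
apply/row_matrixP => i; rewrite !rowE -deriveEjacobian // mulmx1.
exact: derive_id.
Qed.

Lemma near_eq_differentiable m (f g : 'rV[R]_m -> R) (x : 'rV[R]_m) :
  (\forall y \near x, f y = g y) -> differentiable f x -> differentiable g x.
Proof.
move=> fg df.
apply: (@differentiable_approx _ _ _ ('d f x)); first exact: diff_continuous.
move=> e e0; have /diff_locally H := df.
have := H; move=> /eqaddoP /(_ e e0) H1.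
have fgx : f x = g x by apply: nbhs_singleton fg.
have H2 : \forall h \near (0 : 'rV[R]_m), f (h + x) = g (h + x).
  have /nbhs_ballP[r /= r0 rH] := fg; apply/nbhs_ballP; exists r => //= h.
  rewrite -ball_normE /= sub0r normrN => hr; apply: rH.
  by rewrite -ball_normE /= opprD addrCA subrr addr0 normrN.
apply: filterS2 H1 H2 => h; rewrite !fctE /= => + <-.
by rewrite -fgx opprD addrA.
Qed.

Lemma near_eq_jacobian m n (F G : 'rV[R]_m -> 'rV[R]_n) (x : 'rV[R]_m) :
  (\forall y \near x, F y = G y) -> differentiable F x ->
  differentiable G x /\ 'J F x = 'J G x.
Proof.
move=> FG dF.
have dG : differentiable G x.
  apply: differentiable_rV => j.
  apply: near_eq_differentiable (differentiable_comp_coord j dF).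
  by apply: filterS FG => y ->.
split; first exact: dG.
apply/matrixP => i j; rewrite [LHS](jacobianE i j dF) [RHS](jacobianE i j dG).
apply: near_eq_derive.
by apply: filterS FG => y ->.
Qed.

(** [Ck_open] quantifies over lists of directions; this recursive form gives stability under sums,
    products, inverses and composition by induction on the order. *)
Fixpoint Ckn m (k : nat) (U : set 'rV[R]_m) (f : 'rV[R]_m -> R) : Prop :=
  (forall x, U x -> {for x, continuous f}) /\
  if k is k'.+1 then
    forall i, (forall x, U x -> derivable f x (delta_mx 0 i : 'rV[R]_m)) /\ Ckn k' U (pd i f)
  else True.

(** The last direction of the list is the innermost derivative, so peeling lists from the right
    matches the recursion of [Ckn]. *)
Lemma pder_rcons m (s : seq 'I_m) i (f : 'rV[R]_m -> R) :
  pder (rcons s i) f = pder s (pd i f).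
Proof. by rewrite /pder foldr_rcons. Qed.

Lemma Ckn_continuous m k U (f : 'rV[R]_m -> R) : Ckn k U f ->
  forall x, U x -> {for x, continuous f}.
Proof. by case: k => [|k] []. Qed.

Lemma Ckn_sub m k (U V : set 'rV[R]_m) f : V `<=` U -> Ckn k U f -> Ckn k V f.
Proof.
move=> VU; elim: k f => [|k IH] f /= [cf H]; split=> [x /VU|]; try exact: cf.
  by [].
move=> i; have [d c] := H i; split=> [x /VU|]; [exact: d|exact: IH].
Qed.

Lemma Ck_open_Ckn m (k : option nat) U (f : 'rV[R]_m -> R) (l : nat) : lek l k ->
  Ck_open k U f -> Ckn l U f.
Proof.
elim: l k f => [|l IH] k f lk H.
  by split=> // x Ux; have [] := H [::] x Ux; case: k lk {H}.
have H0 x (Ux : U x) := H [::] x Ux.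
have l0 : lek 0 k by case: k lk {H H0} => //=.
have l1 : lek 1 k by case: k lk {H H0 l0} => //= k; apply: leq_ltn_trans.
split=> [x Ux|i]; first by have [] := H0 x Ux l0.
split=> [x Ux|]; first by have [_ ] := H0 x Ux l0; apply.
(* One derivative has been spent: a finite order drops by one, and [None] stays infinite. *)
apply: (IH (omap predn k)).
  by case: k lk {H H0 l0 l1} => //= k; case: k.
move=> s x Ux sk; have := H (rcons s i) x Ux.
rewrite size_rcons pder_rcons => -[].
  by case: k sk {lk H H0 l0} l1 => //= -[].
move=> c d; split=> // sk' j; apply: d.
by case: k sk' {lk H H0 sk l0} l1 => //= -[].
Qed.

Lemma Ckn_Ck_open m U (f : 'rV[R]_m -> R) : (forall l, Ckn l U f) -> Ck_open None U f.
Proof.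
move=> H s x Ux _; elim/last_ind: s f H => [|s i IH] f H.
  split=> [|_ i]; first by have [c _] := H 0%N; exact: c.
  by have [_ /(_ i)[d _]] := H 1%N; exact: d.
rewrite size_rcons pder_rcons; apply: IH => l.
by have [_ /(_ i)[]] := H l.+1.
Qed.

Lemma Ckn_C1at m (U : set 'rV[R]_m) f x : open U -> U x -> Ckn 1 U f -> C1at f x.
Proof.
move=> oU Ux [_ H]; split=> [|i]; last by have [_ [c _]] := H i; exact: c.
have : nbhs x U by exact: open_nbhs_nbhs.
by apply: filterS => y Uy i; have [d _] := H i; exact: d.
Qed.

Lemma Ckn_eq m k (U : set 'rV[R]_m) f g : open U ->
  (forall x, U x -> f x = g x) -> Ckn k U f -> Ckn k U g.
Proof.
move=> oU; elim: k f g => [|k IH] f g fg [cf H];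
  have near_fg x : U x -> \forall y \near x, f y = g y by
    move=> Ux; have : nbhs x U by [exact: open_nbhs_nbhs]; apply: filterS;
    exact: fg.
all: have cg : forall x, U x -> {for x, continuous g} by
  move=> x Ux; suff : g y @[y --> x] --> g x by [] ; rewrite -fg //;
    apply: cvg_trans (cf x Ux); apply: (near_eq_cvg (FF := nbhs_filter x)); exact: near_fg.
  by [].
split=> // i; have [d c] := H i; split=> [x Ux|].
  apply: near_eq_derivable (d x Ux); exact: near_fg.
apply: IH c => x Ux; apply: near_eq_derive; exact: near_fg.
Qed.

Lemma Ckn_S m k (U : set 'rV[R]_m) f : Ckn k.+1 U f -> Ckn k U f.
Proof.
elim: k f => [|k IH] f /= [cf H]; split=> // i.
by have [d /IH] := H i.
Qed.

Lemma Ckn_cst m k (U : set 'rV[R]_m) (c : R) : Ckn k U (fun=> c).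
Proof.
elim: k c => [|k IH] c; (split=> [x _|]; first exact: cst_continuous).
  by [].
move=> i; split=> [x _|]; first exact: derivable_cst.
rewrite [X in Ckn k U X](_ : _ = (fun=> 0)) //.
by apply/funext => x; rewrite /pd derive_cst.
Qed.

Lemma CknD m k (U : set 'rV[R]_m) f g : open U ->
  Ckn k U f -> Ckn k U g -> Ckn k U (fun x => f x + g x).
Proof.
move=> oU; elim: k f g => [|k IH] f g [cf Hf] [cg Hg];
  (split=> [x Ux|]; first by apply: continuousD; [exact: cf|exact: cg]).
  by [].
move=> i; have [[df Df] [dg Dg]] := (Hf i, Hg i); split=> [x Ux|].
  by apply: derivableD; [exact: df|exact: dg].
apply: (@Ckn_eq _ _ _ (fun x => pd i f x + pd i g x)) (IH _ _ Df Dg) => // x Ux.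
by rewrite /pd [RHS](@deriveD _ _ _ f g) //; [exact: df|exact: dg].
Qed.

Lemma CknM m k (U : set 'rV[R]_m) f g : open U ->
  Ckn k U f -> Ckn k U g -> Ckn k U (fun x => f x * g x).
Proof.
move=> oU; elim: k f g => [|k IH] f g Hf0 Hg0;
  have [cf Hf] := Hf0; have [cg Hg] := Hg0;
  (split=> [x Ux|]; first by apply: continuousM; [exact: cf|exact: cg]).
  by [].
move=> i; have [[df Df] [dg Dg]] := (Hf i, Hg i); split=> [x Ux|].
  by apply: derivableM; [exact: df|exact: dg].
apply: (@Ckn_eq _ _ _ (fun x => f x * pd i g x + g x * pd i f x)) => // [x Ux|].
  by rewrite /pd [RHS](@deriveM _ _ f g) //; [exact: df|exact: dg].
by apply: CknD => //; apply: IH => //; exact: Ckn_S.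
Qed.

Lemma Ckn_sum m k (U : set 'rV[R]_m) (I : Type) (r : seq I) (F : I -> 'rV[R]_m -> R) :
  open U -> (forall i, Ckn k U (F i)) -> Ckn k U (fun x => \sum_(i <- r) F i x).
Proof.
move=> oU H; elim: r => [|i r IH].
  rewrite [X in Ckn k U X](_ : _ = (fun=> 0)); first exact: Ckn_cst.
  by apply/funext => x; rewrite big_nil.
rewrite [X in Ckn k U X](_ : _ = (fun x => F i x + \sum_(i <- r) F i x)).
  exact: CknD.
by apply/funext => x; rewrite big_cons.
Qed.

Lemma Ckn_prod m k (U : set 'rV[R]_m) (I : Type) (r : seq I) (F : I -> 'rV[R]_m -> R) :
  open U -> (forall i, Ckn k U (F i)) -> Ckn k U (fun x => \prod_(i <- r) F i x).
Proof.
move=> oU H; elim: r => [|i r IH].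
  rewrite [X in Ckn k U X](_ : _ = (fun=> 1)); first exact: Ckn_cst.
  by apply/funext => x; rewrite big_nil.
rewrite [X in Ckn k U X](_ : _ = (fun x => F i x * \prod_(i <- r) F i x)).
  exact: CknM.
by apply/funext => x; rewrite big_cons.
Qed.

Lemma CknV m k (U : set 'rV[R]_m) f : open U -> (forall x, U x -> f x != 0) ->
  Ckn k U f -> Ckn k U (fun x => (f x)^-1).
Proof.
move=> oU f0; elim: k => [|k IH] Hf0; have [cf Hf] := Hf0;
  (split=> [x Ux|]; first by apply: continuousV; [exact: f0|exact: cf]).
  by [].
move=> i; have [df Df] := Hf i; split=> [x Ux|].
  by apply: derivableV; [exact: f0|exact: df].
have Hk := IH (Ckn_S Hf0).
apply: (@Ckn_eq _ _ _ (fun x => -1 * ((f x)^-1 * (f x)^-1) * pd i f x)) => // [x Ux|].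
  rewrite /pd [RHS](@deriveV _ _ f) //; [|exact: f0|exact: df].
  by rewrite mulN1r -expr2 exprVn.
by apply: CknM => //; apply: CknM => //; [exact: Ckn_cst|exact: CknM].
Qed.

(** By the chain rule each partial derivative is a sum of products whose outer factors are again
    compositions with the same [F], so the induction on the order varies [f] and keeps [F] fixed. *)
Lemma Ckn_comp m n k (U : set 'rV[R]_m) (V : set 'rV[R]_n)
    (f : 'rV[R]_n -> R) (F : 'rV[R]_m -> 'rV[R]_n) :
  open U -> open V -> (forall x, U x -> V (F x)) ->
  Ckn k V f -> (forall j, Ckn k U (fun x => F x 0 j)) -> Ckn k U (fun x => f (F x)).
Proof.
move=> oU oV UV; elim: k f => [|k IH] f Hf0 HF.
all: have c : forall x, U x -> {for x, continuous (fun x => f (F x))} by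
  move=> x Ux; apply: (@continuous_comp _ _ _ F f);
   [apply: continuous_rV => j; exact: (Ckn_continuous (HF j))|
    exact: (Ckn_continuous Hf0 (UV x Ux))].
  by [].
have dF x : U x -> differentiable F x.
  move=> Ux; apply: differentiable_rV => j; apply: C1at_diff.
  apply: (Ckn_C1at oU Ux); have [cF HF'] := HF j; split=> // i.
  have [d c'] := HF' i; split=> //; split=> //; exact: Ckn_continuous c'.
have df x : U x -> differentiable f (F x).
  move=> Ux; apply: C1at_diff; apply: (Ckn_C1at oV (UV x Ux)).
  have [cf Hf'] := Hf0; split=> // i.
  have [d c'] := Hf' i; split=> //; split=> //; exact: Ckn_continuous c'.
split=> // i; split=> [x Ux|].
  apply: diff_derivable; apply: (@differentiable_comp _ _ _ _ F f); [exact: dF|exact: df].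
apply: (@Ckn_eq _ _ _ (fun x => \sum_j pd i (fun y => F y 0 j) x * pd j f (F x))) => //.
  by move=> x Ux; rewrite pd_comp //; [exact: dF|exact: df].
apply: Ckn_sum => // j; apply: CknM => //; first by have [_ /(_ i)[]] := HF j.
by apply: IH => [|j']; [have [_ /(_ j)[]] := Hf0|exact: Ckn_S].
Qed.

End Calculus.

(** * Smoothness of inverse matrices and of inverse maps *)

Section InverseMaps.
Context {R : realType}.

Lemma Ckn_local m k (A : set 'rV[R]_m) f :
  (forall x, A x -> exists U, [/\ open U, U x & Ckn k U f]) -> Ckn k A f.
Proof.
elim: k f => [|k IH] f H.
  by split=> // x /H[U [_ Ux [+ _]]]; apply.
split=> [x /H[U [_ Ux [c _]]]|i]; first exact: c.
split=> [x /H[U [_ Ux [_ /(_ i)[d _]]]]|]; first exact: d.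
by apply: IH => x /H[U [oU Ux [_ /(_ i)[_ c]]]]; exists U.
Qed.

Lemma Ck_on_Ckn m (k : option nat) (A : set 'rV[R]_m) f l : open A -> lek l k ->
  Ck_on k A f -> Ckn l A f.
Proof.
move=> oA lk H; apply: Ckn_local => x Ax.
have [U [F [oU Ux CF FE]]] := H x Ax.
exists (U `&` A); split=> //; first exact: openI.
apply: (@Ckn_eq _ _ _ _ F); first exact: openI.
  by move=> y [Uy Ay]; exact: FE.
apply: Ckn_sub (Ck_open_Ckn lk CF); exact: subIsetl.
Qed.

Lemma Ckn_Ck_on m (A B : set 'rV[R]_m) f : open A -> B `<=` A ->
  (forall l, Ckn l A f) -> Ck_on None B f.
Proof.
move=> oA BA H x Bx; exists A, f; split=> //; first exact: BA.
exact: Ckn_Ck_open.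
Qed.

Lemma Ck_on_sub m k (A B : set 'rV[R]_m) f : B `<=` A -> Ck_on k A f -> Ck_on k B f.
Proof.
move=> BA H x /BA /H[U [F [oU Ux CF FE]]].
by exists U, F; split=> // y Uy /BA; exact: FE.
Qed.

Lemma Ckn_det m n k (U : set 'rV[R]_m) (A : 'rV[R]_m -> 'M[R]_n) : open U ->
  (forall i j, Ckn k U (fun x => A x i j)) -> Ckn k U (fun x => \det (A x)).
Proof.
move=> oU H; rewrite /determinant.
apply: Ckn_sum => // s; apply: CknM => //; first exact: Ckn_cst.
by apply: Ckn_prod.
Qed.

Lemma Ckn_invmx m n k (U : set 'rV[R]_m) (A : 'rV[R]_m -> 'M[R]_n) : open U ->
  (forall x, U x -> A x \in unitmx) ->
  (forall i j, Ckn k U (fun x => A x i j)) ->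
  forall i j, Ckn k U (fun x => invmx (A x) i j).
Proof.
move=> oU uA H i j.
apply: (@Ckn_eq _ _ _ _ (fun x => (\det (A x))^-1 * cofactor (A x) j i)) => //.
  by move=> x Ux; rewrite /invmx uA // !mxE.
apply: CknM => //.
  apply: CknV => //; last exact: Ckn_det.
  by move=> x /uA; rewrite unitmxE unitfE.
apply: CknM => //; first exact: Ckn_cst.
apply: Ckn_det => // i' j'.
rewrite [X in Ckn k U X](_ : _ = fun x => A x (lift j i') (lift i j')) //.
by apply/funext => x; rewrite !mxE.
Qed.

Lemma mulmx_norm_le m n (A : 'M[R]_(m, n)) :
  exists2 C : R, 0 < C & forall v : 'rV[R]_m, `|v *m A| <= C * `|v|.
Proof.
exists (1 + \sum_i \sum_j `|A i j|) => [|v].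
  by apply: ltr_pwDl => //; apply: sumr_ge0 => i _; apply: sumr_ge0.
have S0 : 0 <= \sum_i \sum_j `|A i j|.
  by apply: sumr_ge0 => i _; apply: sumr_ge0.
apply: rV_norm_le => [|j]; first by rewrite mulr_ge0 // addr_ge0.
rewrite mxE; apply: le_trans (ler_norm_sum _ _ _) _.
apply: (@le_trans _ _ ((\sum_i `|A i j|) * `|v|)).
  rewrite mulr_suml; apply: ler_sum => i _.
  by rewrite normrM mulrC ler_wpM2l //; exact: coord_le_norm.
apply: ler_wpM2r => //; apply: ler_wpDl => //; apply: ler_sum => i _.
by rewrite (bigD1 j) //= lerDl; apply: sumr_ge0.
Qed.

Section LocalInverse.
Variables (m n : nat) (U : set 'rV[R]_m) (V : set 'rV[R]_n).
Variables (Phi : 'rV[R]_m -> 'rV[R]_n) (Psi : 'rV[R]_n -> 'rV[R]_m).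
Variable (B : 'rV[R]_m -> 'M[R]_(n, m)).
Hypotheses (oU : open U) (oV : open V).
Hypothesis PsiU : forall y, V y -> U (Psi y).
Hypothesis PhiK : forall y, V y -> Phi (Psi y) = y.
Hypothesis cPsi : forall y, V y -> {for y, continuous Psi}.
Hypothesis dPhi : forall x, U x -> differentiable Phi x.
Hypothesis JB : forall x, U x -> 'J Phi x *m B x = 1%:M.

(* With [k = Psi (y + h) - Psi y] one has [h = k A + o(k)], where [A] is the
   Jacobian; so [k] is [O(h)], and [k = h A^-1 + o(h)]. *)
Lemma inverse_differentiable y j : V y ->
  differentiable (fun z => Psi z 0 j) y /\
  forall i, pd i (fun z => Psi z 0 j) y = B (Psi y) i j.
Proof.
move=> Vy; set x := Psi y; have Ux : U x by exact: PsiU.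
set A := 'J Phi x; have AB : A *m B x = 1%:M := JB Ux.
have [C C0 HC] := mulmx_norm_le (B x).
pose L (w : 'rV[R]_n) := lform (\row_i B x i j) w.
have LE w : L w = (w *m B x) 0 j.
  by rewrite /L /lform mxE; apply: eq_bigr => i _; rewrite mxE.
have main (e : R) : 0 < e ->
  \forall h \near (0 : 'rV[R]_n), `|Psi (h + y) - Psi y - h *m B x| <= e * `|h|.
  move=> e0.
  (* The first bound makes [C * d] at most 1/2, so the error is absorbed by half the norm of [k],
     which gives that [k] is at most [2 * C] times [h]; the second turns the remaining error into
     [e] times the norm of [h]. *)
  pose d := Num.min (2 * C)^-1 (e / (2 * C ^+ 2)).
  have d0 : 0 < d by rewrite lt_min invr_gt0 divr_gt0 // mulr_gt0 // exprn_gt0.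
  have /diff_locally /eqaddoP /(_ d d0) /nbhs_ballP[r /= r0 rH] := dPhi Ux.
  have /cvgrPdist_lt /(_ r r0) c1 := cPsi Vy.
  have Vn : nbhs y V by exact: open_nbhs_nbhs.
  have [s /= s0 sH] := (nbhs_ballP y _).1 (@filterI _ (nbhs y) (nbhs_filter y) _ _ c1 Vn).
  apply/nbhs_ballP; exists s => //= h; rewrite -ball_normE /= sub0r normrN => hs.
  have [|H1 H2] := sH (h + y).
    by rewrite -ball_normE /= opprD addrCA subrr addr0 normrN.
  set k := Psi (h + y) - Psi y.
  have Hk : `|k| < r by rewrite distrC.
  have := rH k; rewrite -ball_normE /= sub0r normrN => /(_ Hk).
  rewrite !fctE /= -/x subrK !PhiK // -deriveE; last exact: dPhi.
  rewrite deriveEjacobian; last exact: dPhi.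
  rewrite -/A opprD addrA addrK => H3.
  have H4 : `|k - h *m B x| <= C * (d * `|k|).
    have -> : k - h *m B x = - ((h - k *m A) *m B x).
      by rewrite mulmxBl -mulmxA AB mulmx1 opprB.
    rewrite normrN; apply: le_trans (HC _) _; exact: (ler_wpM2l (ltW C0) H3).
  have H5 : C * (d * `|k|) <= `|k| / 2.
    rewrite mulrA mulrC ler_wpM2l // -ler_pdivlMl // -invfM mulrC.
    by rewrite /d ge_min lexx.
  have H6 : `|k| <= 2 * C * `|h|.
    have : `|k| <= `|k| / 2 + C * `|h|.
      rewrite -[in leLHS](subrK (h *m B x) k); apply: le_trans (ler_normD _ _) _.
      by apply: lerD; [exact: le_trans H4 H5|exact: HC].
    by lra.
  apply: le_trans H4 _.
  have de : d <= e / (2 * C ^+ 2) by rewrite /d ge_min lexx orbT.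
  apply: (@le_trans _ _ (C * (e / (2 * C ^+ 2) * (2 * C * `|h|)))).
    apply: ler_wpM2l; first exact: ltW.
    by apply: ler_pM => //; exact: ltW.
  rewrite le_eqVlt; apply/orP; left; apply/eqP; field; exact: lt0r_neq0.
have dPsi : differentiable (fun z => Psi z 0 j) y.
  apply: (@differentiable_approx _ _ _ (lform (\row_i B x i j))).
    exact: lform_continuous.
  move=> e e0; apply: filterS (main e e0) => h; apply: le_trans.
  rewrite /= (LE h : lform (\row_i B x i j) h = _).
  by apply: le_trans (coord_le_norm _ j); rewrite !mxE.
split=> // i; rewrite /pd deriveE //.
have E : 'd (fun z : 'rV[R]_n => Psi z 0 j) y = lform (\row_i B x i j) :> (_ -> _).
  apply: diff_unique; first exact: lform_continuous.
  apply/eqaddoP => e e0; apply: filterS (main e e0) => h; apply: le_trans.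
  rewrite !fctE /= (LE h : lform (\row_i B x i j) h = _) opprD addrA.
  by apply: le_trans (coord_le_norm _ j); rewrite !mxE.
rewrite E /lform (bigD1 i) //= big1 ?addr0 => [|k ki]; rewrite !mxE ?eqxx.
  by rewrite mul1r.
by rewrite (negbTE ki) mul0r.
Qed.

(** Bootstrapping: the derivative of [Psi] is [B] composed with [Psi], hence as regular as [Psi]
    itself, and each round gains one order. *)
Lemma inverse_smooth : (forall l i j, Ckn l U (fun x => B x i j)) ->
  forall l j, Ckn l V (fun z => Psi z 0 j).
Proof.
move=> HB l; elim: l => [|l IH] j; (split=> [y Vy|];
  first by apply: differentiable_continuous; have [] := inverse_differentiable j Vy).
  by [].
move=> i; split=> [y Vy|].
  by apply: diff_derivable; have [] := inverse_differentiable j Vy.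
apply: (@Ckn_eq _ _ _ _ (fun z => B (Psi z) i j)) => // [y Vy|].
  by have [_ ->] := inverse_differentiable j Vy.
exact: (Ckn_comp oV oU PsiU (HB l i j) IH).
Qed.

End LocalInverse.

End InverseMaps.

(** * Lebesgue measure as a measure on row vectors *)

Notation brl T := (g_sigma_algebraType (@open T)).

Section BorelSets.
Context {R : realType}.

Lemma open_brl (T : ptopologicalType) (A : set T) : open A -> measurable (A : set (brl T)).
Proof. by move=> oA; apply: sub_sigma_algebra. Qed.

Lemma within_measurable_brl (S T : ptopologicalType) (D : set S) (f : S -> T) :
  measurable (D : set (brl S)) -> {within D, continuous f} ->
  measurable_fun (D : set (brl S)) (f : brl S -> brl T).
Proof.
move=> mD cf.
apply: (@measurability _ _ (brl S) (brl T) D f (@open T)); first by [].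
move=> _ [V oV <-].
have := (continuousP _).1 cf V oV.
move=> /open_subspaceP [U oU E].
rewrite setIC -E; apply: measurableI => //; exact: open_brl.
Qed.

Lemma within_measurable_real (S : ptopologicalType) (D : set S) (f : S -> R) :
  measurable (D : set (brl S)) -> {within D, continuous f} ->
  measurable_fun (D : set (brl S)) (f : brl S -> R).
Proof.
move=> mD cf.
apply: (measurability _ (RGenOpens.measurableE R)).
move=> _ [_ [a [b ->] <-]].
have := (continuousP _).1 cf _ (@interval_open _ (BRight a) (BLeft b) isT isT).
move=> /open_subspaceP [U oU E].
rewrite setIC -E; apply: measurableI => //; exact: open_brl.
Qed.

Lemma coord_measurable m (i : 'I_m) :
  measurable_fun setT ((fun x : 'rV[R]_m => x 0 i) : brl 'rV[R]_m -> R).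
Proof.
apply: within_measurable_real; first exact: measurableT.
by apply: continuous_subspaceT => x; exact: coord_continuous.
Qed.

Definition rat_cube m (p : 'rV[rat]_m * rat) : set 'rV[R]_m :=
  [set x | forall i, `|x 0 i - ratr (p.1 0 i)| < ratr p.2].

(** Rational cubes form a countable base, which is what reduces measurability of a row-valued map to
    that of its coordinates: an open set becomes a countable union of finite intersections of
    conditions on one coordinate. *)
Lemma open_rat_cubes m (O : set 'rV[R]_m) : open O ->
  O = \bigcup_(p in [set p | rat_cube p `<=` O]) rat_cube p.
Proof.
move=> oO; apply/seteqP; split=> [x Ox|x [p pO px]]; last exact: pO.
have /nbhs_cubeP[r r0 rO] : nbhs x O by exact: open_nbhs_nbhs.
have [q /[!in_itv] /= /andP[q0 qr]] := rat_in_itvoo (divr_gt0 r0 (ltr0n R 2)).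
have H i : exists t : rat, `|x 0 i - ratr t| < ratr q.
  have xq : x 0 i - ratr q < x 0 i + ratr q by rewrite ltrD2l gtrN.
  have [t /[!in_itv] /= /andP[t1 t2]] := rat_in_itvoo xq.
  by exists t; rewrite distrC ltr_distl t1 t2.
have [t Ht] := choice H.
exists (\row_i t i, q); last by move=> i; rewrite mxE.
move=> y /= yt; apply: rO => i.
have := yt i; rewrite mxE => H1.
rewrite -(subrKA (ratr (t i))) (le_lt_trans (ler_normD _ _)) //.
rewrite (splitr r) ltrD //; first exact: lt_trans qr.
by rewrite distrC; exact: lt_trans (Ht i) qr.
Qed.

Lemma measurable_rV d (T : measurableType d) m (D : set T) (f : T -> 'rV[R]_m) :
  (forall i, measurable_fun D (fun t => f t 0 i)) ->
  measurable_fun D (f : T -> brl 'rV[R]_m).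
Proof.
move=> mf mD.
suff : measurable_fun D (f : T -> brl 'rV[R]_m) by apply.
apply: (@measurability _ _ T (brl 'rV[R]_m) D f (@open 'rV[R]_m)); first by [].
move=> _ [V /open_rat_cubes-> <-].
rewrite preimage_bigcup setI_bigcupr bigcup_mkcond.
apply: countable_bigcupT_measurable => [|p]; first exact: countableP.
case: ifP => _ //.
rewrite (_ : _ `&` _ = D `&` \big[setI/setT]_(i < m)
   (D `&` (fun t => f t 0 i) @^-1` (ball (ratr (p.1 0 i) : R) (ratr p.2) : set R))).
  apply: measurableI => //; apply: bigsetI_measurable => i _.
  apply: mf => //; rewrite ball_itv; exact: measurable_itv.
apply/seteqP; split=> t.
  move=> [Dt pt]; split=> //; rewrite -bigcap_seq => i _ /=; split=> //.
  by rewrite -ball_normE /= distrC; exact: pt.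
move=> [Dt]; rewrite -bigcap_seq => H; split=> // i.
have [_] := H i (mem_index_enum i).
by rewrite /= -ball_normE /= distrC.
Qed.

End BorelSets.

(** * Adding one coordinate to a measure on rows *)

Section RowMeasure.
Context {R : realType} {m : nat}.
Variable nu : {sigma_finite_measure set (brl 'rV[R]_m) -> \bar R}.

Definition row_cons (p : R * 'rV[R]_m) : 'rV[R]_(1 + m) :=
  row_mx (p.1%:M : 'rV[R]_1) p.2.

Lemma row_consE p (i : 'I_(1 + m)) :
  row_cons p 0 i = match fintype.split i with inl _ => p.1 | inr j => p.2 0 j end.
Proof.
rewrite /row_cons mxE; case: splitP => // j _.
by rewrite !ord1 mxE mulr1n.
Qed.

Lemma measurable_row_cons : measurable_fun setT (row_cons : measurableTypeR R * brl 'rV[R]_m -> brl 'rV[R]_(1 + m)).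
Proof.
apply: measurable_rV => i.
under eq_fun do rewrite row_consE.
case: fintype.split => [_|j]; first exact: measurable_fst.
exact: (measurableT_comp (coord_measurable j) measurable_snd).
Qed.

Definition row_uncons (x : 'rV[R]_(1 + m)) : R * 'rV[R]_m := (lsubmx x 0 0, rsubmx x).

Lemma measurable_row_uncons : measurable_fun setT (row_uncons : brl 'rV[R]_(1 + m) -> measurableTypeR R * brl 'rV[R]_m).
Proof.
apply/measurable_fun_pairP; split.
  rewrite (_ : _ \o _ = (fun x : 'rV[R]_(1 + m) => x 0 (lshift m 0))).
    exact: coord_measurable.
  by apply/funext => x; rewrite /= mxE.
apply: measurable_rV => i.
rewrite (_ : (fun _ => _) = (fun x : 'rV[R]_(1 + m) => x 0 (rshift 1 i))).
  exact: coord_measurable.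
by apply/funext => x; rewrite /= mxE.
Qed.

Lemma row_consK : cancel row_cons row_uncons.
Proof.
by move=> [t y]; rewrite /row_uncons /row_cons row_mxKl row_mxKr mxE mulr1n.
Qed.

(** Adds a coordinate as the recursion of [lebint] does, the new variable being the outermost
    one. *)
Definition row_measure : set (brl 'rV[R]_(1 + m)) -> \bar R :=
  pushforward ((@lebesgue_measure R) \x nu)%E
    (row_cons : measurableTypeR R * brl 'rV[R]_m -> brl 'rV[R]_(1 + m)).

Let row_measure0 : row_measure set0 = 0%E.
Proof. by rewrite /row_measure /pushforward preimage_set0 measure0. Qed.

Let row_measure_ge0 A : (0 <= row_measure A)%E.
Proof. by rewrite /row_measure /pushforward measure_ge0. Qed.

Let row_measure_sigma_additive : semi_sigma_additive row_measure.
Proof.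
move=> F mF tF mUF; rewrite /row_measure /pushforward preimage_bigcup.
have mrow A : measurable (A : set (brl 'rV[R]_(1 + m))) ->
    measurable (row_cons @^-1` A : set (measurableTypeR R * brl 'rV[R]_m)).
  by move=> mA; rewrite -[X in measurable X]setTI; exact: measurable_row_cons.
apply: measure_semi_sigma_additive.
- by move=> n; exact: mrow.
- apply/trivIsetP => /= i j _ _ ij; rewrite -preimage_setI.
  by move/trivIsetP : tF => /(_ _ _ _ _ ij) ->//; rewrite preimage_set0.
- by rewrite -preimage_bigcup; exact: mrow.
Qed.

HB.instance Definition _ := isMeasure.Build _ _ _ row_measure
  row_measure0 row_measure_ge0 row_measure_sigma_additive.

(** Carried along because Tonelli's theorem asks for it when the next coordinate is added. *)
Let row_measure_sigma_finite : sigma_finite setT row_measure.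
Proof.
have /sigma_finiteP[F [TF ndF Foo]] := sigma_finiteT (@lebesgue_measure R).
have /sigma_finiteP[G [TG ndG Goo]] := sigma_finiteT nu.
exists (fun n => row_uncons @^-1` (F n `*` G n)).
  rewrite -preimage_bigcup -[LHS](preimage_setT row_uncons); congr (_ @^-1` _).
  apply/seteqP; split=> // -[x y] _.
  have [k _ Fk] : (\bigcup_i F i) x by rewrite -TF.
  have [n _ Gn] : (\bigcup_i G i) y by rewrite -TG.
  exists (maxn k n) => //; split=> /=.
  - by move: x Fk; exact/subsetPset/ndF/leq_maxl.
  - by move: y Gn; exact/subsetPset/ndG/leq_maxr.
move=> k; have [mF Fk] := Foo k; have [mG Gk] := Goo k; split.
  by rewrite -[X in measurable X]setTI; apply: measurable_row_uncons => //; exact: measurableX.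
rewrite /row_measure /pushforward -comp_preimage.
rewrite (_ : row_uncons \o row_cons = id); last by apply/funext => x; exact: row_consK.
by rewrite preimage_id product_measure1E // lte_mul_pinfty // ge0_fin_numE.
Qed.

HB.instance Definition _ := Measure_isSigmaFinite.Build _ _ _ row_measure
  row_measure_sigma_finite.

Lemma integral_row_measure (f : 'rV[R]_(1 + m) -> \bar R) :
  measurable_fun [set: brl 'rV[R]_(1 + m)] f -> (forall x, 0 <= f x)%E ->
  (\int[row_measure]_x f x =
   \int[@lebesgue_measure R]_t \int[nu]_y f (row_cons (t, y)))%E.
Proof.
move=> mf f0.
have -> : (\int[row_measure]_x f x = \int[@lebesgue_measure R \x nu]_p f (row_cons p))%E.
  have := @ge0_integral_pushforward _ _ _ _ _ _ measurable_row_cons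
    (@lebesgue_measure R \x nu)%E setT f measurableT mf.
  by rewrite preimage_setT; apply.
rewrite (@fubini_tonelli1 _ _ (measurableTypeR R) (brl (matrix R 1 m)) _ _ _ (f \o row_cons)) //.
  exact: measurableT_comp measurable_row_cons.
by move=> x; exact: f0.
Qed.

End RowMeasure.

Section LebesgueMeasureRV.
Context {R : realType}.

(** Integration against a single measure, in place of iterated integrals, gives access to
    monotonicity, image measures and Tonelli. In dimension zero the measure is the Dirac mass at the
    only row. *)
Lemma lebm_exists m : exists nu : {sigma_finite_measure set (brl 'rV[R]_m) -> \bar R},
  forall f : 'rV[R]_m -> \bar R,
    measurable_fun [set: brl 'rV[R]_m] f -> (forall x, 0 <= f x)%E ->
    lebint f = (\int[nu]_x f x)%E.
Proof.
elim: m => [|m [nu IH]].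
  exists (\d_(0 : brl 'rV[R]_0)) => f mf f0 /=.
  by rewrite integral_dirac // diracT mul1e.
exists (row_measure nu) => f mf f0 /=.
rewrite integral_row_measure //; apply: eq_integral => t _.
rewrite IH //.
exact: (measurableT_comp mf (measurableT_comp measurable_row_cons (pair1_measurable t))).
Qed.

Definition lebm m : {sigma_finite_measure set (brl 'rV[R]_m) -> \bar R} :=
  projT1 (cid (lebm_exists m)).

Lemma lebintE m (f : 'rV[R]_m -> \bar R) :
  measurable_fun [set: brl 'rV[R]_m] f -> (forall x, 0 <= f x)%E ->
  lebint f = (\int[lebm m]_x f x)%E.
Proof. exact: (projT2 (cid (lebm_exists m))). Qed.

End LebesgueMeasureRV.

(** * Homotheties and Lebesgue measure *)

Section AffineChange.
Context {R : realType}.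
Local Notation leb := (@lebesgue_measure R).

Definition affine1 (a s : R) : measurableTypeR R -> measurableTypeR R := fun t => a + s * t.

Lemma measurable_affine1 (a s : R) : measurable_fun setT (affine1 a s).
Proof.
apply: continuous_measurable_fun => t; apply: continuousD; first exact: cst_continuous.
by apply: continuousM; [exact: cst_continuous|exact: cvg_id].
Qed.

Section AffineMeasure.
Variables (a s : R) (s0 : 0 < s).

Definition affine_push : set (measurableTypeR R) -> \bar R :=
  fun A => leb (affine1 a s @^-1` A).

Let maff A : measurable A -> measurable (affine1 a s @^-1` A).
Proof. by move=> mA; rewrite -[X in measurable X]setTI; exact: measurable_affine1. Qed.

Let affine_push0 : affine_push set0 = 0%E.
Proof. by rewrite /affine_push preimage_set0 measure0. Qed.

Let affine_push_ge0 A : (0 <= affine_push A)%E.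
Proof. by rewrite /affine_push measure_ge0. Qed.

Let affine_push_sigma_additive : semi_sigma_additive affine_push.
Proof.
move=> F mF tF mUF; rewrite /affine_push preimage_bigcup.
apply: measure_semi_sigma_additive => [n| |].
- exact: maff.
- apply/trivIsetP => /= i j _ _ ij; rewrite -preimage_setI.
  by move/trivIsetP : tF => /(_ _ _ _ _ ij) ->//; rewrite preimage_set0.
- by rewrite -preimage_bigcup; exact: maff.
Qed.

HB.instance Definition _ := isMeasure.Build _ _ _ affine_push
  affine_push0 affine_push_ge0 affine_push_sigma_additive.

(** Lebesgue measure is determined by its values on half-open intervals, and the affine map pulls
    such intervals back to such intervals. *)
Lemma lebesgue_affine A : measurable A ->
  leb A = mscale (NngNum (ltW s0)) affine_push A.
Proof.
move: A; apply: lebesgue_measure_unique => _ [[x y] /= _ <-].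
rewrite /mscale /= /affine_push.
rewrite (_ : _ @^-1` _ = `](x - a) / s, (y - a) / s]%classic); last first.
  by apply/seteqP; split => t /=; rewrite !in_itv /= /affine1;
    rewrite ltr_pdivrMr // ler_pdivlMr // ltrBlDl lerBrDl [t * s]mulrC.
rewrite !lebesgue_measure_itv /= !lte_fin ltr_pM2r ?invr_gt0 // ltrD2r.
case: ifPn => _; last by rewrite mule0.
rewrite -EFinB -EFinM; congr EFin; field; exact: lt0r_neq0.
Qed.

Lemma integral_affine1 (f : R -> \bar R) : measurable_fun setT f ->
  (forall t, 0 <= f t)%E ->
  (\int[leb]_t f (a + s * t)%R = (s^-1)%:E * \int[leb]_t f t)%E.
Proof.
move=> mf f0.
have -> : (\int[leb]_t f t = \int[mscale (NngNum (ltW s0)) affine_push]_t f t)%E.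
  by apply: eq_measure_integral => A mA _; exact: lebesgue_affine.
rewrite ge0_integral_mscale //=.
have -> : (\int[affine_push]_t f t = \int[leb]_t f (a + s * t)%R)%E.
  have := @ge0_integral_pushforward _ _ _ _ _ _ (measurable_affine1 a s) leb setT f measurableT mf.
  by rewrite preimage_setT; apply.
by rewrite muleA -EFinM mulVf ?gt_eqF // mul1e.
Qed.

End AffineMeasure.

Lemma measurable_affine m (a : 'rV[R]_m) (s : R) :
  measurable_fun setT ((fun x => a + s *: x) : brl 'rV[R]_m -> brl 'rV[R]_m).
Proof.
apply: measurable_rV => i.
under eq_fun do rewrite !mxE.
apply: measurable_funD; first exact: measurable_cst.
apply: measurable_funM; first exact: measurable_cst.
exact: coord_measurable.
Qed.

(** Back in iterated form, the homothety acts on one coordinate at a time, and each coordinate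
    contributes a factor [s^-1]. *)
Lemma integral_affine m (a : 'rV[R]_m) (s : R) (f : 'rV[R]_m -> \bar R) : 0 < s ->
  measurable_fun [set: brl 'rV[R]_m] f -> (forall x, 0 <= f x)%E ->
  (\int[lebm m]_x f (a + s *: x)%R = ((s ^- m)%:E * \int[lebm m]_x f x))%E.
Proof.
move=> s0 mf f0.
have maf (b : 'rV[R]_m) : measurable_fun [set: brl 'rV[R]_m] (fun x => f (b + s *: x)).
  exact: (measurableT_comp mf (measurable_affine b s)).
rewrite -!lebintE //; elim: m a f mf f0 {maf} => [|m IH] a f mf f0 /=.
  by rewrite expr0 invr1 mul1e thinmx0.
pose a' : 'rV[R]_(1 + m) := a.
pose g (t : R) := lebint (fun y : 'rV[R]_m => f (row_mx (t%:M : 'rV[R]_1) y)).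
have mft t : measurable_fun [set: brl 'rV[R]_m]
    (fun y : 'rV[R]_m => f (row_mx (t%:M : 'rV[R]_1) y)).
  exact: (measurableT_comp mf (measurableT_comp measurable_row_cons (pair1_measurable t))).
have gE : g = fubini_F (lebm m) (f \o row_cons).
  by apply/funext => t; rewrite /g lebintE.
have mg : measurable_fun setT g.
  rewrite gE; apply: measurable_fun_fubini_tonelli_F.
    exact: measurableT_comp mf measurable_row_cons.
  by move=> x; exact: f0.
have g0 t : (0 <= g t)%E.
  by rewrite gE; apply: integral_ge0 => y _; exact: f0.
transitivity ((s ^- m)%:E * \int[leb]_t g (lsubmx a' 0%R 0%R + s * t)%R)%E.
  rewrite -ge0_integralZl //; last 2 first.
  - exact: (measurableT_comp mg (measurable_affine1 (lsubmx a' 0 0) s)).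
  - by rewrite lee_fin invr_ge0 exprn_ge0 // ltW.
  apply: eq_integral => t _; rewrite /g -(IH (rsubmx a')) //.
  congr (lebint _); apply/funext => y; congr f.
  have E (c : 'rV[R]_(1 + m)) : c + s *: row_mx (t%:M : 'rV[R]_1) y =
      row_mx ((lsubmx c 0 0 + s * t)%:M) (rsubmx c + s *: y).
    rewrite -[in LHS](hsubmxK c) scale_row_mx add_row_mx; congr row_mx.
    by rewrite [lsubmx c in LHS]mx11_scalar scale_scalar_mx -raddfD.
  exact: (E a').
rewrite integral_affine1 // muleA -EFinM; congr (_%:E * _)%E.
by rewrite exprS invfM mulrC.
Qed.

End AffineChange.

(** * The Poincare inequality on convex sets *)

Section StarShaped.
Context {R : realType}.
Local Notation leb := (@lebesgue_measure R).

Lemma sqr_sum_le n (b : 'I_n -> R) : (\sum_i b i) ^+ 2 <= n%:R * \sum_i b i ^+ 2.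
Proof.
rewrite expr2 mulr_suml.
under eq_bigr do rewrite mulr_sumr.
apply: (@le_trans _ _ (\sum_i \sum_j (b i ^+ 2 / 2 + b j ^+ 2 / 2))).
  apply: ler_sum => i _; apply: ler_sum => j _.
  by have := sqr_ge0 (b i - b j); nra.
set S := \sum_i b i ^+ 2.
have T : \sum_j b j ^+ 2 / 2 = S / 2 by rewrite /S mulr_suml.
have E i : \sum_j (b i ^+ 2 / 2 + b j ^+ 2 / 2) = n%:R * (b i ^+ 2 / 2) + S / 2.
  by rewrite big_split /= sumr_const card_ord -T mulr_natl.
under eq_bigr do rewrite E.
rewrite big_split /= -mulr_sumr T sumr_const card_ord -[S / 2 *+ n]mulr_natl.
by rewrite -mulrDr -splitr.
Qed.

(* [g^2 >= 2 c g - c^2] with [c] the increment; the right-hand side integrates to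
   at least [c^2]. *)
Lemma sq_increment_le (phi dphi : R -> R) (th : R) : 0 <= th < 1 ->
  (forall s : R, th <= s <= 1 -> is_derive s 1 phi (dphi s)) ->
  {within `[th, 1%R], continuous dphi} ->
  (((phi 1 - phi th) ^+ 2)%:E <= \int[leb]_(s in `[th, 1%R]) ((dphi s) ^+ 2)%:E)%E.
Proof.
move=> /andP[th0 th1] dp cd; set c := phi 1 - phi th.
have cts (g : R -> R) : {within `[th, 1%R], continuous g} ->
    leb.-integrable `[th, 1%R] (EFin \o g).
  by move=> cg; apply: continuous_compact_integrable => //; exact: segment_compact.
pose f s := 2 * c * dphi s - c ^+ 2.
pose F s := 2 * c * phi s - c ^+ 2 * s.
have cf : {within `[th, 1%R], continuous f}.
  move=> s; rewrite /f; apply: cvgB; last exact: cvg_cst.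
  by apply: cvgM; [exact: cvg_cst|exact: cd].
have dF (s : R) : th <= s <= 1 -> is_derive s 1 F (f s).
  move=> sth; have ds := dp s sth; apply: is_derive_eq.
  by rewrite /f /GRing.scale /=; ring.
have FTC : (\int[leb]_(s in `[th, 1%R]) (f s)%:E = (F 1)%:E - (F th)%:E)%E.
  apply: continuous_FTC2 => //.
    have cF s : th <= s <= 1 -> {for s, continuous F}.
      move=> /dF ds; apply: differentiable_continuous; apply/derivable1_diffP.
      exact: ex_derive.
    split=> [s| |].
    - by rewrite in_itv /= => /andP[/ltW s1 /ltW s2]; have := dF s; rewrite s1 s2 => /(_ isT) ds; exact: ex_derive.
    - by apply: cvg_at_right_filter; apply: cF; rewrite lexx ltW.
    - by apply: cvg_at_left_filter; apply: cF; rewrite lexx ltW.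
  move=> s; rewrite in_itv /= => /andP[/ltW s1 /ltW s2].
  by rewrite derive1E; have := dF s; rewrite s1 s2 => /(_ isT) ds; rewrite derive_val.
apply: (@le_trans _ _ (\int[leb]_(s in `[th, 1%R]) (f s)%:E)%E).
  rewrite FTC -EFinB lee_fin /F.
  have -> : 2 * c * phi 1 - c ^+ 2 * 1 - (2 * c * phi th - c ^+ 2 * th) =
     2 * c * c - c ^+ 2 * (1 - th) by rewrite /c; ring.
  by have := sqr_ge0 c; nra.
apply: le_integral.
- exact: measurable_itv.
- exact: (cts f).
- by apply: (cts (fun s => dphi s ^+ 2)) => s; exact: (cvgM (cd s) (cd s)).
- by move=> s _; rewrite lee_fin /f; have := sqr_ge0 (dphi s - c); nra.
Qed.

Definition gsq m (f : 'rV[R]_m -> R) (x : 'rV[R]_m) : R := \sum_i pd i f x ^+ 2.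

Lemma gsq_ge0 m (f : 'rV[R]_m -> R) x : 0 <= gsq f x.
Proof. by apply: sumr_ge0 => i _; exact: sqr_ge0. Qed.

Lemma open_continuous_measurable m (Q : set 'rV[R]_m) (f : 'rV[R]_m -> R) : open Q ->
  (forall x, Q x -> {for x, continuous f}) ->
  measurable_fun (Q : set (brl 'rV[R]_m)) f.
Proof.
move=> oQ cf; apply: within_measurable_real; first exact: open_brl.
rewrite continuous_open_subspace // => x; rewrite inE; exact: cf.
Qed.

Lemma gsq_measurable m (Q : set 'rV[R]_m) (f : 'rV[R]_m -> R) : open Q -> Ckn 1 Q f ->
  measurable_fun (Q : set (brl 'rV[R]_m)) (gsq f).
Proof.
move=> oQ [_ H]; apply: measurable_sum => i; apply: measurable_funX.
by apply: open_continuous_measurable => // x Qx; have [_ [c _]] := H i; exact: c.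
Qed.

(** The ray is followed only from parameter [th] on: integrating over [x] later brings in
    homotheties of ratio [s], whose Jacobian degenerates as [s] tends to 0. The factor
    [m%:R * r ^+ 2] comes from Cauchy-Schwarz applied to the directional derivative. *)
Lemma ray_increment_le m (Q : set 'rV[R]_m) (f : 'rV[R]_m -> R) (a x : 'rV[R]_m) (th r : R) :
  open Q -> Ckn 1 Q f -> 0 < th < 1 ->
  (forall s : R, th <= s <= 1 -> Q (a + s *: (x - a))) ->
  (forall i, `|x 0 i - a 0 i| <= r) ->
  (((f x - f (a + th *: (x - a))) ^+ 2)%:E <=
   (m%:R * r ^+ 2)%:E * \int[leb]_(s in `[th, 1%R]) (gsq f (a + s *: (x - a)))%:E)%E.
Proof.
move=> oQ Cf /andP[th0 th1] Qs xr.
pose phi (s : R) := f (a + s *: (x - a)).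
pose dphi (s : R) := \sum_i (x - a) 0 i * pd i f (a + s *: (x - a)).
have dp (s : R) : th <= s <= 1 -> is_derive s 1 phi (dphi s).
  move=> /Qs Qx; have df : differentiable f (a + s *: (x - a)).
    by apply: C1at_diff; exact: Ckn_C1at Cf.
  have := is_derive_line (diff_derivable (v := x - a) df).
  by rewrite deriveE // diff_drow.
have cray (s : R) : {for s, continuous (fun s : R => a + s *: (x - a))}.
  apply: continuousD; first exact: cst_continuous.
  by apply: continuousZl; exact: cvg_id.
have cpd i : {within `[th, 1%R], continuous (fun s : R => pd i f (a + s *: (x - a)))}.
  apply/continuous_in_subspaceT => s; rewrite inE /= in_itv /= => /Qs Qx.
  apply: (continuous_comp (cray s)).
  by have [_ /(_ i)[_ [c _]]] := Cf; exact: c.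
have cd : {within `[th, 1%R], continuous dphi}.
  apply: continuous_big => [|i _]; first exact: add_continuous.
  by move=> s; apply: cvgM; [exact: cvg_cst|exact: cpd].
have th01 : 0 <= th < 1 by rewrite ltW.
have cg : {within `[th, 1%R], continuous (fun s : R => gsq f (a + s *: (x - a)))}.
  apply: continuous_big => [|i _]; first exact: add_continuous.
  by move=> s; exact: (cvgM (cpd i s) (cpd i s)).
have mitv (g : R -> R) : {within `[th, 1%R], continuous g} -> measurable_fun `[th, 1%R] g.
  by move=> ?; apply: subspace_continuous_measurable_fun => //; exact: measurable_itv.
have := sq_increment_le th01 dp cd.
rewrite /phi scale1r subrKC => /le_trans; apply.
rewrite -ge0_integralZl //=; last 3 first.
- by apply/measurable_EFinP; exact: mitv.
- by move=> s _; rewrite lee_fin gsq_ge0.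
- by rewrite lee_fin mulr_ge0 // sqr_ge0.
apply: ge0_le_integral => //=.
- by move=> s _; rewrite lee_fin sqr_ge0.
- by apply/measurable_EFinP; apply: measurable_funX; exact: mitv.
- apply/measurable_EFinP; apply: measurable_funM; first exact: measurable_cst.
  exact: mitv.
move=> s _; rewrite lee_fin; apply: le_trans (sqr_sum_le _) _.
rewrite -mulrA ler_wpM2l // /gsq mulr_sumr; apply: ler_sum => i _.
rewrite exprMn ler_wpM2r ?sqr_ge0 // !mxE -real_normK ?num_real //.
by rewrite lerXn2r // nnegrE ?(le_trans _ (xr i)).
Qed.

Lemma lebm_ge0_patch m (A : set 'rV[R]_m) (g : 'rV[R]_m -> R) :
  (forall x, 0 <= g x) -> forall x, (0 <= ((fun y => (g y)%:E) \_ A) x)%E.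
Proof. by move=> g0 x; rewrite /patch; case: ifP => // _; rewrite lee_fin. Qed.

Lemma sub_ray m (a x : 'rV[R]_m) (s : R) : a + s *: (x - a) = (a - s *: a) + s *: x.
Proof. by rewrite scalerBr addrA addrAC. Qed.

(* Integrate [ray_increment_le] over [Q]; the homothety of ratio [s] centred at [a]
   maps [Q] into itself and has Jacobian [s ^ m], which is at least [th ^ m]. *)
Lemma poincare_star m (Q U : set 'rV[R]_m) (f : 'rV[R]_m -> R) (a : 'rV[R]_m) (th r : R) :
  open Q -> Ckn 1 Q f -> 0 < th < 1 ->
  (forall x (s : R), Q x -> th <= s <= 1 -> Q (a + s *: (x - a))) ->
  (forall x i, Q x -> `|x 0 i - a 0 i| <= r) ->
  measurable (U : set (brl 'rV[R]_m)) -> U `<=` Q ->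
  (forall x, Q x -> U (a + th *: (x - a))) ->
  (\int[lebm m]_(x in Q) ((f x) ^+ 2)%:E <=
   (2 * th ^- m)%:E * (\int[lebm m]_(x in U) ((f x) ^+ 2)%:E +
     (m%:R * r ^+ 2)%:E * \int[lebm m]_(x in Q) (gsq f x)%:E))%E.
Proof.
move=> oQ Cf th01 Qs xr mU UQ Uth; have /andP[th0 th1] := th01.
have mQ : measurable (Q : set (brl 'rV[R]_m)) by exact: open_brl.
set K := m%:R * r ^+ 2; have K0 : 0 <= K by rewrite mulr_ge0 // sqr_ge0.
have mf : measurable_fun (Q : set (brl 'rV[R]_m)) (fun x => (f x) ^+ 2).
  by apply: measurable_funX; apply: open_continuous_measurable => //; case: Cf.
pose F := (fun x : brl 'rV[R]_m => ((f x) ^+ 2)%:E) \_ U.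
pose G := (fun x : brl 'rV[R]_m => (gsq f x)%:E) \_ Q.
have F0 x : (0 <= F x)%E by apply: lebm_ge0_patch => y; exact: sqr_ge0.
have G0 x : (0 <= G x)%E by apply: lebm_ge0_patch => y; exact: gsq_ge0.
have mF : measurable_fun [set: brl 'rV[R]_m] F.
  apply/(measurable_restrictT _ _).1 => //; apply/measurable_EFinP.
  exact: measurable_funS mf.
have mG : measurable_fun [set: brl 'rV[R]_m] G.
  apply/(measurable_restrictT _ _).1 => //; apply/measurable_EFinP.
  exact: gsq_measurable.
pose aff (s : R) (x : 'rV[R]_m) := (a - s *: a) + s *: x.
(* Extending by zero in both variables makes the double integral an integral over a full product
   space, where Tonelli applies. *)
pose H (p : brl 'rV[R]_m * measurableTypeR R) : \bar R :=
  ((\1_(`[th, 1%R] : set R) p.2)%:E * G (aff p.2 p.1))%E.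
have H0 p : (0 <= H p)%E by rewrite /H mule_ge0 // lee_fin.
have maff : measurable_fun [set: brl 'rV[R]_m * measurableTypeR R]
    ((fun p => aff p.2 p.1) : _ -> brl 'rV[R]_m).
  apply: measurable_rV => i; rewrite /aff.
  under eq_fun do rewrite !mxE.
  apply: measurable_funD.
    apply: measurable_funB; first exact: measurable_cst.
    by apply: measurable_funM; [exact: measurable_snd|exact: measurable_cst].
  apply: measurable_funM; first exact: measurable_snd.
  exact: (measurableT_comp (coord_measurable i) measurable_fst).
have mH : measurable_fun [set: brl 'rV[R]_m * measurableTypeR R] H.
  apply: emeasurable_funM.
    apply/measurable_EFinP.
    exact: (measurableT_comp (@measurable_indic _ _ R setT _ (measurable_itv _)) measurable_snd).
  exact: (measurableT_comp mG maff).
pose I x := (\int[leb]_s H (x, s))%E.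
have I0 x : (0 <= I x)%E by apply: integral_ge0.
have mI : measurable_fun [set: brl 'rV[R]_m] I.
  exact: (@measurable_fun_fubini_tonelli_F _ _ (brl 'rV[R]_m) (measurableTypeR R) R leb H mH H0).
have mFa : measurable_fun [set: brl 'rV[R]_m] (fun x => F (aff th x)).
  exact: (measurableT_comp mF (measurable_affine _ _)).
have pw x : Q x -> (((f x) ^+ 2)%:E <= 2%:E * (F (aff th x) + K%:E * I x))%E.
  move=> Qx.
  have E1 : I x = (\int[leb]_(s in `[th, 1%R]) (gsq f (a + s *: (x - a)))%:E)%E.
    rewrite integral_mkcond; apply: eq_integral => s _.
    rewrite epatch_indic /H /= muleC; have [sth|sth] := pselect (th <= s <= 1).
      rewrite /G /patch /aff -sub_ray mem_set //; exact: Qs.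
    by rewrite indicE memNset ?mule0 // => -/=; rewrite in_itv.
  have E2 : F (aff th x) = ((f (a + th *: (x - a))) ^+ 2)%:E.
    by rewrite /F /patch /aff -sub_ray mem_set //; exact: Uth.
  rewrite E2 E1.
  apply: (@le_trans _ _ (2%:E * (((f (a + th *: (x - a))) ^+ 2)%:E +
      ((f x - f (a + th *: (x - a))) ^+ 2)%:E))%E).
    rewrite -EFinD -EFinM lee_fin.
    by have := sqr_ge0 (f x - 2 * f (a + th *: (x - a))); nra.
  apply: lee_wpmul2l => //; apply: leeD2l.
  exact: (ray_increment_le oQ Cf th01 (fun s => Qs x s Qx) (fun i => xr x i Qx)).
have m2 : measurable_fun [set: brl 'rV[R]_m] (fun x => 2%:E * (F (aff th x) + K%:E * I x))%E.
  apply: measurable_funeM; apply: emeasurable_funD => //; exact: measurable_funeM.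
have p2 x : (0 <= 2%:E * (F (aff th x) + K%:E * I x))%E.
  by rewrite mule_ge0 // adde_ge0 // mule_ge0.
apply: (@le_trans _ _ (\int[lebm m]_x (2%:E * (F (aff th x) + K%:E * I x)))%E).
  apply: (@le_trans _ _ (\int[lebm m]_(x in Q) (2%:E * (F (aff th x) + K%:E * I x)))%E).
    apply: ge0_le_integral => //.
    - by move=> x _; rewrite lee_fin sqr_ge0.
    - exact/measurable_EFinP.
    - exact: measurable_funTS.
  by apply: ge0_subset_integral.
rewrite ge0_integralZl //; last 2 first.
- apply: emeasurable_funD => //; exact: measurable_funeM.
- by move=> x _; rewrite adde_ge0 // mule_ge0.
rewrite ge0_integralD //; last 2 first.
- by move=> x _; rewrite mule_ge0.
- exact: measurable_funeM.
rewrite ge0_integralZl //.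
rewrite (@integral_affine R m (a - th *: a) th F) //.
rewrite [(2 * th ^- m)%:E]EFinM -[leRHS]muleA.
apply: lee_wpmul2l => //.
have thm0 : (0 <= (th ^- m)%:E)%E by rewrite lee_fin invr_ge0 exprn_ge0 // ltW.
rewrite [leRHS]ge0_muleDr; last 2 first.
- by apply: integral_ge0 => x _; rewrite lee_fin sqr_ge0.
- by rewrite mule_ge0 //; apply: integral_ge0 => x _; rewrite lee_fin gsq_ge0.
rewrite [X in (_ <= _ * X + _)%E]integral_mkcond -/F; apply: leeD2l.
rewrite muleCA; apply: lee_wpmul2l => //.
rewrite [X in (_ <= _ * X)%E]integral_mkcond -/G.
have -> : (\int[lebm m]_x I x = \int[leb]_s \int[lebm m]_x H (x, s))%E.
  exact: (@fubini_tonelli _ _ (brl 'rV[R]_m) (measurableTypeR R) R (lebm m) leb H mH H0).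
have GI0 : (0 <= \int[lebm m]_x G x)%E by exact: integral_ge0.
apply: (@le_trans _ _ (\int[leb]_(s in `[th, 1%R]) ((th ^- m)%:E * \int[lebm m]_x G x))%E).
  rewrite [leRHS]integral_mkcond; apply: ge0_le_integral => //.
  - by move=> s _; apply: integral_ge0 => x _.
  - exact: (@measurable_fun_fubini_tonelli_G _ _ (brl 'rV[R]_m) (measurableTypeR R) R (lebm m) H mH H0).
  - by apply/(measurable_restrictT _ _).1 => //; exact: measurable_cst.
  move=> s _; rewrite epatch_indic /H /=.
  have [sth|sth] := pselect (th <= s <= 1); last first.
    have -> : \1_(`[th, 1%R] : set R) s = 0 :> R.
      by rewrite indicE memNset //= in_itv.
    by rewrite mule0; under eq_integral do rewrite mul0e; rewrite integral0.
  have -> : \1_(`[th, 1%R] : set R) s = 1 :> R by rewrite indicE mem_set //= in_itv.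
  rewrite mule1; under eq_integral do rewrite mul1e.
  have s0 : 0 < s by apply: lt_le_trans th0 _; case/andP: sth.
  rewrite (@integral_affine R m (a - s *: a) s G) //; apply: lee_wpmul2r => //.
  rewrite lee_fin lef_pV2 ?posrE ?exprn_gt0 //.
  apply: lerXn2r; rewrite ?nnegrE; [exact: ltW|exact: ltW|by case/andP: sth].
have L : (leb `[th, 1%R] <= 1%:E)%E.
  by rewrite lebesgue_measure_itv /= lte_fin th1 -EFinB lee_fin lerBlDr lerDl ltW.
rewrite integral_cst // -[leRHS]mule1; apply: lee_wpmul2l L; by rewrite mule_ge0.
Qed.

End StarShaped.

Section ConvexPoincare.
Context {R : realType}.

Definition convex_region m (Q : set 'rV[R]_m) : Prop :=
  forall x y (s : R), Q x -> Q y -> 0 <= s <= 1 -> Q (x + s *: (y - x)).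

(** A convex set is star-shaped about each of its points, and the homothety centred at [a] with
    small enough ratio maps [Q] into the cube of radius [d], hence into [U]. *)
Lemma poincare_convex m (Q U : set 'rV[R]_m) (a : 'rV[R]_m) (d r : R) :
  open Q -> convex_region Q -> Q a -> (forall x i, Q x -> `|x 0 i - a 0 i| <= r) ->
  0 < d -> measurable (U : set (brl 'rV[R]_m)) -> U `<=` Q ->
  (forall x, Q x -> (forall i, `|x 0 i - a 0 i| < d) -> U x) ->
  exists2 C : R, 0 <= C & forall f : 'rV[R]_m -> R, Ckn 1 Q f ->
    (\int[lebm m]_(x in Q) ((f x) ^+ 2)%:E <=
      C%:E * (\int[lebm m]_(x in U) ((f x) ^+ 2)%:E +
              \int[lebm m]_(x in Q) (gsq f x)%:E))%E.
Proof.
move=> oQ cQ Qa xr d0 mU UQ Ud.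
(* In dimension zero the bound on coordinates is vacuous, and [r] may be negative. *)
pose r' := Num.max r 0.
have r'0 : 0 <= r' by rewrite le_max lexx orbT.
have xr' x i : Q x -> `|x 0 i - a 0 i| <= r' by move=> Qx; rewrite le_max xr.
(* Chosen so that [th * r' < d]; the summand 1 keeps the ratio below one even when [r'] is zero. *)
pose th := d / (d + r' + 1).
have D0 : 0 < d + r' + 1 by rewrite ltr_pwDr // addr_ge0 // ltW.
have th0 : 0 < th by rewrite divr_gt0.
have th1 : th < 1 by rewrite ltr_pdivrMr // mul1r -addrA ltrDl ltr_pwDr.
have thr : th * r' < d.
  by rewrite /th mulrAC ltr_pdivrMr // ltr_pM2l // -addrA addrCA ltrDl ltr_pwDl.
have K0 : 0 <= m%:R * r' ^+ 2 :> R by rewrite mulr_ge0 // sqr_ge0.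
have T0 : 0 <= 2 * th ^- m :> R by rewrite mulr_ge0 // invr_ge0 exprn_ge0 // ltW.
exists (2 * th ^- m * (1 + m%:R * r' ^+ 2)) => [|f Cf].
  by rewrite mulr_ge0 // addr_ge0.
have I0 (A : set 'rV[R]_m) (g : 'rV[R]_m -> R) : (forall x, 0 <= g x) ->
    (0 <= \int[lebm m]_(x in A) (g x)%:E)%E.
  by move=> g0; apply: integral_ge0 => x _; rewrite lee_fin.
apply: le_trans (@poincare_star R m Q U f a th r' _ _ _ _ _ _ _ _) _ => //.
- by rewrite th0 th1.
- move=> x s Qx /andP[s0 s1]; apply: cQ => //; rewrite s1 andbT.
  exact: le_trans (ltW th0) s0.
- move=> x Qx; apply: Ud; first by apply: cQ => //; rewrite !ltW.
  move=> i; rewrite !mxE (_ : _ - a 0 i = th * (x 0 i - a 0 i)); last by ring.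
  rewrite normrM (gtr0_norm th0).
  by apply: le_lt_trans thr; apply: ler_wpM2l; [exact: ltW|exact: xr'].
rewrite [in leRHS]EFinM -[leRHS]muleA; apply: lee_wpmul2l; first by rewrite lee_fin.
rewrite [in leRHS]EFinD ge0_muleDl ?lee_fin // mul1e.
have Z : (0 <= \int[lebm m]_(x in U) ((f x) ^+ 2)%:E)%E by apply: I0 => x; exact: sqr_ge0.
have Y : (0 <= \int[lebm m]_(x in Q) (gsq f x)%:E)%E by apply: I0 => x; exact: gsq_ge0.
apply: leeD; first by rewrite leeDl.
by apply: lee_wpmul2l; rewrite ?lee_fin // leeDr.
Qed.

End ConvexPoincare.

(** * Positive definite forms *)

Section PositiveDefinite.
Context {R : realType}.

Definition bform m (G : 'M[R]_m) (v w : 'rV[R]_m) : R := (v *m G *m w^T) 0 0.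

Definition posdef m (G : 'M[R]_m) : Prop :=
  G^T = G /\ forall v, v != 0 -> 0 < qform G v.

Section Form.
Variables (m : nat) (G : 'M[R]_m) (PG : posdef G).

Lemma bformC v w : bform G v w = bform G w v.
Proof.
have [sG _] := PG.
rewrite /bform -[in LHS](trmxK (v *m G *m w^T)) mxE.
by rewrite !trmx_mul trmxK sG mulmxA.
Qed.

Lemma bformZD (s t : R) u v w :
  bform G (s *: u + t *: v) w = s * bform G u w + t * bform G v w.
Proof. by rewrite /bform !mulmxDl -!scalemxAl !mxE. Qed.

Lemma qformE v : qform G v = bform G v v. Proof. by []. Qed.

Lemma qform_ge0 v : 0 <= qform G v.
Proof.
have [->|v0] := eqVneq v 0; first by rewrite /qform !mul0mx mxE.
by have [_ H] := PG; exact/ltW/H.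
Qed.

Lemma qform_lin (s t : R) v w :
  qform G (s *: v + t *: w) = s ^+ 2 * qform G v + 2 * s * t * bform G v w + t ^+ 2 * qform G w.
Proof.
rewrite !qformE bformZD ![bform G _ (_ + _)]bformC !bformZD (bformC w v); ring.
Qed.

Lemma bform_cauchy_schwarz v w : (bform G v w) ^+ 2 <= qform G v * qform G w.
Proof.
have [->|w0] := eqVneq w 0.
  have -> : bform G v 0 = 0 by rewrite /bform trmx0 mulmx0 mxE.
  by rewrite expr0n /= mulr_ge0 // qform_ge0.
have qw : 0 < qform G w by have [_] := PG; apply.
have := qform_ge0 (qform G w *: v + (- bform G v w) *: w).
rewrite qform_lin; set a := qform G v; set b := bform G v w; set c := qform G w.
have -> : c ^+ 2 * a + 2 * c * (- b) * b + (- b) ^+ 2 * c = c * (a * c - b ^+ 2) by ring.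
by rewrite pmulr_rge0 // subr_ge0.
Qed.

Lemma posdef_unit : G \in unitmx.
Proof.
rewrite -row_free_unit; apply: inj_row_free => v vG.
apply/eqP; apply: contraT => v0; have [_ H] := PG.
by have := H v v0; rewrite /qform vG mul0mx mxE ltxx.
Qed.

(** [D *m invmx G] is the gradient belonging to the differential [D]: pairing [D] with [h] is taking
    the [G]-product of this gradient with [h], and Cauchy-Schwarz applies. *)
Lemma grad_dual_le (D h : 'rV[R]_m) :
  ((D *m h^T) 0 0) ^+ 2 <= qform G (D *m invmx G) * qform G h.
Proof.
have -> : (D *m h^T) 0 0 = bform G (D *m invmx G) h.
  by rewrite /bform mulmxKV // posdef_unit.
exact: bform_cauchy_schwarz.
Qed.

(** Minkowski's inequality for the length of complex fields [v + i w], whose squared length is the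
    sum of the two forms. *)
Lemma sqrt_qform_triangle (v1 v2 w1 w2 : 'rV[R]_m) :
  Num.sqrt (qform G (v1 + v2) + qform G (w1 + w2)) <=
  Num.sqrt (qform G v1 + qform G w1) + Num.sqrt (qform G v2 + qform G w2).
Proof.
have E u v : qform G (u + v) = qform G u + 2 * bform G u v + qform G v.
  by have := qform_lin 1 1 u v; rewrite !scale1r => ->; ring.
set A := qform G v1 + qform G w1; set B := qform G v2 + qform G w2.
have A0 : 0 <= A by rewrite addr_ge0 // qform_ge0.
have B0 : 0 <= B by rewrite addr_ge0 // qform_ge0.
rewrite -[leRHS]ger0_norm ?addr_ge0 ?sqrtr_ge0 // -sqrtr_sqr ler_wsqrtr //.
rewrite sqrrD !sqr_sqrtr // !E.
have X : (bform G v1 v2 + bform G w1 w2) ^+ 2 <= A * B.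
  have := bform_cauchy_schwarz v1 v2; have := bform_cauchy_schwarz w1 w2.
  have := qform_ge0 v1; have := qform_ge0 v2; have := qform_ge0 w1; have := qform_ge0 w2.
  rewrite /A /B; set a := qform G v1; set b := qform G v2; set c := qform G w1.
  set d := qform G w2; set x := bform G v1 v2; set y := bform G w1 w2.
  move=> d0 c0 b0 a0 yl xl.
  have : (2 * x * y) <= a * d + c * b.
    apply: le_trans (ler_norm _) _.
    have s0 : 0 <= a * d + c * b by rewrite addr_ge0 // mulr_ge0.
    rewrite -(ler_pXn2r (n := 2)) ?nnegrE // real_normK ?num_real //.
    have : x ^+ 2 * y ^+ 2 <= (a * b) * (c * d) by apply: ler_pM; rewrite ?sqr_ge0.
    by have := sqr_ge0 (a * d - c * b); nra.
  nra.
have X2 : bform G v1 v2 + bform G w1 w2 <= Num.sqrt A * Num.sqrt B.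
  rewrite -sqrtrM //; apply: le_trans (ler_norm _) _.
  by rewrite -sqrtr_sqr ler_wsqrtr.
rewrite -mulr_natr /A /B; lra.
Qed.

(** On the segment from the identity to [G] every matrix is positive definite, so the determinant
    never vanishes and keeps the sign it has at the identity. *)
Lemma posdef_det_gt0 : 0 < \det G.
Proof.
pose H (t : R) : 'M[R]_m := (1 - t) *: 1%:M + t *: G.
have PH t : 0 <= t <= 1 -> \det (H t) != 0.
  move=> /andP[t0 t1]; rewrite -unitfE -unitmxE -row_free_unit; apply: inj_row_free => v vG.
  apply/eqP; apply: contraT => v0.
  have : qform (H t) v = (1 - t) * qform 1%:M v + t * qform G v.
    by rewrite /qform /H mulmxDr mulmxDl -!scalemxAr -!scalemxAl !mxE.
  have q1 : 0 < qform 1%:M v.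
    rewrite /qform mulmx1 mxE; under eq_bigr do rewrite mxE -expr2.
    rewrite lt0r sumr_ge0 ?andbT => [|i _]; last exact: sqr_ge0.
    apply: contra v0; rewrite psumr_eq0 => [|i _]; last exact: sqr_ge0.
    move=> /allP z; apply/eqP/rowP => i; rewrite mxE.
    by apply/eqP; have := z i (mem_index_enum i); rewrite sqrf_eq0.
  have q2 : 0 < qform G v by have [_] := PG; apply.
  rewrite [in LHS]/qform vG mul0mx mxE; nra.
have cH : continuous (fun t => \det (H t)).
  move=> t; rewrite /determinant; apply: cvg_big => [|s _]; first exact: add_continuous.
  apply: cvgM; first exact: cvg_cst.
  apply: cvg_big => [|i _]; first exact: mul_continuous.
  under eq_fun do rewrite !mxE; rewrite !mxE.
  apply: cvgD; apply: cvgM => //; try exact: cvg_cst.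
  by apply: cvgB; first exact: cvg_cst.
have H0 : \det (H 0) = 1 by rewrite /H subr0 scale1r scale0r addr0 det1.
have H1 : H 1 = G by rewrite /H subrr scale0r scale1r add0r.
rewrite ltNge; apply/negP => dG.
have [|t /[!in_itv] /= t01 Ht] := @IVT R (fun t => \det (H t)) 0 1 0 ler01
   (continuous_subspaceT cH).
  by rewrite H0 H1 ge_min le_max dG ler01 orbT.
by have := PH t t01; rewrite Ht eqxx.
Qed.

End Form.
End PositiveDefinite.

(** * Integrals against comparable measures *)

Section MeasureComparison.
Context {R : realType}.
Local Open Scope ereal_scope.

Lemma ge0_integral_mrestr d (T : measurableType d) (la : {measure set T -> \bar R})
    (E : set T) (mE : measurable E) (f : T -> \bar R) :
  measurable_fun setT f -> (forall x, 0 <= f x) ->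
  \int[mrestr la mE]_x f x = \int[la]_(x in E) f x.
Proof.
move=> mf f0.
rewrite -(setUv E) ge0_integral_setU //; first last.
- by apply/disj_setPS => x [].
- exact: measurable_funTS.
- exact: measurableC.
rewrite [X in _ + X](_ : _ = 0) ?adde0; last first.
  transitivity (\int[mzero]_(x in ~` E) f x); last exact: integral_measure_zero.
  apply: eq_measure_integral => A mA AE.
  have AE0 : A `&` E = set0 by apply/seteqP; split=> // x [/AE].
  by rewrite -[LHS]/(la (A `&` E)) AE0 measure0.
apply: eq_measure_integral => A mA AE.
by rewrite -[LHS]/(la (A `&` E)); congr (la _); apply/setIidPl.
Qed.

Import HBNNSimple.

(** Compared on the simple functions below [f]: their level sets of positive value lie in [D], where
    the measures are ordered. *)
Lemma le_measure_integral d (T : measurableType d) (m1 m2 : {measure set T -> \bar R})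
    (D : set T) (f : T -> \bar R) : measurable D ->
  (forall A, measurable A -> A `<=` D -> m1 A <= m2 A) ->
  (forall x, D x -> 0 <= f x) ->
  \int[m1]_(x in D) f x <= \int[m2]_(x in D) f x.
Proof.
move=> mD m12 f0; rewrite !ge0_integralE //.
apply: ge_ereal_sup => _ [h hf <-].
apply: le_ereal_sup_tmp; exists (sintegral m2 h); first by exists h.
rewrite !sintegralE; apply: lee_fsum; first exact: fimfunP.
move=> r _; have [r0|r0|->] := ltgtP r 0%R; last by rewrite !mul0e.
  by rewrite !preimage_nnfun0 // !measure0.
apply: lee_wpmul2l; first by rewrite lee_fin ltW.
apply: m12; first exact: measurable_sfunP.
move=> x /= hx; apply: contrapT => nDx.
by have := hf x; rewrite /patch memNset // hx lee_fin leNgt r0.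
Qed.

Section PushRestricted.
Context d1 d2 (T1 : measurableType d1) (T2 : measurableType d2).
Variables (la : {measure set T1 -> \bar R}) (E : set T1) (mE : measurable E).
Variables (phi : T1 -> T2) (mphi : measurable_fun setT phi).

(** The image of [la] restricted to [E]. A chart inverse is meaningful only on the chart image,
    while an image measure asks for a map defined everywhere. *)
Definition push_restr (A : set T2) : \bar R := mrestr la mE (phi @^-1` A).

Let mpre A : measurable A -> measurable (phi @^-1` A).
Proof. by move=> mA; rewrite -[X in measurable X]setTI; exact: mphi. Qed.

Let push_restr0 : push_restr set0 = 0.
Proof. by rewrite /push_restr preimage_set0 measure0. Qed.

Let push_restr_ge0 A : 0 <= push_restr A.
Proof. by rewrite /push_restr measure_ge0. Qed.

Let push_restr_sigma_additive : semi_sigma_additive push_restr.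
Proof.
move=> F mF tF mUF; rewrite /push_restr preimage_bigcup.
apply: measure_semi_sigma_additive => [n| |].
- exact: mpre.
- apply/trivIsetP => /= i j _ _ ij; rewrite -preimage_setI.
  by move/trivIsetP : tF => /(_ _ _ _ _ ij) ->//; rewrite preimage_set0.
- by rewrite -preimage_bigcup; exact: mpre.
Qed.

HB.instance Definition _ := isMeasure.Build _ _ _ push_restr
  push_restr0 push_restr_ge0 push_restr_sigma_additive.

Lemma integral_push_restr (f : T2 -> \bar R) :
  measurable_fun setT f -> (forall x, 0 <= f x) ->
  \int[push_restr]_x f x = \int[la]_(x in E) f (phi x).
Proof.
move=> mf f0.
have -> : \int[push_restr]_x f x = \int[mrestr la mE]_x f (phi x).
  have := @ge0_integral_pushforward _ _ _ _ _ _ mphi (mrestr la mE) setT f measurableT mf.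
  by rewrite preimage_setT; apply.
by rewrite ge0_integral_mrestr //; exact: measurableT_comp mphi.
Qed.

(** Each half of the bound on sets orders [mu] against a multiple of the image measure, so it passes
    to integrals of nonnegative functions without an exact change of variables. *)
Lemma push_comparison (mu : {measure set T2 -> \bar R}) (N : set T2) (c1 c2 : R) (f : T2 -> \bar R) :
  (0 < c1)%R -> (0 <= c2)%R -> measurable N -> (forall x, E x -> N (phi x)) ->
  (forall A, measurable A -> A `<=` N ->
     c1%:E * la (phi @^-1` A `&` E) <= mu A <= c2%:E * la (phi @^-1` A `&` E)) ->
  measurable_fun N f -> (forall x, N x -> 0 <= f x) ->
  c1%:E * \int[la]_(x in E) f (phi x) <= \int[mu]_(x in N) f x <=
  c2%:E * \int[la]_(x in E) f (phi x).
Proof.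
move=> c10 c20 mN EN H mf f0.
have mg : measurable_fun setT (f \_ N) by exact/(measurable_restrictT _ _).1.
have g0 x : 0 <= (f \_ N) x by rewrite /patch; case: ifP => // /[!inE]; exact: f0.
have E1 : \int[push_restr]_(x in N) f x = \int[la]_(x in E) f (phi x).
  rewrite [LHS]integral_mkcond.
  transitivity (\int[la]_(x in E) (f \_ N) (phi x)); first exact: integral_push_restr.
  apply: eq_integral => x /[!inE] Ex.
  by rewrite /patch mem_set //; exact: EN.
have sc (c : {nonneg R}) : \int[mscale c push_restr]_(x in N) f x =
    (c%:num)%:E * \int[la]_(x in E) f (phi x).
  by rewrite ge0_integral_mscale // E1.
rewrite -(sc (NngNum (ltW c10))) -(sc (NngNum c20)).
apply/andP; split; apply: le_measure_integral => // A mA AN;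
  by have /andP[] := H A mA AN.
Qed.

End PushRestricted.

End MeasureComparison.

(** * Charts and the interior *)

Section Charts.
Context {R : realType}.

Section ChartBasics.
Variables (X : topologicalType) (m : nat) (c : chart R X m).
Hypothesis Hc : is_chart c.

Lemma cinv_cmap p : cdom c p -> cinv c (cmap c p) = p.
Proof. by move=> cp; have [_ H _ _ _] := Hc; exact: H. Qed.

Lemma cimg_cmap p : cdom c p -> cimg c (cmap c p).
Proof. by exists p. Qed.

Lemma cimg_cinv x : cimg c x -> cdom c (cinv c x) /\ cmap c (cinv c x) = x.
Proof. by move=> [p cp <-]; rewrite cinv_cmap. Qed.

Lemma cmap_continuous p : cdom c p -> {for p, continuous (cmap c)}.
Proof.
have [oc _ + _ _] := Hc; rewrite continuous_open_subspace // => H cp.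
by apply: H; rewrite inE.
Qed.

Lemma cinv_continuous x : (cimg c)° x -> {for x, continuous (cinv c)}.
Proof.
move=> xi; have [_ _ _ + _] := Hc => /(continuous_subspaceW (@interior_subset _ (cimg c))).
rewrite continuous_open_subspace; last exact: open_interior.
by apply; rewrite inE.
Qed.

Lemma cinv_near x (O : set X) : open O -> (cimg c)° x -> O (cinv c x) ->
  nbhs x (cinv c @^-1` O).
Proof. by move=> oO xi Ox; apply: (cinv_continuous xi); exact: open_nbhs_nbhs. Qed.

Lemma open_cmap_preimage (V : set 'rV[R]_m) : open V ->
  open (cdom c `&` cmap c @^-1` V).
Proof.
move=> oV; rewrite openE => p [cp Vp]; apply: filterI.
  by apply: open_nbhs_nbhs; split=> //; have [] := Hc.
by apply: (cmap_continuous cp); exact: open_nbhs_nbhs.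
Qed.

Lemma open_cinv_preimage (O : set X) : open O -> open ((cimg c)° `&` cinv c @^-1` O).
Proof.
move=> oO; rewrite openE => x [xi Ox]; apply: filterI; last exact: cinv_near.
by apply: open_nbhs_nbhs; split=> //; exact: open_interior.
Qed.

End ChartBasics.

Definition pos_halfspace m : set 'rV[R]_m :=
  [set x | forall i : 'I_m, val i = 0%N -> 0 < x 0 i].

Lemma open_pos_halfspace m : open (@pos_halfspace m).
Proof.
rewrite openE => x Hx.
apply: (@filter_forall _ _ (fun (i : 'I_m) (y : 'rV[R]_m) => val i = 0%N -> 0 < y 0 i)
  (nbhs x) (nbhs_filter x)) => i.
have [i0|i0] := pselect (val i = 0%N); last by near=> y => /i0.
have : nbhs (x 0 i) [set t | 0 < t].
  by apply: open_nbhs_nbhs; split; [exact: open_gt|exact: Hx].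
move=> /(@coord_continuous R 1 m 0 i x).
by apply: (@filterS _ (nbhs x) (nbhs_filter x)).
Unshelve. all: by end_near. Qed.

Lemma pos_halfspace_interior m (U : set 'rV[R]_m) :
  U `&` @pos_halfspace m `<=` U `&` @halfspace R m.
Proof. by move=> x [Ux Hx]; split=> // i /Hx /ltW. Qed.

Section Manifold.
Variables (m : nat) (M : manifold R m).
Implicit Types (c : chart R M m) (p : M).

(** Restricted to the interior of the chart image, where derivatives are two-sided and the
    transformation laws are imposed. *)
Definition overlap c c' : set 'rV[R]_m := (cimg c)° `&` cinv c @^-1` (cdom c').

Lemma open_overlap c c' : atlas c -> atlas c' -> open (overlap c c').
Proof.
move=> Ac Ac'; apply: open_cinv_preimage; first exact: atlas_chart.
by have [] := atlas_chart Ac'.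
Qed.

Lemma transition_smooth c c' l j : atlas c -> atlas c' ->
  Ckn l (overlap c c') (fun x => transition c c' x 0 j).
Proof.
move=> Ac Ac'; apply: (@Ck_on_Ckn _ _ None); [exact: open_overlap|by []|].
apply: Ck_on_sub (atlas_compat Ac Ac' j) => x [/interior_subset xi xc'].
have [cx E] := cimg_cinv (atlas_chart Ac) xi.
by exists (cinv c x).
Qed.

Lemma transition_differentiable c c' x : atlas c -> atlas c' -> overlap c c' x ->
  differentiable (transition c c') x.
Proof.
move=> Ac Ac' xW; apply: differentiable_rV => j; apply: C1at_diff.
exact: (Ckn_C1at (open_overlap Ac Ac') xW (transition_smooth 1 j Ac Ac')).
Qed.

(** At this stage [T x] is not known to be an interior point, so the reverse transition only has
    local C^1 extensions there. Such an extension still inverts [T] at the images of points near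
    [x], and the chain rule yields an inverse of the Jacobian. *)
Lemma transition_unit c c' x : atlas c -> atlas c' -> overlap c c' x ->
  'J (transition c c') x \in unitmx.
Proof.
move=> Ac Ac' xW; have [xi xc'] := xW.
have dT := transition_differentiable Ac Ac' xW.
have Hc := atlas_chart Ac; have Hc' := atlas_chart Ac'.
set T := transition c c'; set A := cmap c' @` (cdom c' `&` cdom c).
have TA y : overlap c c' y -> A (T y).
  move=> [/interior_subset yi yc']; exists (cinv c y) => //.
  by split=> //; have [] := cimg_cinv Hc yi.
have H j : exists F : 'rV[R]_m -> R, C1at F (T x) /\
    \forall y \near T x, A y -> F y = transition c' c y 0 j.
  have [U [F [oU UT CF FE]]] := atlas_compat Ac' Ac j (TA x xW).
  exists F; split.
    exact: (Ckn_C1at oU UT (Ck_open_Ckn (k := None) (l := 1%N) I CF)).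
  have : nbhs (T x) U by exact: open_nbhs_nbhs.
  by apply: filterS => y Uy Ay; exact: FE.
have [F HF] := choice H.
pose FF y := \row_j F j y : 'rV[R]_m.
have dFF : differentiable FF (T x).
  apply: differentiable_rV => j; have [+ _] := HF j => /C1at_diff.
  by apply: near_eq_differentiable; near=> y; rewrite mxE.
have E : \forall y \near x, FF (T y) = y.
  have HT : \forall z \near T x, forall j, A z -> F j z = transition c' c z 0 j.
    apply: (@filter_forall _ _ (fun j z => A z -> F j z = transition c' c z 0 j)
      (nbhs (T x)) (nbhs_filter _)) => j.
    by have [] := HF j.
  have := differentiable_continuous dT HT.
  have Wn : nbhs x (overlap c c') by apply: open_nbhs_nbhs; split=> //; exact: open_overlap.
  apply: (@filterS2 _ (nbhs x) (nbhs_filter x) _ _ _ _ Wn) => y yW /= H1.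
  apply/rowP => j; rewrite mxE H1; last exact: TA.
  have [/interior_subset yi yc'] := yW.
  rewrite /transition cinv_cmap //.
  by have [_ ->] := cimg_cinv Hc yi.
have dI : differentiable (fun y : 'rV[R]_m => FF (T y)) x.
  exact: (@differentiable_comp _ _ _ _ T FF).
have [_ J1] := near_eq_jacobian E dI.
have := jacobian_comp dT dFF; rewrite J1 jacobian_id => /esym JJ.
by case: (mulmx1_unit JJ) => uJ _; exact: uJ.
Unshelve. all: by end_near. Qed.

Lemma derive_at_min n (f : 'rV[R]_n -> R) (x v : 'rV[R]_n) :
  differentiable f x -> (\forall y \near x, differentiable f y) ->
  (\forall y \near x, f x <= f y) -> 'D_v f x = 0.
Proof.
move=> df dfn fmin.
pose phi (t : R) := f (x + t *: v).
have cray : {for (0 : R), continuous (fun t : R => x + t *: v)}.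
  by apply: continuousD; [exact: cst_continuous|apply: continuousZl; exact: cvg_id].
have near0 (P : set 'rV[R]_n) : nbhs x P -> \forall t \near (0 : R), P (x + t *: v).
  by move=> xP; apply: cray; rewrite scale0r addr0.
have [r /= r0 rH] := (nbhs_ballP _ _).1 (filterI (near0 _ dfn) (near0 _ fmin)).
have rin (t : R) : t \in `](- r), r[ -> ball (0 : R) r t.
  by rewrite in_itv /= -ball_normE /= sub0r normrN ltr_norml.
have D (t : R) : t \in `](- r), r[ -> is_derive t 1 phi ('D_v f (x + t *: v)).
  move=> /rin /rH [dt _]; apply: is_derive_line; exact: diff_derivable.
have z : (0 : R) \in `](- r), r[ by rewrite in_itv /= oppr_lt0 r0.
have := @derive1_at_min R phi (- r) r 0.
have -> : - r <= r by rewrite ge0_cp ?ltW.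
move=> /(_ isT (fun t ht => @ex_derive _ _ _ _ _ _ _ (D t ht)) z) min0.
have [|_ E0] := min0; first by move=> t /rin /rH [_]; rewrite /phi scale0r addr0.
by have [_ E1] := D 0 z; rewrite -E0 E1 scale0r addr0.
Qed.

(** Takes the place of invariance of domain. If [F x] lay on the face of a half-space chart, the
    face coordinate of [F] would be minimal at [x]; its derivatives would vanish, and with them a
    column of the Jacobian, against the left inverse [B]. *)
Lemma interior_image n (c : chart R M m) (F : 'rV[R]_n -> 'rV[R]_m) (W : set 'rV[R]_n)
    (x : 'rV[R]_n) (B : 'M[R]_(m, n)) : is_chart c -> open W -> W x ->
  (forall y, W y -> differentiable F y /\ cimg c (F y)) -> B *m 'J F x = 1%:M ->
  (cimg c)° (F x).
Proof.
move=> Hc oW Wx HF BJ; have Wn : nbhs x W by exact: open_nbhs_nbhs.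
have [_ _ _ _ [U oU [E|E]]] := Hc.
  by rewrite E; apply: open_nbhs_nbhs; split=> //; rewrite -E; have [] := HF x Wx.
have [Ux Hx] : (U `&` @halfspace R m) (F x) by rewrite -E; have [] := HF x Wx.
have [Hp|] := pselect (@pos_halfspace m (F x)).
  have : nbhs (F x) (U `&` @pos_halfspace m).
    by apply: open_nbhs_nbhs; split=> //; apply: openI => //; exact: open_pos_halfspace.
  by apply: filterS; rewrite E; exact: pos_halfspace_interior.
move=> /existsNP[i /not_implyP[i0 /negP]]; rewrite -leNgt => Hi.
have {Hi} Ti : F x 0 i = 0 by apply: le_anti; rewrite Hi Hx.
suff Jk k : ('J F x) k i = 0.
  have := BJ => /matrixP /(_ i i); rewrite !mxE big1 => [|k _]; last first.
    by rewrite Jk mulr0.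
  by rewrite eqxx => /eqP; rewrite eq_sym oner_eq0.
rewrite jacobianE; last by have [] := HF x Wx.
apply: derive_at_min.
- by apply: differentiable_comp_coord; have [] := HF x Wx.
- apply: (@filterS _ (nbhs _) (nbhs_filter _) _ _ _ Wn) => y Wy.
  by apply: differentiable_comp_coord; have [] := HF y Wy.
- apply: (@filterS _ (nbhs _) (nbhs_filter _) _ _ _ Wn) => y Wy.
  by rewrite Ti; have [_] := HF y Wy; rewrite E => -[_]; exact.
Qed.

Lemma interior_transfer c c' p : atlas c -> atlas c' -> cdom c p -> cdom c' p ->
  (cimg c)° (cmap c p) -> (cimg c')° (cmap c' p).
Proof.
move=> Ac Ac' cp cp' xi; have Hc := atlas_chart Ac.
have xW : overlap c c' (cmap c p) by split; rewrite //= cinv_cmap.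
have <- : transition c c' (cmap c p) = cmap c' p by rewrite /transition cinv_cmap.
apply: (interior_image (atlas_chart Ac') (open_overlap Ac Ac') xW).
  move=> y yW; split; first exact: transition_differentiable.
  by apply: cimg_cmap; have [] := yW.
exact: mulVmx (transition_unit Ac Ac' xW).
Qed.

Lemma minteriorP c p : atlas c -> cdom c p -> minterior M p <-> (cimg c)° (cmap c p).
Proof.
move=> Ac cp; split=> H.
  exact: (interior_transfer (atlas_chart_at p) Ac (dom_chart_at p) cp H).
exact: (interior_transfer Ac (atlas_chart_at p) cp (dom_chart_at p) H).
Qed.

Lemma open_minterior : open (minterior M).
Proof.
rewrite openE => p ip; set c := chart_at p.
have Ac : atlas c := atlas_chart_at p; have Hc := atlas_chart Ac.
have : nbhs p (cdom c `&` cmap c @^-1` (cimg c)°).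
  apply: open_nbhs_nbhs; split; last by split; [exact: dom_chart_at|].
  by apply: open_cmap_preimage => //; exact: open_interior.
by apply: filterS => q [cq iq]; apply/(minteriorP Ac cq).
Qed.

Lemma minterior_cinv c x : atlas c -> (cimg c)° x -> minterior M (cinv c x).
Proof.
move=> Ac xi; have Hc := atlas_chart Ac.
have [cx E] := cimg_cinv Hc (interior_subset xi).
by apply/(minteriorP Ac cx); rewrite E.
Qed.

(* In a half-cube chart one moves slightly in the direction of the first axis. *)
Lemma minterior_dense p (O : set M) : nbhs p O -> exists q, O q /\ minterior M q.
Proof.
move=> pO; have [ip|nip] := pselect (minterior M p).
  by exists p; split=> //; exact: nbhs_singleton.
set c := chart_at p; have Ac : atlas c := atlas_chart_at p; have Hc := atlas_chart Ac.
have cp : cdom c p := dom_chart_at p.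
have [_ _ _ ci [U oU [E|E]]] := Hc.
  by case: nip; apply/(minteriorP Ac cp); rewrite E; apply: open_nbhs_nbhs; split=> //;
     rewrite -E; exact: cimg_cmap.
set x := cmap c p; have [Ux Hx] : (U `&` @halfspace R m) x by rewrite -E; exact: cimg_cmap.
have [V oV VE] : exists2 V : set 'rV[R]_m, open V &
    V `&` cimg c = cinv c @^-1` (O°) `&` cimg c.
  by apply/open_subspaceP; exact: ((continuousP _).1 ci _ (open_interior O)).
have Vx : V x.
  have : (cinv c @^-1` (O°) `&` cimg c) x.
    by split; [rewrite /= /x cinv_cmap|exact: cimg_cmap].
  by rewrite -VE => -[].
have [r r0 rH] := (nbhs_cubeP x (V `&` U)).1
  (open_nbhs_nbhs (conj (openI oV oU) (conj Vx Ux))).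
pose y : 'rV[R]_m := \row_i (if val i == 0%N then x 0 i + r / 2 else x 0 i).
have [Vy Uy] : (V `&` U) y.
  apply: rH => i; rewrite mxE; case: ifP => _; last by rewrite subrr normr0.
  by rewrite addrC addKr gtr0_norm ?divr_gt0 // ltr_pdivrMr // ltr_pMr // ltr1n.
have Py : @pos_halfspace m y.
  by move=> i i0; rewrite mxE i0 eqxx ltr_wpDl ?Hx // divr_gt0.
have iy : (cimg c)° y.
  have : nbhs y (U `&` @pos_halfspace m).
    by apply: open_nbhs_nbhs; split=> //; apply: openI => //; exact: open_pos_halfspace.
  by apply: filterS; rewrite E; exact: pos_halfspace_interior.
exists (cinv c y); split; last exact: minterior_cinv.
have : (V `&` cimg c) y by split=> //; exact: interior_subset.
by rewrite VE => -[/interior_subset].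
Qed.

End Manifold.
End Charts.

(** * Gradients and the Riemannian measure *)

Section Fields.
Context {R : realType}.

Lemma Ck_on_continuous m (k : option nat) (A : set 'rV[R]_m) (f : 'rV[R]_m -> R) :
  Ck_on k A f -> {within A, continuous f}.
Proof.
move=> H; apply/subspace_continuousP => x Ax.
have [U [F [oU Ux CF FE]]] := H x Ax.
have [cF _] : {for x, continuous F} /\ True by split=> //; have [] := CF [::] x Ux; case: (k).
suff : f @ within A (nbhs x) --> f x by [].
rewrite -(FE x Ux Ax); 
have cW : F @ within A (nbhs x) --> F x by exact: (cvg_within_filter _ (FF := nbhs_filter x) cF).
apply: cvg_trans cW.
have Un : nbhs x U by exact: open_nbhs_nbhs.
apply: near_eq_cvg; rewrite near_withinE.
by apply: (@filterS _ (nbhs x) (nbhs_filter x) _ _ _ Un) => y Uy Ay; exact: FE.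
Qed.

Section OnManifold.
Variables (m : nat) (M : manifold R m).
Implicit Types (c : chart R M m) (p : M).

Lemma Ck_fun_continuous (k : option nat) (A : set M) (f : M -> R) :
  Ck_fun k A f -> {within A, continuous f}.
Proof.
move=> H; apply/subspace_continuousP => p Ap.
set c := chart_at p; have Ac : atlas c := atlas_chart_at p; have Hc := atlas_chart Ac.
have cp : cdom c p := dom_chart_at p.
have xA : (cmap c @` (A `&` cdom c)) (cmap c p) by exists p.
have [U [F [oU Ux CF FE]]] := H c Ac _ xA.
have cF : {for cmap c p, continuous F} by have [] := CF [::] _ Ux; case: (k).
have cFc : {for p, continuous (F \o cmap c)}.
  by apply: continuous_comp => //; exact: cmap_continuous.
have E q : A q -> cdom c q -> U (cmap c q) -> F (cmap c q) = f q.
  by move=> Aq cq Uq; rewrite FE //=; [rewrite cinv_cmap|exists q].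
suff : f @ within A (nbhs p) --> f p by [].
rewrite -(E p Ap cp Ux); 
have cW : (F \o cmap c) @ within A (nbhs p) --> (F \o cmap c) p by exact: cvg_within_filter cFc.
apply: cvg_trans cW.
have Un : nbhs p (cdom c `&` cmap c @^-1` U).
  by apply: open_nbhs_nbhs; split=> //; exact: open_cmap_preimage.
apply: near_eq_cvg; rewrite near_withinE.
by apply: filterS Un => q [cq Uq] Aq; exact: E.
Qed.

Lemma Ck_fun_chart (k : option nat) (f : M -> R) c l : lek l k -> Ck_fun k setT f ->
  atlas c -> Ckn l (cimg c)° (f \o cinv c).
Proof.
move=> lk H Ac; apply: (@Ck_on_Ckn _ _ k); [exact: open_interior|by []|].
apply: Ck_on_sub (H c Ac) => x /interior_subset [q cq <-].
by exists q.
Qed.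

Variable (g : gram M).
Hypothesis Hg : is_metric g.

Lemma metric_posdef c x : atlas c -> cimg c x -> posdef (g c x).
Proof.
have [_ H1 H2 _] := Hg => Ac cx; split; first exact: H1.
by move=> v; exact: H2.
Qed.

Lemma metric_Ckn c l i j : atlas c -> Ckn l (cimg c)° (fun x => g c x i j).
Proof.
move=> Ac; apply: (@Ck_on_Ckn _ _ None); [exact: open_interior|by []|].
by apply: Ck_on_sub (@interior_subset _ _) _; have [+ _ _ _] := Hg; exact.
Qed.

Lemma metric_continuous c i j : atlas c ->
  {within cimg c, continuous (fun x => g c x i j)}.
Proof. by move=> Ac; have [/(_ c Ac i j) + _ _ _] := Hg; exact: Ck_on_continuous. Qed.

Lemma metric_law c c' x : atlas c -> atlas c' -> overlap c c' x ->
  g c x = 'J (transition c c') x *m g c' (transition c c' x) *m ('J (transition c c') x)^T.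
Proof.
by move=> Ac Ac' [xi xc']; have [_ _ _ H] := Hg; exact: H.
Qed.

Lemma transition_cimg c c' x : overlap c c' x -> cimg c' (transition c c' x).
Proof. by move=> [_ xc']; exact: cimg_cmap. Qed.

Lemma cinv_transition c c' x : atlas c' -> overlap c c' x ->
  cinv c' (transition c c' x) = cinv c x.
Proof. by move=> Ac' [_ xc']; rewrite /transition cinv_cmap //; exact: atlas_chart. Qed.

Lemma transition_interior c c' x : atlas c -> atlas c' -> overlap c c' x ->
  (cimg c')° (transition c c' x).
Proof.
move=> Ac Ac' [xi xc']; have [cx E] := cimg_cinv (atlas_chart Ac) (interior_subset xi).
by apply: (interior_transfer Ac Ac' cx xc'); rewrite E.
Qed.

Definition vfield_law (w : vfield M) : Prop :=
  forall c c' x, atlas c -> atlas c' -> (cimg c)° x -> cdom c' (cinv c x) ->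
     w c' (transition c c' x) = w c x *m 'J (transition c c') x.

Lemma vfield_law_sub v w : vfield_law v -> vfield_law w -> vfield_law (vfield_sub v w).
Proof.
move=> Hv Hw c c' x Ac Ac' xi xc'.
by rewrite /vfield_sub Hv // Hw // mulmxBl.
Qed.

Lemma qform_law c c' x (v : 'rV[R]_m) : atlas c -> atlas c' -> overlap c c' x ->
  qform (g c' (transition c c' x)) (v *m 'J (transition c c') x) = qform (g c x) v.
Proof.
move=> Ac Ac' xW; rewrite [in RHS](metric_law Ac Ac' xW) /qform trmx_mul !mulmxA.
by [].
Qed.

(** With [J] the Jacobian of the transition, [D = D' J^T] and [g = J g' J^T], whence
    [D g^-1 J = D' g'^-1]: the gradient transforms as a vector. *)
Lemma grad_law (f : M -> R) : Ck_fun None setT f -> vfield_law (grad g f).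
Proof.
move=> Hf c c' x Ac Ac' xi xc'; have xW : overlap c c' x by [].
set T := transition c c'; have uJ := transition_unit Ac Ac' xW.
have G := metric_law Ac Ac' xW.
have uG : g c x \in unitmx.
  by apply: posdef_unit; apply: metric_posdef => //; exact: interior_subset.
have uG' : g c' (T x) \in unitmx.
  by apply: posdef_unit; apply: metric_posdef => //; exact: transition_cimg.
rewrite -/T in uJ G *; set J := 'J T x in uJ G *.
have dT : differentiable T x := transition_differentiable Ac Ac' xW.
have df' : differentiable (f \o cinv c') (T x).
  apply: C1at_diff; apply: (Ckn_C1at (open_interior _) (transition_interior Ac Ac' xW)).
  exact: (Ck_fun_chart (k := None)).
have ED : drow (f \o cinv c) x = drow (f \o cinv c') (T x) *m J^T.
  rewrite /J -drow_comp //; apply/rowP => i; rewrite !mxE /pd.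
  apply: near_eq_derive.
  have Wn : nbhs x (overlap c c') by apply: open_nbhs_nbhs; split=> //; exact: open_overlap.
  apply: (@filterS _ (nbhs x) (nbhs_filter x) _ _ _ Wn) => y yW /=.
  by rewrite cinv_transition.
rewrite /grad -/(drow (f \o cinv c) x) -/(drow (f \o cinv c') (T x)).
set D' := drow (f \o cinv c') (T x) in ED *; set W := D' *m invmx (g c' (T x)).
have EW : drow (f \o cinv c) x = W *m invmx J *m g c x.
  by rewrite ED G !mulmxA mulmxKV // /W mulmxKV.
by rewrite EW mulmxK // mulmxKV.
Qed.

Definition nsq (v w : vfield M) c x : R := qform (g c x) (v c x) + qform (g c x) (w c x).

Lemma nsq_ge0 v w c x : atlas c -> cimg c x -> 0 <= nsq v w c x.
Proof.
by move=> Ac cx; rewrite addr_ge0 // qform_ge0 //; exact: metric_posdef.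
Qed.

(** [vfield_norm] uses the preferred chart of each point, which changes without control from point
    to point; measurability and local estimates need one chart for a whole neighbourhood. *)
Lemma vfield_normE v w c p : vfield_law v -> vfield_law w -> atlas c -> cdom c p ->
  minterior M p -> vfield_norm g v w p = Num.sqrt (nsq v w c (cmap c p)).
Proof.
move=> Hv Hw Ac cp ip; rewrite /vfield_norm indicE mem_set // mul1r; congr Num.sqrt.
set c' := chart_at p; have Ac' : atlas c' := atlas_chart_at p.
have xi : (cimg c)° (cmap c p) by apply/(minteriorP Ac cp).
have E := cinv_cmap (atlas_chart Ac) cp.
have xc' : cdom c' (cinv c (cmap c p)) by rewrite E; exact: dom_chart_at.
have TE : transition c c' (cmap c p) = cmap c' p by rewrite /transition E.
have xW : overlap c c' (cmap c p) by [].
by rewrite /nsq -TE Hv // Hw // !qform_law.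
Qed.

Lemma vfield_norm_out v w p : ~ minterior M p -> vfield_norm g v w p = 0.
Proof. by move=> ip; rewrite /vfield_norm indicE memNset // mul0r. Qed.

Lemma vfield_norm_ge0 v w p : 0 <= vfield_norm g v w p.
Proof. by rewrite /vfield_norm mulr_ge0 // sqrtr_ge0. Qed.

Lemma vfield_norm_triangle v1 v2 w1 w2 p :
  vfield_norm g v1 w1 p <=
  vfield_norm g (vfield_sub v1 v2) (vfield_sub w1 w2) p + vfield_norm g v2 w2 p.
Proof.
have [ip|ip] := pselect (minterior M p); last by rewrite !vfield_norm_out // addr0.
rewrite /vfield_norm indicE mem_set // !mul1r /vfield_sub.
set c := chart_at p; set x := cmap c p.
have pd : posdef (g c x).
  by apply: metric_posdef; [exact: atlas_chart_at|exact: cimg_cmap (dom_chart_at p)].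
have := sqrt_qform_triangle pd (v1 c x - v2 c x) (v2 c x) (w1 c x - w2 c x) (w2 c x).
by rewrite !subrK.
Qed.

Lemma open_cdom c : atlas c -> open (cdom c).
Proof. by move=> /atlas_chart[]. Qed.

(** The maximal atlas need not be countable, so countability comes from a base of the topology: the
    base sets contained in some chart domain still cover. *)
Lemma chartwise_measurable (f : borel M -> R) :
  (forall c, atlas c -> measurable_fun (cdom c : set (borel M)) f) ->
  measurable_fun [set: borel M] f.
Proof.
move=> H _ Y mY; rewrite setTI.
have [B /countable_injP[e einj] [Bo Bb]] := manifold_countable M.
pose ok b := B b /\ exists c, atlas c /\ b `<=` cdom c.
(* [e] numbers the base; a number that no admissible base set carries contributes the empty set. *)
pose F (n : nat) : set (borel M) := [set p | exists b, [/\ ok b, e b = n & b p]] `&` f @^-1` Y.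
rewrite (_ : f @^-1` Y = \bigcup_n F n); last first.
  apply/seteqP; split=> [p fp|p [n _ []]] //.
  have cn : nbhs p (cdom (chart_at p)).
    apply: open_nbhs_nbhs; split; last exact: dom_chart_at.
    exact/open_cdom/atlas_chart_at.
  have [b [bB bp] bc] := Bb p _ cn.
  exists (e b) => //; split=> //; exists b; split=> //; split=> //.
  by exists (chart_at p); split=> //; exact: atlas_chart_at.
apply: bigcupT_measurable => n.
have [[b [[bB [c [Ac bc]]] eb]]|nb] := pselect (exists b, ok b /\ e b = n); last first.
  rewrite (_ : F n = set0) //; apply/seteqP; split=> // p [[b [okb eb _]] _].
  by apply: nb; exists b.
rewrite (_ : F n = b `&` f @^-1` Y); last first.
  apply/seteqP; split=> p [].
    move=> [b' [[bB' _] eb' bp]] fp; split=> //.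
    by rewrite (_ : b = b') //; apply: einj; rewrite ?inE // eb.
  by move=> bp fp; split=> //; exists b; split=> //; split=> //; exists c.
have mb : measurable (b : set (borel M)) by apply: open_brl; exact: Bo.
exact: (measurable_funS (open_brl (open_cdom Ac)) bc (H c Ac)).
Qed.

(** Weaker than [is_measurable_vfield]: coordinates are measurable over interior points only, which
    is what a gradient satisfies, and the norm is set to 0 elsewhere. *)
Definition measurable_field (v : vfield M) : Prop :=
  vfield_law v /\ forall c i, atlas c ->
    measurable_fun (cdom c `&` minterior M : set (borel M))
      (fun p : borel M => v c (cmap c p) 0 i).

Lemma measurable_field_of v : is_measurable_vfield v -> measurable_field v.
Proof.
move=> [H1 H2]; split=> // c i Ac.
exact: (measurable_funS (open_brl (open_cdom Ac)) (@subIsetl _ _ _) (H2 c i Ac)).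
Qed.

Lemma measurable_field_sub v w : measurable_field v -> measurable_field w ->
  measurable_field (vfield_sub v w).
Proof.
move=> [H1 H2] [K1 K2]; split; first exact: vfield_law_sub.
move=> c i Ac; rewrite /vfield_sub; under eq_fun do rewrite !mxE.
by apply: measurable_funB; [exact: H2|exact: K2].
Qed.

Lemma open_interior_chart c : atlas c -> open (cdom c `&` minterior M).
Proof. by move=> Ac; apply: openI; [exact: open_cdom|exact: open_minterior]. Qed.

Lemma chart_fun_measurable c (h : 'rV[R]_m -> R) : atlas c ->
  (forall x, (cimg c)° x -> {for x, continuous h}) ->
  measurable_fun (cdom c `&` minterior M : set (borel M)) (fun p : borel M => h (cmap c p)).
Proof.
move=> Ac ch; apply: within_measurable_real; first exact: (open_brl (open_interior_chart Ac)).
apply/continuous_in_subspaceT => p; rewrite inE => -[cp ip].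
apply: (@continuous_comp _ _ _ (cmap c) h).
  by apply: cmap_continuous => //; exact: atlas_chart.
exact: (ch _ ((minteriorP Ac cp).1 ip)).
Qed.

Lemma metric_measurable c i j : atlas c ->
  measurable_fun (cdom c `&` minterior M : set (borel M))
    (fun p : borel M => g c (cmap c p) i j).
Proof.
move=> Ac; apply: (chart_fun_measurable (h := fun x => g c x i j)) => // x xi.
by have [+ _] := metric_Ckn 0 i j Ac; apply.
Qed.

Lemma measurable_field_grad (f : M -> R) : Ck_fun None setT f ->
  measurable_field (grad g f).
Proof.
move=> Hf; split; first exact: grad_law.
move=> c i Ac; apply: (chart_fun_measurable (h := fun x => grad g f c x 0 i)) => // x xi.
have oi : open (cimg c)° by exact: open_interior.
suff [+ _] : Ckn 0 (cimg c)° (fun x => grad g f c x 0 i) by apply.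
rewrite /grad; under eq_fun do rewrite mxE.
apply: Ckn_sum => // k; apply: CknM => //.
  under eq_fun do rewrite mxE.
  have [_ /(_ k)[_ +]] := Ck_fun_chart (k := None) (l := 1) I Hf Ac.
  exact.
apply: Ckn_invmx => // [y yi|i' j']; last exact: metric_Ckn.
by apply: posdef_unit; apply: metric_posdef => //; exact: interior_subset.
Qed.

Lemma nsq_measurable v w c : measurable_field v -> measurable_field w -> atlas c ->
  measurable_fun (cdom c `&` minterior M : set (borel M))
    (fun p : borel M => nsq v w c (cmap c p)).
Proof.
move=> [_ Hv] [_ Hw] Ac.
have Q (u : vfield M) : (forall i, measurable_fun (cdom c `&` minterior M : set (borel M))
      (fun p : borel M => u c (cmap c p) 0 i)) ->
    measurable_fun (cdom c `&` minterior M : set (borel M))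
      (fun p : borel M => qform (g c (cmap c p)) (u c (cmap c p))).
  move=> Hu; rewrite /qform; under eq_fun do rewrite mxE.
  apply: measurable_sum => j; apply: measurable_funM; last first.
    by under eq_fun do rewrite mxE; exact: Hu.
  under eq_fun do rewrite mxE.
  apply: measurable_sum => k; apply: measurable_funM; first exact: Hu.
  exact: metric_measurable.
by apply: measurable_funD; apply: Q => i; [exact: Hv|exact: Hw].
Qed.

Lemma vfield_norm_measurable v w : measurable_field v -> measurable_field w ->
  measurable_fun [set: borel M] (vfield_norm g v w : borel M -> R).
Proof.
move=> Hv Hw; apply: chartwise_measurable => c Ac.
have mI : measurable (minterior M : set (borel M)) by exact: (open_brl (open_minterior M)).
have mc : measurable (cdom c : set (borel M)) by exact: (open_brl (open_cdom Ac)).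
have -> : (cdom c : set (borel M)) = (cdom c `&` minterior M) `|` (cdom c `\` minterior M).
  by rewrite setUIDK.
apply/measurable_funU; [exact: measurableI|exact: measurableD|split].
  have H : measurable_fun (cdom c `&` minterior M : set (borel M))
      (fun p : borel M => Num.sqrt (nsq v w c (cmap c p))).
    apply: (measurableT_comp (continuous_measurable_fun (@sqrt_continuous R))).
    exact: nsq_measurable.
  apply: eq_measurable_fun H => p /[!inE] -[cp ip]; rewrite -vfield_normE //.
    by case: Hv.
  by case: Hw.
have H : measurable_fun (cdom c `\` minterior M : set (borel M)) (fun=> 0 : R).
  exact: measurable_cst.
by apply: eq_measurable_fun H => p /[!inE] -[_ ip]; rewrite vfield_norm_out.
Qed.

Lemma Ck_fun_measurable (f : M -> R) : Ck_fun None setT f ->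
  measurable_fun [set: borel M] (f : borel M -> R).
Proof.
by move=> Hf; apply: within_measurable_real; [exact: measurableT|exact: Ck_fun_continuous Hf].
Qed.

End OnManifold.
End Fields.

(** * The Riemannian measure in a chart *)

Section ChartMeasure.
Context {R : realType}.
Variables (m : nat) (M : manifold R m) (g : gram M).
Variable mu : {measure set (borel M) -> \bar R}.
Hypothesis Hg : is_metric g.
Hypothesis hmu : is_riemannian_measure g mu.
Implicit Types (c : chart R M m).

Lemma halfspace_measurable n : measurable (@halfspace R n : set (brl 'rV[R]_n)).
Proof.
have -> : @halfspace R n = ~` (\bigcup_(i in [set i : 'I_n | val i = 0%N])
    (fun x : 'rV[R]_n => x 0 i) @^-1` `]-oo, 0[).
  apply/seteqP; split=> x.
    by move=> H [i /= i0]; rewrite in_itv /= ltNge H.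
  move=> H i i0; rewrite leNgt; apply/negP => xi; apply: H.
  by exists i; [exact: i0|rewrite /= in_itv].
apply: measurableC; apply: fin_bigcup_measurable; first exact: finite_finset.
move=> i _; rewrite -[X in measurable X]setTI.
by apply: coord_measurable => //; exact: measurable_itv.
Qed.

Lemma cimg_measurable c : atlas c -> measurable (cimg c : set (brl 'rV[R]_m)).
Proof.
move=> Ac; have [_ _ _ _ [U oU [->|->]]] := atlas_chart Ac; first exact: open_brl.
by apply: measurableI; [exact: open_brl|exact: halfspace_measurable].
Qed.

Lemma cmap_imageE c (A : set M) : atlas c -> A `<=` cdom c ->
  cmap c @` A = cimg c `&` cinv c @^-1` A.
Proof.
move=> Ac AD; have Hc := atlas_chart Ac; apply/seteqP; split=> x.
  move=> [p Ap <-]; split; first exact/cimg_cmap/AD.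
  by rewrite /= (cinv_cmap Hc) //; exact: AD.
move=> [xc Ax]; exists (cinv c x) => //.
by have [] := cimg_cinv Hc xc.
Qed.

Lemma cinv_measurable c : atlas c ->
  measurable_fun (cimg c : set (brl 'rV[R]_m)) (cinv c : brl 'rV[R]_m -> borel M).
Proof.
move=> Ac; apply: within_measurable_brl; first exact: cimg_measurable.
by have [] := atlas_chart Ac.
Qed.

Lemma cmap_image_measurable c (A : set (borel M)) : atlas c -> measurable A ->
  A `<=` cdom c -> measurable (cmap c @` A : set (brl 'rV[R]_m)).
Proof.
move=> Ac mA AD; rewrite cmap_imageE //.
exact: (cinv_measurable Ac (cimg_measurable Ac) mA).
Qed.

Lemma det_metric_measurable c : atlas c ->
  measurable_fun (cimg c : set (brl 'rV[R]_m)) (fun x => Num.sqrt (\det (g c x))).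
Proof.
move=> Ac; apply: (measurableT_comp (continuous_measurable_fun (@sqrt_continuous R))).
rewrite /determinant; apply: measurable_sum => s.
apply: measurable_funM; first exact: measurable_cst.
apply: measurable_prod => i _; apply: within_measurable_real.
  exact: cimg_measurable.
exact: metric_continuous.
Qed.

Lemma riemannian_measureE c (A : set (borel M)) : atlas c -> measurable A ->
  A `<=` cdom c ->
  (mu A = \int[lebm m]_(x in cmap c @` A) (Num.sqrt (\det (g c x)))%:E)%E.
Proof.
move=> Ac mA AD; have mB := cmap_image_measurable Ac mA AD.
rewrite (hmu Ac mA AD) lebintE.
- rewrite [RHS]integral_mkcond; apply: eq_integral => x _.
  by rewrite epatch_indic /= EFinM muleC.
- have H : measurable_fun [set: brl 'rV[R]_m]
      ((fun x : brl 'rV[R]_m => (Num.sqrt (\det (g c x)))%:E) \_ (cmap c @` A)).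
    apply/(measurable_restrictT _ _).1 => //; apply/measurable_EFinP.
    apply: (measurable_funS (cimg_measurable Ac) _ (det_metric_measurable Ac)).
    by move=> x [p Ap <-]; exact/cimg_cmap/AD.
  apply: eq_measurable_fun H => x _.
  by rewrite epatch_indic /= EFinM muleC.
- by move=> x; rewrite lee_fin mulr_ge0 // sqrtr_ge0.
Qed.

(** Bounds on the density suffice, since a Poincare inequality is insensitive to constants. The
    absolute value keeps the upper factor nonnegative when [N] is empty and [D] is unconstrained. *)
Lemma chart_measure c (N : set (borel M)) (d D : R) (F : borel M -> \bar R) :
  atlas c -> measurable N -> N `<=` cdom c -> 0 < d ->
  (forall x, (cmap c @` N) x -> d <= Num.sqrt (\det (g c x)) <= D) ->
  measurable_fun N F -> (forall p, N p -> 0 <= F p)%E ->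
  (d%:E * \int[lebm m]_(x in cmap c @` N) F (cinv c x) <= \int[mu]_(p in N) F p <=
   `|D|%:E * \int[lebm m]_(x in cmap c @` N) F (cinv c x))%E.
Proof.
move=> Ac mN ND d0 HD mF F0; have Hc := atlas_chart Ac.
set E := cmap c @` N; have mE : measurable (E : set (brl 'rV[R]_m)).
  exact: cmap_image_measurable.
have EC : E `<=` cimg c by move=> x [p Np <-]; exact/cimg_cmap/ND.
(* [cinv c] made total and measurable; the value [point] is taken only off [E]. *)
pose phi (x : brl 'rV[R]_m) : borel M := if x \in E then cinv c x else point.
have mphi : measurable_fun setT phi.
  rewrite (_ : phi = patch (fun=> point) E (cinv c)); last by apply/funext => x; rewrite /phi /patch.
  apply/(measurable_restrictT _ _).1 => //.
  exact: (measurable_funS (cimg_measurable Ac) EC (cinv_measurable Ac)).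
have phiE x : E x -> phi x = cinv c x by move=> Ex; rewrite /phi mem_set.
have EN x : E x -> N (phi x).
  by move=> Ex; rewrite phiE //; case: Ex => p Np <-; rewrite (cinv_cmap Hc) //; exact: ND.
have pre A : A `<=` N -> phi @^-1` A `&` E = cmap c @` A.
  move=> AN; apply/seteqP; split=> x.
    move=> [/= Ax Ex]; rewrite phiE // in Ax; exists (cinv c x) => //.
    by have [] := cimg_cinv Hc (EC x Ex).
  move=> [p Ap <-]; have Ep : E (cmap c p) by exists p => //; exact: AN.
  by split=> //=; rewrite phiE // (cinv_cmap Hc) //; exact/ND/AN.
have -> : (\int[lebm m]_(x in E) F (cinv c x) = \int[lebm m]_(x in E) F (phi x))%E.
  by apply: eq_integral => x /[!inE] Ex; rewrite phiE.
apply: (push_comparison mE mphi) => // A mA AN.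
rewrite pre // (riemannian_measureE Ac mA (subset_trans AN ND)).
have mB := cmap_image_measurable Ac mA (subset_trans AN ND).
have mw : measurable_fun (cmap c @` A : set (brl 'rV[R]_m)) (fun x => (Num.sqrt (\det (g c x)))%:E).
  apply/measurable_EFinP.
  apply: (measurable_funS (cimg_measurable Ac) _ (det_metric_measurable Ac)).
  by move=> x [p Ap <-]; exact/cimg_cmap/ND/AN.
have B x : (cmap c @` A) x -> d <= Num.sqrt (\det (g c x)) <= D.
  by move=> [p Ap <-]; apply: HD; exists p => //; exact: AN.
apply/andP; split.
  rewrite -integral_cst //; apply: ge0_le_integral => //.
  - by move=> x _; rewrite lee_fin ltW.
  - by move=> x /B /andP[+ _]; rewrite lee_fin.
rewrite -integral_cst //; apply: ge0_le_integral => //.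
move=> x /B /andP[_ H]; rewrite lee_fin; apply: le_trans H _; exact: ler_norm.
Qed.

End ChartMeasure.

(** * Good sets *)

Section LocalPoincare.
Context {R : realType}.
Variables (m : nat) (M : manifold R m) (g : gram M).
Variable mu : {measure set (borel M) -> \bar R}.
Hypothesis Hg : is_metric g.
Hypothesis hmu : is_riemannian_measure g mu.
Implicit Types (c : chart R M m) (f : M -> R).

Definition real_test f : Prop :=
  Ck_fun None setT f /\ compact (closure [set p | f p != 0]).

(** Stands for the imaginary part, so that real functions can use the complex [vfield_norm]. *)
Definition zero_field : vfield M := fun _ _ => 0.

Lemma zero_field_measurable : measurable_field zero_field.
Proof.
split=> [c c' x _ _ _ _|c i _]; first by rewrite mul0mx.
under eq_fun do rewrite mxE; exact: measurable_cst.
Qed.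

Definition gnorm f p : R := vfield_norm g (grad g f) zero_field p ^+ 2.

Definition energy f : \bar R := (\int[mu]_p (gnorm f p)%:E)%E.

Definition sqint (S : set M) f : \bar R := (\int[mu]_(p in S) ((f p) ^+ 2)%:E)%E.

Lemma gnorm_ge0 f p : 0 <= gnorm f p. Proof. exact: sqr_ge0. Qed.

Lemma energy_ge0 f : (0 <= energy f)%E.
Proof. by apply: integral_ge0 => p _; rewrite lee_fin gnorm_ge0. Qed.

Lemma gnorm_measurable f : Ck_fun None setT f ->
  measurable_fun [set: borel M] (gnorm f : borel M -> R).
Proof.
move=> Hf; apply: measurable_funX; apply: vfield_norm_measurable => //.
  exact: measurable_field_grad.
exact: zero_field_measurable.
Qed.

Lemma sq_measurable f : Ck_fun None setT f ->
  measurable_fun [set: borel M] (fun p : borel M => (f p) ^+ 2).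
Proof. by move=> Hf; apply: measurable_funX; exact: Ck_fun_measurable. Qed.

Lemma gnorm_chart f c x : Ck_fun None setT f -> atlas c -> (cimg c)° x ->
  gnorm f (cinv c x) = qform (g c x) (grad g f c x).
Proof.
move=> Hf Ac xi; have [cx E] := cimg_cinv (atlas_chart Ac) (interior_subset xi).
rewrite /gnorm (vfield_normE Hg (grad_law Hg Hf) (proj1 zero_field_measurable) Ac cx); last first.
  exact: minterior_cinv.
have xc := interior_subset xi.
rewrite E sqr_sqrtr; last exact: nsq_ge0.
by rewrite /nsq /zero_field [X in _ + X](_ : _ = 0) ?addr0 // /qform !mul0mx mxE.
Qed.

(** [grad_dual_le] against the [i]-th basis vector bounds the square of the [i]-th partial
    derivative by [g c x i i] times the squared gradient; summing over [i] produces the trace. *)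
Lemma gsq_le_gnorm f c x : Ck_fun None setT f -> atlas c -> (cimg c)° x ->
  gsq (f \o cinv c) x <= \tr (g c x) * gnorm f (cinv c x).
Proof.
move=> Hf Ac xi; rewrite (gnorm_chart Hf Ac xi) mulrC /gsq /mxtrace mulr_sumr.
apply: ler_sum => i _.
have PG := metric_posdef Hg Ac (interior_subset xi).
have := grad_dual_le PG (drow (f \o cinv c) x) (delta_mx 0 i).
rewrite /grad -/(drow (f \o cinv c) x).
have -> : (drow (f \o cinv c) x *m (delta_mx 0 i : 'rV[R]_m)^T) 0 0 = pd i (f \o cinv c) x.
  by rewrite trmx_delta -colE !mxE.
by have -> : qform (g c x) (delta_mx 0 i) = g c x i i by rewrite /qform trmx_delta -colE -rowE !mxE.
Qed.

Definition good (S : set M) : Prop :=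
  measurable (S : set (borel M)) /\
  exists2 C : R, 0 <= C & forall f, real_test f -> (sqint S f <= C%:E * energy f)%E.

Lemma good_sub (S T : set M) : measurable (S : set (borel M)) -> S `<=` T -> good T -> good S.
Proof.
move=> mS ST [mT [C C0 H]]; split=> //; exists C => // f tf.
apply: le_trans (H f tf); apply: ge0_subset_integral => //.
  apply/measurable_EFinP; apply: measurable_funS (sq_measurable (proj1 tf)) => //.
by move=> x _; rewrite lee_fin sqr_ge0.
Qed.

Lemma goodU (S T : set M) : good S -> good T -> good (S `|` T).
Proof.
move=> [mS [C C0 H]] [mT [C' C'0 H']]; split; first exact: measurableU.
exists (C + C') => [|f tf]; first exact: addr_ge0.
have mf : measurable_fun [set: borel M] (fun p : borel M => ((f p) ^+ 2)%:E).
  by apply/measurable_EFinP; exact: sq_measurable (proj1 tf).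
rewrite EFinD ge0_muleDl ?lee_fin //.
apply: le_trans (leeD (H f tf) (H' f tf)).
have -> : S `|` T = S `|` (T `\` S).
  apply/seteqP; split=> p [Sp|]; try by left.
    by move=> Tp; have [Sp|nSp] := pselect (S p); [left|right].
  by move=> [Tp _]; right.
have mTS : measurable (T `\` S : set (borel M)) by exact: measurableD.
have mfU : measurable_fun (S `|` T `\` S : set (borel M)) (fun p => ((f p) ^+ 2)%:E).
  exact: measurable_funTS.
have dST : [disjoint S & T `\` S]%classic by apply/disj_setPS => x [Sx [_]].
have f0 (p : M) : (S `|` T `\` S) p -> (0 <= ((f p) ^+ 2)%:E)%E.
  by move=> _; rewrite lee_fin sqr_ge0.
rewrite /sqint (ge0_integral_setU mu mS mTS mfU f0 dST).
apply: leeD2l; apply: ge0_subset_integral => //; first exact: measurable_funTS.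
by move=> x _; rewrite lee_fin sqr_ge0.
Qed.

Lemma good0 : good set0.
Proof.
split; first exact: measurable0; exists 0 => // f tf.
by rewrite /sqint integral_set0 mul0e.
Qed.

(** [Q0] is the part of the convex set [Q] that lies in the manifold; [h] agrees there with [f] and
    vanishes with its gradient on the rest. The same statement thus serves points with [Q0 = Q] and
    ends, where [h] is an extension by zero. *)
Lemma chart_poincare c (Q0 Q U : set 'rV[R]_m) (a : 'rV[R]_m) (e r d D K : R) :
  atlas c -> Q0 `<=` (cimg c)° -> open Q0 -> Q0 `<=` Q ->
  0 < d -> (forall x, Q0 x -> d <= Num.sqrt (\det (g c x)) <= D /\ \tr (g c x) <= K) ->
  open Q -> convex_region Q -> Q a -> (forall x i, Q x -> `|x 0 i - a 0 i| <= r) ->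
  0 < e -> measurable (U : set (brl 'rV[R]_m)) -> U `<=` Q ->
  (forall x, Q x -> (forall i, `|x 0 i - a 0 i| < e) -> U x) ->
  exists2 C : R, 0 <= C & forall f (h : 'rV[R]_m -> R), Ck_fun None setT f -> Ckn 1 Q h ->
    (forall x, Q0 x -> h x = f (cinv c x)) ->
    (forall x, Q x -> ~ Q0 x -> h x = 0 /\ gsq h x = 0) ->
    (sqint (cinv c @` Q0) f <=
      C%:E * (\int[lebm m]_(x in U) ((h x) ^+ 2)%:E + energy f))%E.
Proof.
move=> Ac Q0c oQ0 Q0Q d0 HQ oQ cQ Qa Qr e0 mU UQ Ue.
have Hc := atlas_chart Ac.
have [C C0 HC] := poincare_convex oQ cQ Qa Qr e0 mU UQ Ue.
set N := cinv c @` Q0.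
have NE : N = cdom c `&` cmap c @^-1` Q0.
  apply/seteqP; split=> p.
    move=> [x Qx <-]; have [cx E] := cimg_cinv Hc (interior_subset (Q0c x Qx)).
    by split=> //=; rewrite E.
  by move=> [cp Qp]; exists (cmap c p) => //; exact: cinv_cmap.
have oN : open N by rewrite NE; exact: open_cmap_preimage.
have mN : measurable (N : set (borel M)) by exact: open_brl.
have ND : N `<=` cdom c by rewrite NE; exact: subIsetl.
have cN : cmap c @` N = Q0.
  apply/seteqP; split=> x; first by move=> [p]; rewrite NE => -[_ Qp] <-.
  move=> Qx; exists (cinv c x); first by exists x.
  by have [] := cimg_cinv Hc (interior_subset (Q0c x Qx)).
have K0' : 0 <= `|K| by [].
(* [D] bounds the density on the left-hand side, [C] is the Euclidean constant, and [K] with [d]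
   turns Euclidean gradients into energy; the absolute values guard against an empty [Q0]. *)
exists (`|D| * C * (1 + `|K| / d)) => [|f h Hf Hh hE h0].
  by rewrite !mulr_ge0 // addr_ge0 // divr_ge0 // ltW.
have mQ0 : measurable (Q0 : set (brl 'rV[R]_m)) by exact: open_brl.
have mQ : measurable (Q : set (brl 'rV[R]_m)) by exact: open_brl.
have HD x : (cmap c @` N) x -> d <= Num.sqrt (\det (g c x)) <= D.
  by rewrite cN => /HQ[].
have mf : measurable_fun (N : set (borel M)) (fun p : borel M => ((f p) ^+ 2)%:E).
  by apply: measurable_funTS; apply/measurable_EFinP; exact: sq_measurable.
have mgn : measurable_fun [set: borel M] (fun p : borel M => (gnorm f p)%:E).
  by apply/measurable_EFinP; exact: gnorm_measurable.
have /andP[_ H1] := chart_measure Hg hmu Ac mN ND d0 HD mf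
  (fun p _ => sqr_ge0 (f p)).
have gn0 p : (0 <= (gnorm f p)%:E)%E by rewrite lee_fin gnorm_ge0.
have /andP[H2 _] := chart_measure Hg hmu Ac mN ND d0 HD (measurable_funTS mgn) (fun p _ => gn0 p).
rewrite cN in H1 H2.
set I := (\int[lebm m]_(x in U) ((h x) ^+ 2)%:E)%E.
have I0 : (0 <= I)%E by apply: integral_ge0 => x _; rewrite lee_fin sqr_ge0.
have mh : measurable_fun (Q : set (brl 'rV[R]_m)) (fun x => ((h x) ^+ 2)%:E).
  apply/measurable_EFinP; apply: measurable_funX.
  by apply: open_continuous_measurable => //; case: Hh.
have mgs : measurable_fun (Q : set (brl 'rV[R]_m)) (fun x => (gsq h x)%:E).
  by apply/measurable_EFinP; exact: gsq_measurable.
have A1 : (\int[lebm m]_(x in Q0) ((f (cinv c x)) ^+ 2)%:E <=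
    \int[lebm m]_(x in Q) ((h x) ^+ 2)%:E)%E.
  have -> : (\int[lebm m]_(x in Q0) ((f (cinv c x)) ^+ 2)%:E =
      \int[lebm m]_(x in Q0) ((h x) ^+ 2)%:E)%E.
    by apply: eq_integral => x /[!inE] Qx; rewrite hE.
  by apply: ge0_subset_integral => // x _; rewrite lee_fin sqr_ge0.
have A2 : (d%:E * \int[lebm m]_(x in Q) (gsq h x)%:E <= `|K|%:E * energy f)%E.
  have -> : (\int[lebm m]_(x in Q) (gsq h x)%:E = \int[lebm m]_(x in Q0) (gsq h x)%:E)%E.
    rewrite [LHS]integral_mkcond [RHS]integral_mkcond; apply: eq_integral => x _.
    rewrite /patch; have [Qx|nQx] := pselect (Q x); last first.
      by rewrite !memNset // => /Q0Q.
    have [Q0x|nQ0x] := pselect (Q0 x); first by rewrite !mem_set.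
    by rewrite mem_set // memNset //; have [_ ->] := h0 x Qx nQ0x.
  apply: (@le_trans _ _ (d%:E * (`|K|%:E * \int[lebm m]_(x in Q0) (gnorm f (cinv c x))%:E))%E).
    apply: lee_wpmul2l; first by rewrite lee_fin ltW.
    have mgc : measurable_fun (Q0 : set (brl 'rV[R]_m)) (fun x => (gnorm f (cinv c x))%:E).
      have Q0i : Q0 `<=` cimg c by move=> x /Q0c /interior_subset.
      exact: (measurableT_comp mgn (measurable_funS (cimg_measurable Ac) Q0i (cinv_measurable Ac))).
    have K0e : (0 <= `|K|%:E)%E by rewrite lee_fin.
    rewrite -(ge0_integralZl _ mQ0 mgc (fun x _ => gn0 (cinv c x)) K0e).
    apply: ge0_le_integral => //.
    - by move=> x _; rewrite lee_fin gsq_ge0.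
    - exact: (measurable_funS mQ Q0Q mgs).
    - exact: measurable_funeM.
    move=> x Qx; rewrite lee_fin.
    have -> : gsq h x = gsq (f \o cinv c) x.
      rewrite /gsq; apply: eq_bigr => i _; congr (_ ^+ 2); apply: near_eq_derive.
      have Qn : nbhs x Q0 by exact: open_nbhs_nbhs.
      by apply: (@filterS _ (nbhs x) (nbhs_filter x) _ _ _ Qn) => y /hE.
    apply: le_trans (gsq_le_gnorm Hf Ac (Q0c x Qx)) _.
    apply: ler_wpM2r; first exact: gnorm_ge0.
    by apply: le_trans (ler_norm _); have [_] := HQ x Qx.
  rewrite muleCA; apply: lee_wpmul2l; first by rewrite lee_fin.
  apply: le_trans H2 _; apply: ge0_subset_integral => //.
apply: le_trans H1 _.
rewrite -mulrA EFinM -muleA; apply: lee_wpmul2l; first by rewrite lee_fin.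
apply: le_trans A1 _; apply: le_trans (HC h Hh) _.
rewrite EFinM -muleA; apply: lee_wpmul2l; first by rewrite lee_fin.
have Kd : 0 <= `|K| / d by rewrite divr_ge0 // ltW.
rewrite EFinD ge0_muleDl ?lee_fin // mul1e; apply: leeD; first by rewrite leeDl // energy_ge0.
have A3 : (\int[lebm m]_(x in Q) (gsq h x)%:E <= (`|K| / d)%:E * energy f)%E.
  by rewrite mulrC EFinM -muleA lee_pdivlMl.
apply: le_trans A3 _; apply: lee_wpmul2l; first by rewrite lee_fin.
by rewrite leeDr.
Qed.

End LocalPoincare.

(** * Boxes in charts and the closedness of the regular set *)

Section RegularPoints.
Context {R : realType}.

Definition nearcube m (x : 'rV[R]_m) (r : R) : set 'rV[R]_m :=
  [set y | forall i, `|y 0 i - x 0 i| < r].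

Lemma nearcube_nbhs m (x : 'rV[R]_m) (r : R) : 0 < r -> nbhs x (nearcube x r).
Proof. by move=> r0; apply/nbhs_cubeP; exists r. Qed.

Lemma open_nearcube m (x : 'rV[R]_m) (r : R) : open (nearcube x r).
Proof.
rewrite openE => y yx.
apply: (@filter_forall _ _ (fun (i : 'I_m) (z : 'rV[R]_m) => `|z 0 i - x 0 i| < r)
  (nbhs y) (nbhs_filter y)) => i.
have : nbhs (y 0 i) [set t | `|t - x 0 i| < r].
  have : nbhs (y 0 i) (ball (x 0 i) r).
    by apply: open_nbhs_nbhs; split; [exact: ball_open|rewrite -ball_normE /= distrC; exact: yx].
  by apply: filterS => t; rewrite -ball_normE /= distrC.
move=> /(@coord_continuous R 1 m 0 i y).
by apply: (@filterS _ (nbhs y) (nbhs_filter y)).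
Qed.

Lemma convex_gt0 (s a b : R) : 0 <= s -> s <= 1 -> 0 < a -> 0 < b ->
  0 < (1 - s) * a + s * b.
Proof.
move=> s0 s1 a0 b0; have [->|s1'] := eqVneq s 1.
  by rewrite subrr mul0r add0r mul1r.
apply: ltr_pwDl; last by apply: mulr_ge0 => //; exact: ltW.
by apply: mulr_gt0 => //; rewrite subr_gt0 lt_neqAle s1'.
Qed.

Lemma convex_nearcube m (x : 'rV[R]_m) (r : R) : convex_region (nearcube x r).
Proof.
move=> y z s yx zx /andP[s0 s1] i; rewrite !mxE.
have -> : y 0 i + s * (z 0 i - y 0 i) - x 0 i =
  (1 - s) * (y 0 i - x 0 i) + s * (z 0 i - x 0 i) by ring.
have := yx i; have := zx i; rewrite !ltr_norml => /andP[z1 z2] /andP[y1 y2].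
have H1 := @convex_gt0 s (r + (y 0 i - x 0 i)) (r + (z 0 i - x 0 i)) s0 s1.
have H2 := @convex_gt0 s (r - (y 0 i - x 0 i)) (r - (z 0 i - x 0 i)) s0 s1.
have {}H1 := H1 ltac:(lra) ltac:(lra); have {}H2 := H2 ltac:(lra) ltac:(lra).
by apply/andP; split; lra.
Qed.

Lemma convex_regionI m (P Q : set 'rV[R]_m) : convex_region P -> convex_region Q ->
  convex_region (P `&` Q).
Proof.
by move=> cP cQ x y s [Px Qx] [Py Qy] s01; split; [exact: cP|exact: cQ].
Qed.

Lemma convex_pos_halfspace m : convex_region (@pos_halfspace R m).
Proof.
move=> x y s Hx Hy /andP[s0 s1] i i0; rewrite !mxE.
rewrite (_ : _ + _ = (1 - s) * x 0 i + s * y 0 i); last by ring.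
by apply: convex_gt0 => //; [exact: Hx|exact: Hy].
Qed.

(** The face coordinate is the outermost variable of [lebint], and the inner integral vanishes
    unless that variable is 0. In dimension zero the set is empty. *)
Lemma lebm_face0 m :
  lebm m [set x : 'rV[R]_m | exists2 i : 'I_m, val i = 0%N & x 0 i = 0] = 0%E.
Proof.
set Z := [set x | _].
have mZ : measurable (Z : set (brl 'rV[R]_m)).
  rewrite (_ : Z = \bigcup_(i in [set i : 'I_m | val i = 0%N])
      (fun x : 'rV[R]_m => x 0 i) @^-1` [set 0]); last first.
    by apply/seteqP; split=> x [i i0 xi]; exists i.
  apply: fin_bigcup_measurable; first exact: finite_finset.
  move=> i _; rewrite -[X in measurable X]setTI.
  by apply: coord_measurable => //; exact: measurable_set1.
have -> : (lebm m Z = \int[lebm m]_x (\1_Z x)%:E)%E by rewrite integral_indic // setIT.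
rewrite -(@lebintE R m (fun x => (\1_Z x)%:E)); last 2 first.
- by apply/measurable_EFinP; exact: measurable_indic.
- by move=> x; rewrite lee_fin.
case: m @Z mZ => [|m] Z mZ /=.
  by rewrite indicE memNset // => -[[]].
pose F (t : R) := lebint (fun y : 'rV[R]_m => (\1_Z (row_mx (t%:M : 'rV[R]_1) y : 'rV[R]_m.+1))%:E).
transitivity (\int[@lebesgue_measure R]_t F t)%E; first by [].
have F0 t : t <> 0 -> F t = 0%E.
  move=> t0; rewrite /F (_ : (fun _ => _) = (fun=> 0%E)).
    rewrite lebintE //; first exact: integral0.
  apply/funext => y; rewrite indicE memNset // => -[i i0].
  have -> : i = lshift m (0 : 'I_1) by apply: val_inj.
  have E : row_mx (t%:M : 'rV[R]_1) y 0 (lshift m 0) = t by rewrite row_mxEl mxE mulr1n.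
  by move=> H; apply: t0; exact: etrans (esym E) H.
rewrite (_ : F = F \_ [set 0]); last first.
  apply/funext => t; rewrite /patch; case: ifPn => // /negP; rewrite inE => /F0.
  exact.
by rewrite -integral_mkcond integral_set1.
Qed.

Section MetricBounds.
Variables (m : nat) (M : manifold R m) (g : gram M).
Hypothesis Hg : is_metric g.
Implicit Types (c : chart R M m) (p : M).

(** Continuity is taken within the chart image, so [x0] may lie on the boundary face; definiteness
    keeps the determinant positive there. *)
Lemma metric_bounds c x0 : atlas c -> cimg c x0 ->
  exists r d D K : R, [/\ 0 < r, 0 < d & forall x, cimg c x -> nearcube x0 r x ->
    d <= Num.sqrt (\det (g c x)) <= D /\ \tr (g c x) <= K].
Proof.
move=> Ac cx0.
have cg i j : {within cimg c, continuous (fun x => g c x i j)} by exact: metric_continuous.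
have cdet : {within cimg c, continuous (fun x => \det (g c x))}.
  rewrite /determinant; apply: continuous_big => [|s _]; first exact: add_continuous.
  move=> x; apply: cvgM; first exact: cvg_cst.
  by apply: cvg_big => [|i _]; [exact: mul_continuous|exact: cg].
have ctr : {within cimg c, continuous (fun x => \tr (g c x))}.
  rewrite /mxtrace; apply: continuous_big => [|i _]; first exact: add_continuous.
  exact: cg.
have cs : {within cimg c, continuous (fun x => Num.sqrt (\det (g c x)))}.
  move=> x; apply: (@continuous_comp _ _ _ (fun x : subspace (cimg c) => \det (g c x))
     (@Num.sqrt R)); first exact: cdet.
  exact: sqrt_continuous.
set q := Num.sqrt (\det (g c x0)).
have q0 : 0 < q by rewrite sqrtr_gt0; apply: posdef_det_gt0; exact: metric_posdef.
have H1 : \forall x \near x0, cimg c x -> `|q - Num.sqrt (\det (g c x))| < q / 2.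
  have /subspace_continuousP /(_ x0 cx0) /cvgrPdist_lt /(_ (q / 2)) := cs.
  by rewrite divr_gt0 // near_withinE; apply.
have H2 : \forall x \near x0, cimg c x -> `|\tr (g c x0) - \tr (g c x)| < 1.
  have /subspace_continuousP /(_ x0 cx0) /cvgrPdist_lt /(_ 1) := ctr.
  by rewrite ltr01 near_withinE; apply.
have [r r0 rH] := (nbhs_cubeP x0 _).1 (@filterI _ (nbhs x0) (nbhs_filter x0) _ _ H1 H2).
exists r, (q / 2), (q + q / 2), (\tr (g c x0) + 1); split=> // [|x cx xr].
  by rewrite divr_gt0.
have [/(_ cx) + /(_ cx)] := rH x xr.
rewrite !ltr_norml => /andP[a1 a2] /andP[b1 b2].
set s := Num.sqrt (\det (g c x)) in a1 a2 *; set t := \tr (g c x) in b1 b2 *.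
split; last by lra.
by apply/andP; split; lra.
Qed.

(* [P] is the whole space or the open half-space. *)
Lemma chart_region c : atlas c -> exists U P : set 'rV[R]_m,
  [/\ open U, open P, convex_region P, cimg c `<=` U &
   [/\ U `&` P `<=` cimg c, (cimg c)° `<=` P & lebm m (cimg c `\` P) = 0%E]].
Proof.
move=> Ac; have mc := cimg_measurable Ac.
have [_ _ _ _ [U oU [E|E]]] := atlas_chart Ac.
  exists U, setT; split=> //; [exact: openT|by rewrite E|split=> //].
    by rewrite E setIT.
  by rewrite setDT measure0.
exists U, (@pos_halfspace R m); split=> //.
- exact: open_pos_halfspace.
- exact: convex_pos_halfspace.
- by rewrite E; exact: subIsetl.
split.
- by rewrite E; exact: pos_halfspace_interior.
- move=> x /nbhs_cubeP[r r0 rH] i i0.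
  (* A small step outwards from an interior point stays in the half-space, so the face coordinate
     was strictly positive. *)
  have : cimg c (x - (r / 2) *: delta_mx 0 i).
    apply: rH => j; rewrite !mxE; have -> (u v : R) : u - v - u = - v by ring.
    rewrite normrN normrM gtr0_norm ?divr_gt0 //.
    apply: (@le_lt_trans _ _ (r / 2)); last by rewrite ltr_pdivrMr // ltr_pMr // ltr1n.
    by case: (_ && _); rewrite ?normr1 ?normr0 ?mulr1 ?mulr0 // divr_ge0 // ltW.
  rewrite E => -[_ /(_ i i0)]; rewrite !mxE !eqxx /= mulr1 subr_ge0.
  by apply: lt_le_trans; rewrite divr_gt0.
- apply/eqP; rewrite -measure_le0 -(lebm_face0 m); apply: le_measure; rewrite ?inE.
  + by apply: measurableD => //; apply: open_brl; exact: open_pos_halfspace.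
  + rewrite (_ : [set x | _] = \bigcup_(i in [set i : 'I_m | val i = 0%N])
        (fun x : 'rV[R]_m => x 0 i) @^-1` [set 0]); last first.
      by apply/seteqP; split=> x [i i0 xi]; exists i.
    apply: fin_bigcup_measurable; first exact: finite_finset.
    move=> i _; rewrite -[X in measurable X]setTI.
    by apply: coord_measurable => //; exact: measurable_set1.
  move=> x [xc /existsNP[i /not_implyP[i0 /negP]]]; rewrite -leNgt => xi.
  exists i => //; apply: le_anti; rewrite xi; move: xc; rewrite E => -[_]; exact.
Qed.

End MetricBounds.

Section Regular.
Variables (m : nat) (M : manifold R m) (g : gram M).
Variable mu : {measure set (borel M) -> \bar R}.
Hypothesis Hg : is_metric g.
Hypothesis hmu : is_riemannian_measure g mu.
Implicit Types (c : chart R M m) (p : M).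

Definition regular : set M := [set p | exists O : set M, [/\ open O, O p & good g mu O]].

Lemma open_regular : open regular.
Proof.
rewrite openE => p [ O [oO Op gO]].
have : nbhs p O by exact: open_nbhs_nbhs.
by apply: filterS => q Oq; exists O.
Qed.

Lemma good_null (S : set M) : measurable (S : set (borel M)) -> mu S = 0%E ->
  good g mu S.
Proof.
move=> mS S0; split=> //; exists 0 => // f tf; rewrite mul0e.
rewrite /sqint (_ : (\int[mu]_(p in S) ((f p) ^+ 2)%:E)%E = 0%E) //.
apply: (@null_set_integral _ _ _ mu S) => //.
by apply: measurable_funTS; apply/measurable_EFinP; exact: sq_measurable (proj1 tf).
Qed.

(** The point [p] may lie on the boundary. The Poincare inequality is then applied on the open half
    of a box, which is still convex, and the excluded face is null. *)
Lemma closed_regular p : closure regular p -> regular p.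
Proof.
move=> clp; set c := chart_at p.
have Ac : atlas c := atlas_chart_at p; have Hc := atlas_chart Ac.
have cp : cdom c p := dom_chart_at p.
set x0 := cmap c p; have cx0 : cimg c x0 by exact: cimg_cmap.
have [r1 [d [D [K [r10 d0 HB]]]]] := metric_bounds Hg Ac cx0.
have [U [P [oU oP cP cU [UPc ciP null]]]] := chart_region Ac.
have [r2 r20 r2U] := (nbhs_cubeP x0 U).1 (open_nbhs_nbhs (conj oU (cU _ cx0))).
pose r := Num.min r1 r2.
have r0 : 0 < r by rewrite lt_min r10.
pose B := nearcube x0 r.
have B1 : B `<=` nearcube x0 r1 by move=> x xr i; apply: lt_le_trans (xr i) _; rewrite ge_min lexx.
have BU : B `<=` U.
  by move=> x xr; apply: r2U => i; apply: lt_le_trans (xr i) _; rewrite ge_min lexx orbT.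
have oB : open B by exact: open_nearcube.
pose N := cdom c `&` cmap c @^-1` B.
have oN : open N by exact: open_cmap_preimage.
have Np : N p by split=> // i; rewrite subrr normr0.
have [q [[ O [oO Oq gO]] Nq]] : regular `&` N !=set0.
  by apply: clp; exact: open_nbhs_nbhs.
(* Interior points are dense, so the centre [a] can be taken interior, inside both the box and the
   good set. *)
have [q' [[Nq' Oq'] iq']] : exists q', (N `&` O) q' /\ minterior M q'.
  apply: (@minterior_dense _ _ M q (N `&` O)).
  by apply: open_nbhs_nbhs; split; [exact: openI|].
have [cq' Bq'] := Nq'.
set a := cmap c q'; have ai : (cimg c)° a by apply/(minteriorP Ac cq').
pose Q := B `&` P.
have oQ : open Q by exact: openI.
have Qc : Q `<=` (cimg c)°.
  move=> x [Bx Px]; have : nbhs x (U `&` P).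
    by apply: open_nbhs_nbhs; split; [exact: openI|split=> //; exact: BU].
  by apply: (@filterS _ (nbhs x) (nbhs_filter x)).
have Qa : Q a by split=> //; exact: ciP.
have Oa : O (cinv c a) by rewrite (cinv_cmap Hc cq').
have [e e0 eO] := (nbhs_cubeP a _).1 (cinv_near Hc oO ai Oa).
pose W := Q `&` nearcube a e.
have oW : open W by apply: openI => //; exact: open_nearcube.
have mW : measurable (W : set (brl 'rV[R]_m)) by exact: open_brl.
have WO x : W x -> O (cinv c x) by move=> [_ xe]; exact: eO.
have HQ x : Q x -> d <= Num.sqrt (\det (g c x)) <= D /\ \tr (g c x) <= K.
  move=> Qx; apply: HB; first exact: (interior_subset (Qc x Qx)).
  by apply: B1; case: Qx.
have cQ : convex_region Q by apply: convex_regionI => //; exact: convex_nearcube.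
have Qr x i : Q x -> `|x 0 i - a 0 i| <= r + r.
  move=> [Bx _]; rewrite -(subrKA (x0 0 i)); apply: le_trans (ler_normD _ _) _.
  by apply: lerD; [exact: ltW (Bx i)|rewrite distrC; exact: ltW (Bq' i)].
have [C C0 HC] := chart_poincare Hg hmu Ac Qc oQ (@subset_refl _ Q) d0 HQ oQ cQ Qa Qr e0 mW
  (@subIsetl _ _ _) (fun x Qx xe => conj Qx xe).
have [_ [C1 C10 HO]] := gO.
have g1 : good g mu (cinv c @` Q).
  have QE : cinv c @` Q = cdom c `&` cmap c @^-1` Q.
    apply/seteqP; split=> z.
      move=> [x Qx <-]; have [cx E] := cimg_cinv Hc (interior_subset (Qc x Qx)).
      by split=> //=; rewrite E.
    by move=> [cz Qz]; exists (cmap c z) => //; exact: cinv_cmap.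
  split; first by rewrite QE; apply: open_brl; exact: open_cmap_preimage.
  exists (C * (d^-1 * C1 + 1)) => [|f tf].
    by rewrite mulr_ge0 // addr_ge0 // mulr_ge0 // invr_ge0 ltW.
  have [Hf _] := tf.
  have Ch : Ckn 1 Q (f \o cinv c) by apply: Ckn_sub Qc _; exact: (Ck_fun_chart (k := None)).
  apply: le_trans (HC f (f \o cinv c) Hf Ch (fun x _ => erefl) _) _ => //.
  rewrite EFinM -muleA; apply: lee_wpmul2l; first by rewrite lee_fin.
  rewrite EFinD ge0_muleDl ?lee_fin ?mulr_ge0 ?invr_ge0 ?(ltW d0) // mul1e.
  apply: leeD => //.
  (* The integral over [W] is carried back to the manifold, where it is bounded through the good set
     [O]; the lower bound on the density costs the factor [d^-1]. *)
  pose V := cdom c `&` cmap c @^-1` W.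
  have oV : open V by exact: open_cmap_preimage.
  have VW : cmap c @` V = W.
    apply/seteqP; split=> x; first by move=> [z [_ Wz] <-].
    move=> Wx; have [cx E] := cimg_cinv Hc (interior_subset (Qc x (proj1 Wx))).
    by exists (cinv c x) => //; split=> //=; rewrite E.
  have HD x : (cmap c @` V) x -> d <= Num.sqrt (\det (g c x)) <= D.
    by rewrite VW => -[/HQ[]].
  have mf : measurable_fun [set: borel M] (fun p : borel M => ((f p) ^+ 2)%:E).
    by apply/measurable_EFinP; exact: sq_measurable.
  have f0 z : (0 <= ((f z) ^+ 2)%:E)%E by rewrite lee_fin sqr_ge0.
  have /andP[H1 _] := chart_measure Hg hmu Ac (open_brl oV) (@subIsetl _ _ _) d0 HD
    (measurable_funTS mf) (fun z _ => f0 z).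
  rewrite VW in H1.
  rewrite EFinM -muleA -lee_pdivrMl ?invr_gt0 // invrK.
  apply: le_trans H1 _; apply: le_trans (HO f tf).
  apply: ge0_subset_integral => //.
  - exact: open_brl.
  - exact: open_brl.
  - exact: measurable_funTS.
  - by move=> z [cz Wz]; have := WO _ Wz; rewrite (cinv_cmap Hc cz).
have mNQ : measurable (N `\` cinv c @` Q : set (borel M)).
  by apply: measurableD; [exact: open_brl|case: g1].
(* What remains of the neighbourhood lies over the boundary face, which has measure zero. *)
have g2 : good g mu (N `\` cinv c @` Q).
  apply: good_null => //.
  have sub : N `\` cinv c @` Q `<=` cdom c by move=> z [[cz _] _].
  rewrite (riemannian_measureE Hg hmu Ac mNQ sub).
  have mI := cmap_image_measurable Ac mNQ sub.
  apply: (@null_set_integral _ _ _ (lebm m)) => //.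
  - apply/measurable_EFinP; apply: (measurable_funS (cimg_measurable Ac) _ (det_metric_measurable Hg Ac)).
    by move=> x [z [[cz _] _] <-]; exact: cimg_cmap.
  apply/eqP; rewrite -measure_le0 -null; apply: le_measure; rewrite ?inE //.
    by apply: measurableD; [exact: cimg_measurable|exact: open_brl].
  move=> x [z [[cz Bz] nz] <-]; split; first exact: cimg_cmap.
  by move=> Pz; apply: nz; exists (cmap c z) => //; exact: cinv_cmap.
exists N; split=> //.
apply: good_sub (open_brl oN) _ (goodU g1 g2) => z Nz.
by have [?|?] := pselect ((cinv c @` Q) z); [left|right].
Qed.

End Regular.
End RegularPoints.

(** * Compactness, and functions vanishing at an end *)

Section Compactness.
Context {R : realType}.

(** Asking only for a superset of [K] makes it unnecessary that the property pass to subsets. *)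
Lemma compact_union_ind (T : ptopologicalType) (K : set T) (P : set T -> Prop) :
  compact K -> P set0 -> (forall A B, P A -> P B -> P (A `|` B)) ->
  (forall p, K p -> exists A, [/\ open A, A p & P A]) ->
  exists2 S, P S & K `<=` S.
Proof.
move=> cK P0 PU H.
have H' p : exists A, K p -> [/\ open A, A p & P A].
  have [Kp|nKp] := pselect (K p); last by exists set0.
  by have [A HA] := H p Kp; exists A.
have [A HA] := choice H'.
move: cK; rewrite compact_cover => /(_ T K A).
case=> [p Kp|p Kp|D DK cov].
- by have [] := HA p Kp.
- by exists p => //; have [] := HA p Kp.
have [s Ds] := (finite_seqP [set` D]).1 (finite_fset D).
have DK' p : p \in s -> K p.
  move=> ps; have : [set` D] p by rewrite Ds.
  by move=> /DK /[!inE].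
suff [S PS DS] : exists2 S, P S & forall p, p \in s -> A p `<=` S.
  exists S => // q /cov [p pD Apq]; apply: (DS p) Apq.
  by have : [set` s] p by rewrite -Ds.
elim: s DK' {Ds} => [|p s IH] Hs; first by exists set0.
have [|S PS SS] := IH; first by move=> q qs; apply: Hs; rewrite inE qs orbT.
exists (A p `|` S).
  by apply: PU => //; have [] := HA p (Hs p (mem_head _ _)).
move=> q; rewrite inE => /orP[/eqP->|qs]; first by left.
by move=> r Ar; right; exact: (SS q qs).
Qed.

(** Read off the supremum over simple functions, hence valid without measurability; it is applied to
    arc length integrands and to norms. *)
Lemma ge0_le_integral_sup d (T : measurableType d) (mu : {measure set T -> \bar R})
    (D : set T) (f1 f2 : T -> \bar R) :
  (forall x, D x -> 0 <= f1 x)%E -> (forall x, D x -> f1 x <= f2 x)%E ->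
  (\int[mu]_(x in D) f1 x <= \int[mu]_(x in D) f2 x)%E.
Proof.
move=> f10 f12; have f20 x : D x -> (0 <= f2 x)%E.
  by move=> Dx; exact: le_trans (f10 x Dx) (f12 x Dx).
rewrite !ge0_integralE //; apply: ereal_sup_le => _ [h hf <-].
exists h => // x; apply: le_trans (hf x) _; rewrite /patch.
by case: ifPn => // /[!inE] /f12.
Qed.

Section Vanishing.
Variables (m : nat) (M : manifold R m) (g : gram M).
Variable mu : {measure set (borel M) -> \bar R}.
Hypothesis Hg : is_metric g.
Hypothesis hmu : is_riemannian_measure g mu.

Lemma pd_eq0_near n (h : 'rV[R]_n -> R) (x : 'rV[R]_n) :
  (\forall y \near x, h y = 0) -> gsq h x = 0.
Proof.
move=> H; rewrite /gsq big1 // => i _.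
rewrite /pd (_ : 'D_ _ h x = 'D_(delta_mx 0 i : 'rV[R]_n) (fun=> 0 : R) x); last first.
  exact: near_eq_derive.
by rewrite derive_cst expr0n.
Qed.

(** [L] vanishes on the end, the manifold occupies [0 < L], and the cube about [a] lies beyond the
    end. [Q], [a] and [e] do not depend on [f]; the neighbourhoods of [L = 0] on which [f] vanishes
    do, but they serve only to make the extension by zero smooth and flat, and do not enter the
    constant. *)
Lemma vanish_good (c : chart R M m) (Q : set 'rV[R]_m) (L : 'rV[R]_m -> R)
    (a : 'rV[R]_m) (e r d D K : R) :
  atlas c -> continuous L -> open Q -> convex_region Q -> Q a ->
  (forall x i, Q x -> `|x 0 i - a 0 i| <= r) ->
  (forall x, Q x -> 0 < L x -> (cimg c)° x /\
     d <= Num.sqrt (\det (g c x)) <= D /\ \tr (g c x) <= K) ->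
  0 < d -> 0 < e -> (forall x, Q x -> (forall i, `|x 0 i - a 0 i| < e) -> L x < 0) ->
  (forall f, real_test f -> forall x, Q x -> L x = 0 ->
     \forall y \near x, Q y -> 0 < L y -> f (cinv c y) = 0) ->
  good g mu (cinv c @` (Q `&` [set x | 0 < L x])).
Proof.
move=> Ac cL oQ cQ Qa Qr HQ d0 e0 Le van; have Hc := atlas_chart Ac.
have oL (A : set R) : open A -> open (L @^-1` A) by move=> oA; apply: open_comp => // x _; exact: cL.
set Q0 := Q `&` [set x | 0 < L x].
have oQ0 : open Q0 by apply: openI => //; exact: (oL [set t | 0 < t] (@open_gt R 0)).
pose U := Q `&` [set x | L x < 0].
have oU : open U by apply: openI => //; exact: (oL [set t | t < 0] (@open_lt R 0)).
have Q0c : Q0 `<=` (cimg c)° by move=> x [Qx Lx]; have [] := HQ x Qx Lx.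
have QE : cinv c @` Q0 = cdom c `&` cmap c @^-1` Q0.
  apply/seteqP; split=> z.
    move=> [x Qx <-]; have [cx E] := cimg_cinv Hc (interior_subset (Q0c x Qx)).
    by split=> //=; rewrite E.
  by move=> [cz Qz]; exists (cmap c z) => //; exact: cinv_cmap.
have [C C0 HC] := chart_poincare Hg hmu Ac Q0c oQ0 (@subIsetl _ _ _) d0
  (fun x Qx => proj2 (HQ x (proj1 Qx) (proj2 Qx))) oQ cQ Qa Qr e0 (open_brl oU)
  (@subIsetl _ _ _) (fun x Qx xe => conj Qx (Le x Qx xe)).
split; first by rewrite QE; apply: open_brl; exact: open_cmap_preimage.
exists C => // f tf; have [Hf _] := tf.
pose h x := if 0 < L x then f (cinv c x) else 0.
have hE x : Q0 x -> h x = f (cinv c x) by move=> [_ Lx]; rewrite /h Lx.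
have h0 x : Q x -> ~ Q0 x -> \forall y \near x, h y = 0.
  move=> Qx nQ0; have Lx : L x <= 0.
    by rewrite leNgt; apply/negP => Lx; apply: nQ0.
  have [L0|L0] := eqVneq (L x) 0.
    have Qn : nbhs x Q by exact: open_nbhs_nbhs.
    apply: (@filterS2 _ (nbhs x) (nbhs_filter x) _ _ _ _ Qn (van f tf x Qx L0)) => y Qy H.
    by rewrite /h; case: ifPn => // Ly; exact: H.
  have Un : nbhs x U by apply: open_nbhs_nbhs; split=> //; split=> //=; rewrite lt_neqAle L0.
  apply: (@filterS _ (nbhs x) (nbhs_filter x) _ _ _ Un) => y [_ Ly].
  by rewrite /h ltNge (ltW Ly).
have Ch : Ckn 1 Q h.
  apply: Ckn_local => x Qx; have [Q0x|nQ0x] := pselect (Q0 x).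
    exists Q0; split=> //; apply: (@Ckn_eq _ _ _ _ (f \o cinv c)) => //.
      by move=> y /hE ->.
    by apply: Ckn_sub Q0c _; exact: (Ck_fun_chart (k := None)).
  have Vx : nbhs x [set y | h y = 0] := h0 x Qx nQ0x.
  move: Vx; rewrite nbhsE => -[V [oV Vx] VH].
  exists V; split=> //; apply: (@Ckn_eq _ _ _ _ (fun=> 0)) => //.
    by move=> y /VH ->.
  exact: Ckn_cst.
have := HC f h Hf Ch hE.
have -> : (\int[lebm m]_(x in U) ((h x) ^+ 2)%:E = 0)%E.
  rewrite (_ : (\int[lebm m]_(x in U) ((h x) ^+ 2)%:E)%E = (\int[lebm m]_(x in U) 0)%E).
    exact: integral0.
  by apply: eq_integral => x /[!inE] -[_ Lx]; rewrite /h ltNge (ltW Lx) /= expr0n.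
rewrite add0e; apply => x Qx nQ0x; have H := h0 x Qx nQ0x; split.
  exact: (nbhs_singleton H).
exact: pd_eq0_near.
Qed.

(** [rho] has a positive minimum on the compact support. Since [rho] tends to zero at every end,
    this is how compact support becomes vanishing near the ends. *)
Lemma real_test_rho_bound (rho f : M -> R) : Ck_fun (Some 1%N) setT rho ->
  (forall p, 0 < rho p) -> real_test f ->
  exists2 c0 : R, 0 < c0 & forall p, rho p < c0 -> f p = 0.
Proof.
move=> Hr r0 [_ cf]; set S := closure _ in cf.
have fS p : ~ S p -> f p = 0.
  by move=> nS; apply/eqP; apply: contrapT => /negP fp; apply: nS; exact: subset_closure.
have [[p Sp]|S0] := pselect (S !=set0); last first.
  by exists 1 => // p _; apply: fS => Sp; apply: S0; exists p.
have cr : {within S, continuous rho}.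
  exact: continuous_subspaceW (@subsetT _ _) (Ck_fun_continuous Hr).
have [q Sq qmin] := @compact_EVT_min M R rho S (ex_intro _ p Sp) cf cr.
exists (rho q) => // z zq; apply: fS => Sz.
by have := qmin z (mem_set Sz); rewrite leNgt zq.
Qed.

End Vanishing.
End Compactness.

(** * The core near the removed hypersurfaces *)

Section Distance.
Context {R : realType}.

Lemma posdef_entry_le_trace m (G : 'M[R]_m) (i j : 'I_m) : posdef G -> `|G i j| <= \tr G.
Proof.
move=> PG.
have E k l : G k l = bform G (delta_mx 0 k) (delta_mx 0 l).
  by rewrite /bform trmx_delta -colE -rowE !mxE.
have D0 k : 0 <= G k k by rewrite E; exact: qform_ge0.
have Dt k : G k k <= \tr G by rewrite /mxtrace (bigD1 k) //= lerDl sumr_ge0.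
have t0 : 0 <= \tr G := le_trans (D0 i) (Dt i).
rewrite -(ler_pXn2r (n := 2)) ?nnegrE ?normr_ge0 //.
rewrite real_normK ?num_real // E.
apply: le_trans (bform_cauchy_schwarz PG _ _) _.
rewrite -[qform G (delta_mx 0 i)]/(bform G _ _) -[qform G (delta_mx 0 j)]/(bform G _ _).
by rewrite -!E expr2; apply: ler_pM.
Qed.

Lemma qform_le_trace m (G : 'M[R]_m) (v : 'rV[R]_m) (e : R) : posdef G -> 0 <= e ->
  (forall i, `|v 0 i| <= e) -> qform G v <= (m%:R ^+ 2 * \tr G) * e ^+ 2.
Proof.
move=> PG e0 ve; apply: le_trans (ler_norm _) _.
rewrite /qform mxE.
have -> : (m%:R ^+ 2 * \tr G) * e ^+ 2 = \sum_(j < m) \sum_(i < m) (e * \tr G * e).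
  rewrite !sumr_const card_ord -mulrnA -[RHS]mulr_natl natrM; ring.
apply: le_trans (ler_norm_sum _ _ _) _; apply: ler_sum => j _.
rewrite !mxE mulr_suml; apply: le_trans (ler_norm_sum _ _ _) _; apply: ler_sum => i _.
rewrite !normrM; apply: ler_pM => //; rewrite ?mulr_ge0 //.
by apply: ler_pM => //; exact: posdef_entry_le_trace.
Qed.

Variables (m : nat) (M : manifold R m) (g : gram M).
Hypothesis Hg : is_metric g.

Lemma mdist_ge0 (p : M) (S : set M) : (0 <= Defs.mdist g p S)%E.
Proof.
apply: le_ereal_inf_tmp => l [q _ J]; elim: J => // q' l' c gam _ l0 _ _ _ _ _.
by apply: adde_ge0 => //; apply: integral_ge0 => t _; rewrite lee_fin sqrtr_ge0.
Qed.

(** The straight segment in the chart is an admissible curve, and the bound on the trace makes its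
    length small. *)
Lemma mdist_near (S : set M) (c : chart R M m) (x0 : 'rV[R]_m) (e : R) :
  atlas c -> (cimg c)° x0 -> S (cinv c x0) -> 0 < e ->
  \forall x \near x0, (Defs.mdist g (cinv c x) S <= e%:E)%E.
Proof.
move=> Ac x0i S0 e0.
have [r1 [d [D [K [r10 _ HB]]]]] := metric_bounds Hg Ac (interior_subset x0i).
have [r2 r20 r2U] := (nbhs_cubeP x0 (cimg c)).1 x0i.
(* Bounds the Riemannian length of a vector with coordinates at most 1, by [qform_le_trace]; the
   maximum keeps the radicand nonnegative. *)
pose C := Num.sqrt (m%:R ^+ 2 * Num.max K 0).
have C0 : 0 <= C by exact: sqrtr_ge0.
pose h := Num.min (Num.min r1 r2) (e / (C + 1)).
have C1 : 0 < C + 1 by rewrite ltr_wpDl.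
have h0 : 0 < h by rewrite !lt_min r10 r20 divr_gt0.
have hr1 : h <= r1 by rewrite !ge_min lexx.
have hr2 : h <= r2 by rewrite !ge_min lexx orbT.
have he : C * h <= e.
  apply: (@le_trans _ _ ((C + 1) * h)); first by apply: ler_wpM2r; [exact: ltW|rewrite lerDl].
  by rewrite mulrC -ler_pdivlMr // ge_min lexx orbT.
apply: (@filterS _ (nbhs x0) (nbhs_filter x0) _ _ _ (nearcube_nbhs x0 h0)) => x xh.
pose v := x0 - x; pose gam (t : R) : 'rV[R]_m := x + t *: v.
have dgam t : is_derive t (1 : R) gam v.
  rewrite /gam; have dz : is_derive t (1 : R) (fun s : R => s *: v) v.
    have E : (fun h' : R => h'^-1 *: (((fun s : R => s *: v) \o shift t) (h' *: 1) - t *: v)) @ 0^' --> v.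
      apply: (@cvg_trans _ ((fun=> v) @ (0^' : set_system R))); last exact: cvg_cst.
      apply: near_eq_cvg; near=> s.
      rewrite /= scalerDl addrK scalerA (_ : s *: 1 = s) ?mulVf ?scale1r //; last exact: mulr1.
      by near: s; exact: nbhs_dnbhs_neq.
    by split; [apply/cvg_ex; exists v|exact: cvg_lim].
  by rewrite -[X in is_derive _ _ _ X]add0r; apply: is_deriveD.
have gamE : derive1 gam = fun=> v.
  by apply/funext => t; rewrite derive1E; have [_ H] := dgam t; exact: H.
have dergam t : derivable gam t 1 by have [H _] := dgam t; exact: H.
have gamQ t : 0 <= t <= 1 -> cimg c (gam t) /\ nearcube x0 r1 (gam t).
  move=> t01; have H : nearcube x0 h (gam t).
    apply: convex_nearcube => // i; rewrite subrr normr0 //.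
  split; last by move=> i; exact: lt_le_trans (H i) hr1.
  by apply: r2U => i; exact: lt_le_trans (H i) hr2.
have gam0 : gam 0 = x by rewrite /gam scale0r addr0.
have gam1 : gam 1 = x0 by rewrite /gam scale1r addrC subrK.
have J : joins g (cinv c x) (cinv c (gam 1))
  (0 + \int[@lebesgue_measure R]_(t in `[0%R, 1%R])
             (Num.sqrt (qform (g c (gam t)) (derive1 gam t)))%:E)%E.
  have cgam : continuous (derive1 gam) by rewrite gamE => t; exact: cvg_cst.
  have Ig t : 0 <= t <= 1 -> cimg c (gam t) by move=> /gamQ[].
  have E0 : cinv c (gam 0) = cinv c x by rewrite gam0.
  exact (joins_step (joins_refl g (cinv c x)) Ac dergam cgam Ig E0).
apply: (@le_trans _ _ (0 + \int[@lebesgue_measure R]_(t in `[0%R, 1%R])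
             (Num.sqrt (qform (g c (gam t)) (derive1 gam t)))%:E)%E).
  by apply: ereal_inf_lbound; exists (cinv c (gam 1)) => //; rewrite gam1.
rewrite add0e; apply: (@le_trans _ _ (\int[@lebesgue_measure R]_(t in `[0%R, 1%R]) (cst e%:E t))%E).
  apply: ge0_le_integral_sup => t /=; rewrite in_itv /= => t01; first by rewrite lee_fin sqrtr_ge0.
  have [cg Ng] := gamQ t t01; have [_ tK] := HB _ cg Ng.
  rewrite lee_fin gamE; apply: le_trans he.
  have -> : C * h = Num.sqrt ((m%:R ^+ 2 * Num.max K 0) * h ^+ 2).
    by rewrite sqrtrM ?sqrtr_sqr ?gtr0_norm // mulr_ge0 ?sqr_ge0 // le_max lexx orbT.
  apply: ler_wsqrtr.
  have PG := metric_posdef Hg Ac cg.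
  apply: le_trans (qform_le_trace PG (ltW h0) _) _.
    by move=> i; rewrite /v !mxE distrC; apply: ltW; exact: xh.
  apply: ler_wpM2r; first exact: sqr_ge0.
  by apply: ler_wpM2l; [exact: sqr_ge0|rewrite le_max tK].
rewrite integral_cst; last exact: measurable_itv.
rewrite [X in (_ * X)%E](_ : _ = 1%E) ?mule1 //.
transitivity (@lebesgue_measure R `[0%R, 1%R]%classic); first by [].
by rewrite lebesgue_measure_itv /= lte01 oppr0 adde0.
Unshelve. all: by end_near. Qed.

End Distance.

(** * Charts of the core, seen in [M] *)

Section Core.
Context {R : realType}.
Variables (m : nat) (M : manifold R m) (g : gram M) (rho : M -> R).
Variables (ns : nat) (beta : 'I_ns -> R) (rc : removable_core g rho beta).
Variable mu : {measure set (borel M) -> \bar R}.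
Hypothesis Hg : is_metric g.
Hypothesis hmu : is_riemannian_measure g mu.
Hypothesis rho_C1 : Ck_fun (Some 1%N) setT rho.
Hypothesis rho_gt0 : forall p, 0 < rho p.

Notation N := (core rc).

Lemma closed_csing j : closed (csing (r := rc) j).
Proof.
have [_ cs _ _ _] := csingP rc j.
by apply: compact_closed => //; exact: manifold_hausdorff.
Qed.

(** With [predT] this concerns the regular part of the core, with [predC1 j] the complement of all
    hypersurfaces but one. *)
Lemma open_avoid (P : pred 'I_ns) :
  open [set p : N | forall j, P j -> ~ csing (r := rc) j p].
Proof.
rewrite openE => p Hp.
apply: (@filter_forall _ _ (fun (j : 'I_ns) (q : N) => P j -> ~ csing (r := rc) j q)
  (nbhs p) (nbhs_filter p)) => j.
have [Pj|nPj] := boolP (P j); last by apply: filterE => q.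
have : nbhs p (~` csing (r := rc) j).
  by apply: open_nbhs_nbhs; split; [exact/closed_openC/closed_csing|exact: Hp].
by apply: filterS => q nq _.
Qed.

Lemma open_creg : open (creg rc).
Proof.
have := open_avoid predT; rewrite (_ : [set p | _] = creg rc) //.
by apply/seteqP; split=> p H j; [exact: H|move=> _; exact: H].
Qed.

(** The interior is imposed because the image of this part under [cincl] is open in [M]. *)
Definition cpart : set N := creg rc `&` minterior N.

Lemma open_cpart : open cpart.
Proof. by apply: openI; [exact: open_creg|exact: (open_minterior N)]. Qed.

Lemma cincl_continuous p : creg rc p -> {for p, continuous (cincl rc)}.
Proof.
move=> cp; have [_ [ci _] _] := cincl_diffeo rc.
by move: ci; rewrite continuous_open_subspace ?open_creg //; last exact: open_creg; move=> /(_ p); rewrite inE => /(_ cp).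
Qed.

Lemma cproj_continuous p : (cincl rc @` cpart) p -> {for p, continuous (cproj rc)}.
Proof.
move=> cp; have [_ _ [ci _]] := cincl_diffeo rc.
have {}ci : {within cincl rc @` cpart, continuous (cproj rc)}.
  by apply: continuous_subspaceW ci => q [z [cz _] <-]; exists z.
by move: ci; rewrite continuous_open_subspace; last exact: cincl_open; move=> /(_ p); rewrite inE => /(_ cp).
Qed.

Lemma cincl_open_image (W : set N) : open W -> W `<=` cpart -> open (cincl rc @` W).
Proof.
move=> oW Wc; rewrite openE => _ [p Wp <-].
have [pK _ _] := cincl_diffeo rc.
have cp : (cincl rc @` cpart) (cincl rc p) by exists p => //; exact: Wc.
have H1 : nbhs (cincl rc p) (cincl rc @` cpart) by apply: open_nbhs_nbhs; split=> //; exact: cincl_open.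
have H2 : nbhs (cincl rc p) (cproj rc @^-1` W).
  apply: cproj_continuous => //; rewrite pK; last by have [] := Wc p Wp.
  exact: open_nbhs_nbhs.
apply: filterS2 H1 H2 => _ [z cz <-] /= Wz; exists z => //.
by rewrite pK in Wz; last by have [] := cz.
Qed.

(** Near the hypersurface [rho] is a power of the distance with exponent at least 1, hence at most
    the distance once the latter is at most 1. *)
Lemma rho_near_csing j (p : N) (e : R) : csing (r := rc) j p -> 0 < e ->
  \forall q \near p, creg rc q -> rho (cincl rc q) < e.
Proof.
move=> jp e0; have [GM _ _ _] := coreP rc; have [_ _ _ _ ji] := csingP rc j.
have [delta [r [_ /andP[r0 _] _ Hrho _]]] := core_rho rc.
set c := chart_at p; have Ac : atlas c := atlas_chart_at p.
have cp : cdom c p := dom_chart_at p; have Hc := atlas_chart Ac.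
(* [r] gives access to the formula for [rho], 1 to the comparison of powers, and [e / 2] leaves room
   for a strict inequality. *)
pose e' := Num.min (e / 2) (Num.min r 1).
have e'0 : 0 < e' by rewrite !lt_min divr_gt0 //= r0 ltr01.
have pi : (cimg c)° (cmap c p) := ji p jp.
have jp' : csing (r := rc) j (cinv c (cmap c p)) by rewrite (cinv_cmap Hc).
have H : nbhs (cmap c p) [set x | (Defs.mdist (core_gram (r := rc)) (cinv c x) (csing (r := rc) j) <= e'%:E)%E].
  exact: mdist_near.
have cd : nbhs p (cdom c) by apply: open_nbhs_nbhs; split=> //; exact: open_cdom.
apply: filterS2 cd (cmap_continuous Hc cp H) => q cq /=; rewrite (cinv_cmap Hc cq) => Hq nq.
set d := Defs.mdist _ _ _ in Hq.
have d0 : (0 <= d)%E by exact: mdist_ge0.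
have dfin : d \is a fin_num by rewrite ge0_fin_numE //; apply: le_lt_trans Hq _; exact: ltry.
have fd : fine d <= e' by rewrite -lee_fin fineK.
have er : e' <= r by rewrite !ge_min lexx orbT.
have e1 : e' <= 1 by rewrite !ge_min lexx !orbT.
have e2 : e' <= e / 2 by rewrite !ge_min lexx.
have Er := Hrho j q nq (le_trans Hq (er : (e'%:E <= r%:E)%E)).
have fd0 : 0 <= fine d by exact: fine_ge0.
(* Positivity of the distance off the hypersurface has not been established, so the value 0 is
   treated apart; its power is 0. *)
rewrite Er -/d; move: fd0; rewrite le_eqVlt => /orP[/eqP fd0|fd0].
  by rewrite -fd0 powR0 // gt_eqF // (lt_le_trans ltr01) // (beta_ge1 rc).
apply: le_lt_trans (ge1r_powR _ _) _; first by rewrite fd0 (le_trans fd).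
- exact: (beta_ge1 rc).
- by lra.
Qed.

Lemma vanish_near_csing f j (p : N) : real_test f -> csing (r := rc) j p ->
  \forall q \near p, creg rc q -> f (cincl rc q) = 0.
Proof.
move=> tf jp; have [c0 c00 Hc0] := real_test_rho_bound rho_C1 rho_gt0 tf.
by apply: filterS (rho_near_csing jp c00) => q H cq; apply: Hc0; exact: H.
Qed.

(** A core chart with the removed set taken out of its domain: both sides of a hypersurface remain
    in one coordinate system, which is what permits an extension across it. *)
Definition core_chart (c : chart R N m) : chart R M m :=
  Chart (cincl rc @` (cpart `&` cdom c)) (cmap c \o cproj rc) (cincl rc \o cinv c).

Lemma cimg_core_chart c : atlas c ->
  cimg (core_chart c) = (cimg c)° `&` cinv c @^-1` cpart.
Proof.
move=> Ac; have Hc := atlas_chart Ac; have [pK _ _] := cincl_diffeo rc.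
apply/seteqP; split=> x.
  move=> [_ [p [cp dp] <-] <-] /=; rewrite pK; last by have [] := cp.
  by split; [apply/(minteriorP Ac dp); have [] := cp|rewrite /= (cinv_cmap Hc)].
move=> [xi cx]; have [dx E] := cimg_cinv Hc (interior_subset xi).
exists (cincl rc (cinv c x)); first by exists (cinv c x).
by rewrite /= pK //; have [] := cx.
Qed.

(** Transitions to and from charts of [M] are the coordinate expressions of [cincl] and [cproj], so
    maximality of the atlas applies. *)
Lemma core_chart_atlas c : atlas c -> atlas (core_chart c).
Proof.
move=> Ac; have Hc := atlas_chart Ac; have [pK [ciC ciS] [cpC cpS]] := cincl_diffeo rc.
have oi : open (cimg (core_chart c)).
  by rewrite cimg_core_chart //; apply: open_cinv_preimage => //; exact: open_cpart.
have od : open (cdom (core_chart c)).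
  apply: cincl_open_image; last exact: subIsetl.
  by apply: openI; [exact: open_cpart|exact: open_cdom].
apply: atlas_maximal.
  split=> //.
  - move=> _ [p [cp dp] <-] /=; rewrite pK; last by have [] := cp.
    by rewrite (cinv_cmap Hc).
  - rewrite continuous_open_subspace // => _ /set_mem [p [cp dp] <-] /=.
    apply: continuous_comp; first by apply: cproj_continuous; exists p.
    by rewrite pK; [exact: cmap_continuous|have [] := cp].
  - rewrite continuous_open_subspace // => x /set_mem.
    rewrite cimg_core_chart // => -[xi [cx _]].
    apply: continuous_comp; first exact: cinv_continuous.
    exact: cincl_continuous.
  - by exists (cimg (core_chart c)) => //; left.
move=> c' Ac'; split=> j.
  apply: Ck_on_sub (ciS c c' Ac Ac' j) => _ [_ [[p [[cp _] dp] <-] dp'] <-] /=.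
  by rewrite pK //; exists p.
apply: Ck_on_sub (cpS c' c Ac' Ac j) => _ [q [dp' [p [[cp _] dp] E]] <-] /=.
rewrite -{q}E in dp' *; exists (cincl rc p) => //; split; last by rewrite /= pK.
by split=> //; exists p.
Qed.

(** In this pair of charts [cincl] is the identity, and the isometry condition becomes an equality
    of Gram matrices. *)
Lemma core_chart_metric c x : atlas c -> cimg (core_chart c) x ->
  g (core_chart c) x = core_gram (r := rc) c x.
Proof.
move=> Ac cx; have Hc := atlas_chart Ac; have [pK _ _] := cincl_diffeo rc.
have oi : open (cimg (core_chart c)).
  by rewrite cimg_core_chart //; apply: open_cinv_preimage => //; exact: open_cpart.
have := cx; rewrite cimg_core_chart // => -[xi cpx].
have [dx _] := cimg_cinv Hc (interior_subset xi).
have [crx _] := cpx.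
have dc : cdom (core_chart c) (cincl rc (cinv c x)) by exists (cinv c x).
have <- := core_metric Ac (core_chart_atlas Ac) xi crx dc.
rewrite /pullback /=.
set F := (fun y : 'rV[R]_m => cmap c (cproj rc (cincl rc (cinv c y)))).
have FE : \forall y \near x, id y = F y.
  have : nbhs x (cimg (core_chart c)) by exact: open_nbhs_nbhs.
  apply: (@filterS _ (nbhs x) (nbhs_filter x)) => y.
  rewrite cimg_core_chart // => -[yi [cy _]]; rewrite /F pK //.
  by have [_ ->] := cimg_cinv Hc (interior_subset yi).
have dI : differentiable (fun y : 'rV[R]_m => y) x by [].
have [_ <-] := near_eq_jacobian FE dI.
rewrite jacobian_id mul1mx trmx1 mulmx1; congr (g _ _).
by have := nbhs_singleton FE; rewrite /F /= => <-.
Qed.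

End Core.

(** * Propagation of goodness in the core *)

Section CoreGood.
Context {R : realType}.
Variables (m : nat) (M : manifold R m) (g : gram M) (rho : M -> R).
Variables (ns : nat) (beta : 'I_ns -> R) (rc : removable_core g rho beta).
Variable mu : {measure set (borel M) -> \bar R}.
Hypothesis Hg : is_metric g.
Hypothesis hmu : is_riemannian_measure g mu.
Hypothesis rho_C1 : Ck_fun (Some 1%N) setT rho.
Hypothesis rho_gt0 : forall p, 0 < rho p.

Notation N := (core rc).

Definition core_regular : set N := [set p | exists V : set N,
  [/\ open V, V p & exists2 S, good g mu S & cincl rc @` (V `&` creg rc) `<=` S]].

(** The two sides of the hypersurface count as two ends. Each is treated alone, with
    [L x = s * x 0 i] and [s] equal to 1 or -1: the function is replaced by zero on the opposite
    side, even where the test function lives there. *)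
Lemma csing_core_regular j p0 : csing (r := rc) j p0 -> core_regular p0.
Proof.
move=> jp; have [GM _ _ _] := coreP rc; have [_ _ _ Hhyp _] := csingP rc j.
have [c [i [Ac cp oc Hs]]] := Hhyp p0 jp; have Hc := atlas_chart Ac.
set x0 := cmap c p0; have cx0 : cimg c x0 by exact: cimg_cmap.
have x0i : x0 0 i = 0 by apply/Hs.
have ci x : cimg c x -> (cimg c)° x by move=> cx; exact: (open_nbhs_nbhs (conj oc cx)).
(* Keeps away from the other hypersurfaces, so that only [x 0 i = 0] is missing from the box. *)
pose Av := [set p : N | forall k, k != j -> ~ csing (r := rc) k p].
have oAv : open Av by exact: (@open_avoid _ _ _ _ _ _ _ rc (predC1 j)).
have Avp : Av p0.
  move=> k kj kp; have := csing_disjoint rc kj; move/seteqP => [/(_ p0)].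
  by move=> /(_ (conj kp jp)).
have [r1 [d [D [K [r10 d0 HB]]]]] := metric_bounds GM Ac cx0.
have Avn : nbhs x0 (cinv c @^-1` Av).
  by apply: cinv_near => //; [exact: ci|rewrite (cinv_cmap Hc)].
have [r2 r20 r2U] := (nbhs_cubeP x0 _).1 (@filterI _ (nbhs x0) (nbhs_filter x0) _ _ (ci _ cx0) Avn).
pose r := Num.min r1 r2.
have r0 : 0 < r by rewrite lt_min r10.
pose Q := nearcube x0 r.
have Q1 x : Q x -> nearcube x0 r1 x.
  by move=> xr k; apply: lt_le_trans (xr k) _; rewrite ge_min lexx.
have Q2 x : Q x -> cimg c x /\ Av (cinv c x).
  by move=> xr; apply: r2U => k; apply: lt_le_trans (xr k) _; rewrite ge_min lexx orbT.
have Qreg x : Q x -> x 0 i != 0 -> cimg (core_chart c) x.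
  move=> Qx xi0; have [cx Ax] := Q2 x Qx; rewrite cimg_core_chart //.
  have [dx E] := cimg_cinv Hc cx.
  split; first exact: ci; split; last exact: minterior_cinv (ci _ cx).
  move=> k; have [->|kj] := eqVneq k j; last exact: Ax.
  by move=> /(Hs _ dx); rewrite E => xi; rewrite xi eqxx in xi0.
have oi : open (cimg (core_chart c)).
  by rewrite cimg_core_chart //; apply: open_cinv_preimage => //; exact: open_cpart.
have half (s : R) : s ^+ 2 = 1 ->
    good g mu (cinv (core_chart c) @` (Q `&` [set x | 0 < s * x 0 i])).
  move=> s2; have ns1 : `|s| = 1.
    by apply/eqP; rewrite -[_ == _](@eqrXn2 _ 2) ?normr_ge0 // real_normK ?num_real // s2 expr1n.
  (* [x0] moved by [r / 2] into the side [s * x 0 i < 0]; the cube of radius [r / 2] about [a] stays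
     on that side. *)
  pose a : 'rV[R]_m := \row_k (x0 0 k - (k == i)%:R * (s * (r / 2))).
  have ai : a 0 i = - (s * (r / 2)) by rewrite mxE eqxx mul1r x0i sub0r.
  have as0 k : `|a 0 k - x0 0 k| <= r / 2.
    rewrite mxE addrAC subrr add0r normrN; case: eqP => _.
      by rewrite mul1r normrM ns1 mul1r ger0_norm // divr_ge0 // ltW.
    by rewrite mul0r normr0 divr_ge0 // ltW.
  have Qa : Q a by move=> k; apply: le_lt_trans (as0 k) _; lra.
  apply: (@vanish_good R m M g mu Hg hmu (core_chart c) Q (fun x => s * x 0 i) a
    (r / 2) (2 * r) d D K).
  - exact: core_chart_atlas.
  - move=> x; apply: (@continuous_comp _ _ _ (fun y : 'rV[R]_m => y 0 i) ( *%R s)).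
      exact: coord_continuous.
    exact: mulrl_continuous.
  - exact: open_nearcube.
  - exact: convex_nearcube.
  - exact: Qa.
  - move=> x k Qx; rewrite (_ : x 0 k - a 0 k = (x 0 k - x0 0 k) - (a 0 k - x0 0 k)); last by ring.
    apply: le_trans (ler_normB _ _) _; have := as0 k; have := Qx k; lra.
  - move=> x Qx sx; have cx : cimg (core_chart c) x.
      by apply: Qreg => //; apply: contraTneq sx => ->; rewrite mulr0 ltxx.
    split; first exact: (open_nbhs_nbhs (conj oi cx)).
    rewrite core_chart_metric //; apply: HB; last exact: Q1.
    by have [] := Q2 x Qx.
  - exact: d0.
  - by lra.
  - move=> x Qx /(_ i); rewrite ai opprK => H.
    have : `|s * (x 0 i + s * (r / 2))| < r / 2 by rewrite normrM ns1 mul1r.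
    rewrite mulrDr mulrA -expr2 s2 mul1r ltr_norml => /andP[_]; lra.
  - move=> f tf x Qx sx0; have xi0 : x 0 i = 0.
      by have := congr1 ( *%R s) sx0; rewrite mulrA -expr2 s2 mul1r mulr0.
    have [cx Ax] := Q2 x Qx; have [dx E] := cimg_cinv Hc cx.
    have jx : csing (r := rc) j (cinv c x) by apply/Hs; rewrite // E.
    have H := @cinv_continuous _ _ _ _ Hc x (ci _ cx) _ (vanish_near_csing rho_C1 rho_gt0 tf jx).
    apply: (@filterS _ (nbhs x) (nbhs_filter x) _ _ _ H) => y /= Hy Qy sy.
    apply: Hy; have : cimg (core_chart c) y.
      by apply: Qreg => //; apply: contraTneq sy => ->; rewrite mulr0 ltxx.
    by rewrite cimg_core_chart // => -[_ []].
exists (cdom c `&` cmap c @^-1` Q); split.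
- by apply: open_cmap_preimage => //; exact: open_nearcube.
- by split=> // k; rewrite subrr normr0.
exists (cinv (core_chart c) @` (Q `&` [set x | 0 < 1 * x 0 i]) `|`
        cinv (core_chart c) @` (Q `&` [set x | 0 < -1 * x 0 i])).
  by apply: goodU; apply: half; rewrite ?sqrrN expr1n.
move=> _ [p [[dp Qp] crp] <-].
have pi : cmap c p 0 i != 0 by apply/eqP => /(Hs _ dp); exact: crp.
have E : cinv (core_chart c) (cmap c p) = cincl rc p by rewrite /= (cinv_cmap Hc).
have [pl|pg] := leP (cmap c p 0 i) 0; [right|left]; exists (cmap c p) => //; split=> //=.
  by rewrite mulN1r oppr_gt0 lt_neqAle pi.
by rewrite mul1r.
Qed.

Lemma regular_core_regular p : creg rc p -> regular g mu (cincl rc p) -> core_regular p.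
Proof.
move=> cp [ O [oO Op gO]].
have H : nbhs p (cincl rc @^-1` O).
  by apply: cincl_continuous => //; exact: open_nbhs_nbhs.
move: H; rewrite nbhsE => -[V [oV Vp] VO]; exists V; split=> //.
by exists O => // _ [q [Vq _] <-]; exact: VO.
Qed.

Lemma open_core_regular : open core_regular.
Proof.
rewrite openE => p [V [oV Vp HV]].
have : nbhs p V by exact: open_nbhs_nbhs.
by apply: filterS => q Vq; exists V.
Qed.

Lemma closed_core_regular : closed core_regular.
Proof.
move=> p clp; have [[j jp]|cp] := pselect (exists j, csing (r := rc) j p).
  exact: csing_core_regular jp.
have {}cp : creg rc p by move=> j jp; apply: cp; exists j.
apply: regular_core_regular => //; apply: closed_regular => // O nO.
have V1 : nbhs p (creg rc) by apply: open_nbhs_nbhs; split=> //; exact: open_creg.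
have V2 : nbhs p (cincl rc @^-1` O°).
  apply: cincl_continuous => //; apply: open_nbhs_nbhs; split; last exact: nO.
  exact: open_interior.
have [q [[V [oV Vq [S gS VS]]] [cq Oq]]] := clp _ (filterI V1 V2).
have V3 : nbhs q (V `&` (creg rc `&` cincl rc @^-1` O)).
  apply: filterI; first exact: open_nbhs_nbhs.
  apply: filterI; first by apply: open_nbhs_nbhs; split=> //; exact: open_creg.
  by apply: (cincl_continuous cq).
(* An interior point is needed because [cincl] sends open sets to open sets only inside [cpart]. *)
have [z [[Vz [cz Oz]] zi]] := minterior_dense V3.
exists (cincl rc z); split=> //.
exists (cincl rc @` (V `&` cpart (rc:=rc))).
have oW : open (cincl rc @` (V `&` cpart (rc:=rc))).
  by apply: cincl_open_image; [apply: openI => //; exact: open_cpart|exact: subIsetr].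
split=> //; first by exists z.
apply: good_sub gS; first exact: open_brl.
by move=> _ [y [Vy [cy _]] <-]; apply: VS; exists y.
Qed.

Lemma core_good : core_regular = setT -> exists2 S, good g mu S & cincl rc @` creg rc `<=` S.
Proof.
move=> H; have [_ cN _ _] := coreP rc.
pose P (A : set N) := exists2 S, good g mu S & cincl rc @` (A `&` creg rc) `<=` S.
have [|A B [S gS AS] [T gT BT]|p _|A [S gS AS] NA] := @compact_union_ind N setT P cN.
- by exists set0; [exact: good0|move=> _ [p [[] _]]].
- exists (S `|` T); first exact: goodU.
  by move=> _ [p [[Ap|Bp] cp] <-]; [left; apply: AS; exists p|right; apply: BT; exists p].
- have : core_regular p by rewrite H.
  by move=> [V [oV Vp HV]]; exists V.
exists S => // _ [p cp <-]; apply: AS; exists p => //; split=> //; exact: NA.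
Qed.

Lemma core_regular_singular : (0 < ns)%N -> core_regular = setT.
Proof.
move=> ns0; have [_ _ conN _] := coreP rc.
have [[p jp] _ _ _ _] := csingP rc (Ordinal ns0).
apply: conN.
- by exists p; exact: csing_core_regular jp.
- by exists core_regular; [exact: open_core_regular|rewrite setTI].
- by exists core_regular; [exact: closed_core_regular|rewrite setTI].
Qed.

(** With no hypersurface there is no starting point inside the core, so connectedness of [M] carries
    regularity from a wedge to it. *)
Lemma core_regular_connected : ns = 0%N -> connected [set: M] ->
  regular g mu !=set0 -> core_regular = setT.
Proof.
move=> ns0 conM r0; have rT : regular g mu = setT.
  apply: conM => //.
    by exists (regular g mu); [exact: open_regular|rewrite setTI].
  exists (regular g mu); last by rewrite setTI.
  by move=> p; exact: closed_regular.
apply/seteqP; split=> // p _; apply: regular_core_regular; last by rewrite rT.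
by move=> [j jn]; exfalso; move: jn; rewrite ns0.
Qed.

End CoreGood.

(** * Wedges *)

(* [compact_cover] requires pointed spaces. *)
HB.instance Definition _ (S T : ptopologicalType) := Topological.on (S * T)%type.

Section Blocks.
Context {R : realType}.

Lemma continuous_row_mx (T : topologicalType) m n (F : T -> 'rV[R]_m) (G : T -> 'rV[R]_n) t :
  {for t, continuous F} -> {for t, continuous G} ->
  {for t, continuous (fun s => row_mx (F s) (G s))}.
Proof.
move=> cF cG; apply: continuous_rV => i.
rewrite -(splitK i); case: (fintype.split i) => j /=.
  rewrite (_ : (fun s => row_mx (F s) (G s) 0 (lshift n j)) = fun s => F s 0 j); last first.
    by apply/funext => s; rewrite row_mxEl.
  by apply: (@continuous_comp _ _ _ F (fun v : 'rV[R]_m => v 0 j)) => //; exact: coord_continuous.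
rewrite (_ : (fun s => row_mx (F s) (G s) 0 (rshift m j)) = fun s => G s 0 j); last first.
  by apply/funext => s; rewrite row_mxEr.
by apply: (@continuous_comp _ _ _ G (fun v : 'rV[R]_n => v 0 j)) => //; exact: coord_continuous.
Qed.

Lemma continuous_lsubmx m n : continuous (fun v : 'rV[R]_(m + n) => lsubmx v).
Proof.
move=> v; apply: continuous_rV => i.
rewrite (_ : (fun v => lsubmx v 0 i) = fun v : 'rV[R]_(m + n) => v 0 (lshift n i)).
  exact: coord_continuous.
by apply/funext => w; rewrite mxE.
Qed.

Lemma continuous_rsubmx m n : continuous (fun v : 'rV[R]_(m + n) => rsubmx v).
Proof.
move=> v; apply: continuous_rV => i.
rewrite (_ : (fun v => rsubmx v 0 i) = fun v : 'rV[R]_(m + n) => v 0 (rshift m i)).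
  exact: coord_continuous.
by apply/funext => w; rewrite mxE.
Qed.

Lemma open_preimage (S T : topologicalType) (f : S -> T) (A : set T) :
  continuous f -> open A -> open (f @^-1` A).
Proof. by move=> cf oA; apply: open_comp => // x _; exact: cf. Qed.

Lemma boundaryless_cimg m (B : manifold R m) c : mboundary B = set0 -> atlas c ->
  open (cimg (c : chart R B m)).
Proof.
move=> B0 Ac; rewrite openE => x cx; have Hc := atlas_chart Ac.
have [dx E] := cimg_cinv Hc cx; rewrite -E; apply/(minteriorP Ac dx).
by apply: contrapT => nb; have : mboundary B (cinv c x) by []; rewrite B0.
Qed.

Section ThreeBlocks.
Variables b q : nat.
Notation V := 'rV[R]_(1 + (b + q)).

Definition block3 (A : set R) (S : set 'rV[R]_b) (T : set 'rV[R]_q) : set V :=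
  [set x | [/\ A (lsubmx x 0 0), S (lsubmx (rsubmx x)) & T (rsubmx (rsubmx x))]].

Lemma continuous_block1 : continuous (fun x : V => lsubmx x 0 0).
Proof.
move=> x; apply: (@continuous_comp _ _ _ (@lsubmx R 1 1 (b + q)) (fun v : 'rV[R]_1 => v 0 0)).
  exact: continuous_lsubmx.
exact: coord_continuous.
Qed.

Lemma continuous_block2 : continuous (fun x : V => lsubmx (rsubmx x)).
Proof.
move=> x; apply: (@continuous_comp _ _ _ (@rsubmx R 1 1 (b + q)) (@lsubmx R 1 b q)).
  exact: continuous_rsubmx.
exact: continuous_lsubmx.
Qed.

Lemma continuous_block3 : continuous (fun x : V => rsubmx (rsubmx x)).
Proof.
move=> x; apply: (@continuous_comp _ _ _ (@rsubmx R 1 1 (b + q)) (@rsubmx R 1 b q)).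
  exact: continuous_rsubmx.
exact: continuous_rsubmx.
Qed.

Lemma open_block3 A S T : open A -> open S -> open T -> open (block3 A S T).
Proof.
move=> oA oS oT.
rewrite (_ : block3 A S T = (fun x : V => lsubmx x 0 0) @^-1` A `&`
    ((fun x : V => lsubmx (rsubmx x)) @^-1` S `&` (fun x : V => rsubmx (rsubmx x)) @^-1` T)); last first.
  by apply/seteqP; split=> x; [move=> []|move=> [? []]].
apply: openI; first exact: (open_preimage continuous_block1 oA).
apply: openI; first exact: (open_preimage continuous_block2 oS).
exact: (open_preimage continuous_block3 oT).
Qed.

Lemma convex_block3 (u v : R) S T : convex_region S -> convex_region T ->
  convex_region (block3 [set t | u < t < v] S T).
Proof.
move=> cS cT x y s [/andP[x1 x2] xS xT] [/andP[y1 y2] yS yT] s01; have /andP[s0 s1] := s01.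
have E2 : lsubmx (rsubmx (x + s *: (y - x))) = lsubmx (rsubmx x) + s *: (lsubmx (rsubmx y) - lsubmx (rsubmx x)).
  by apply/rowP => i; rewrite !mxE.
have E3 : rsubmx (rsubmx (x + s *: (y - x))) = rsubmx (rsubmx x) + s *: (rsubmx (rsubmx y) - rsubmx (rsubmx x)).
  by apply/rowP => i; rewrite !mxE.
split; [|by rewrite E2; exact: cS|by rewrite E3; exact: cT].
rewrite /= !mxE.
have H1 := convex_gt0 s0 s1 (a := x 0 (lshift (b + q) 0) - u) (b := y 0 (lshift (b + q) 0) - u).
have H2 := convex_gt0 s0 s1 (a := v - x 0 (lshift (b + q) 0)) (b := v - y 0 (lshift (b + q) 0)).
move: x1 x2 y1 y2; rewrite !mxE => x1 x2 y1 y2.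
have {}H1 := H1 ltac:(lra) ltac:(lra); have {}H2 := H2 ltac:(lra) ltac:(lra).
by apply/andP; split; lra.
Qed.

End ThreeBlocks.

End Blocks.

(** * The wedge as a cylinder, with parametrisation [h] and time function [tau] *)

Section Wedge.
Context {R : realType}.
Variables (b q : nat) (B : manifold R b) (gB : gram B) (G : manifold R q) (gG : gram G).
Variables (M : manifold R (1 + (b + q))) (g : gram M) (rho tau : M -> R).
Variable h : R * B * G -> M.

Definition wslab : set (R * B * G) := [set a | 0 < a.1.1 <= 1].
Definition wopen : set (R * B * G) := [set a | 0 < a.1.1 < 1].

Hypotheses (KB : compact [set: B]) (KG : compact [set: G]).
Hypotheses (B0 : mboundary B = set0) (G0 : mboundary G = set0).
Hypotheses (HB : is_metric gB) (HG : is_metric gG) (Hg : is_metric g).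
Hypothesis hD : {within wslab, continuous h}.
Hypothesis hinj : forall a a', wslab a -> wslab a' -> h a = h a' -> a = a'.
Hypothesis ctau : {within h @` wslab, continuous tau}.
Hypothesis tauh : forall a, wslab a -> tau (h a) = a.1.1.
Hypothesis oh : open (h @` wopen).
Hypothesis hS : forall cB cG c, atlas cB -> atlas cG -> atlas c -> forall j,
  Ck_on None (dom3 h cB cG c) (fun x => coord3 h cB cG c x 0 j).
Hypothesis hM : forall cB cG c x, atlas cB -> atlas cG -> atlas c ->
  dom3 h cB cG c x -> lsubmx x 0 0 < 1 ->
  pullback (coord3 h cB cG c) (g c) x =
    block_mx 1%:M 0 0 (block_mx (gB cB (lsubmx (rsubmx x))) 0 0 (gG cG (rsubmx (rsubmx x)))).

Lemma wopen_slab : wopen `<=` wslab.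
Proof. by move=> a /andP[a0 a1]; rewrite /wslab /= a0 ltW. Qed.

Lemma continuous_time : continuous (fun a : R * B * G => a.1.1).
Proof.
move=> a; apply: (@continuous_comp _ _ _ (@fst (R * B) G) (@fst R B)); exact: cvg_fst.
Qed.

Lemma open_wopen : open wopen.
Proof.
have -> : wopen = (fun a => a.1.1) @^-1` [set t | 0 < t] `&` (fun a => a.1.1) @^-1` [set t | t < 1].
  by apply/seteqP; split=> a; [move=> /andP[]|move=> [H1 H2]; apply/andP].
apply: openI; apply: open_preimage; try exact: continuous_time.
  exact: (@open_gt R 0).
exact: (@open_lt R 1).
Qed.

Lemma wparam_continuous a : wopen a -> {for a, continuous h}.
Proof.
have := continuous_subspaceW wopen_slab hD.
rewrite continuous_open_subspace; last exact: open_wopen.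
by move=> H oa; apply: H; rewrite inE.
Qed.

(* The inverse of [h] is continuous because [h] maps the compact slabs
   [t0/2, 1] x B x G, minus any open set, to closed sets. *)
Lemma wparam_nbhs a (O : set (R * B * G)) : wopen a -> nbhs a O ->
  nbhs (h a) (h @` (O `&` wopen)).
Proof.
move=> oa Oa; have /andP[a0 a1] := oa.
pose K : set (R * B * G) := ([set` `[a.1.1 / 2, 1]] `*` setT) `*` setT.
have cK : compact (K `&` ~` O°).
  apply: compact_closedI; last exact/open_closedC/open_interior.
  by apply: compact_setX => //; apply: compact_setX => //; exact: segment_compact.
have KD : K `&` ~` O° `<=` wslab.
  move=> z [[[/= + _] _] _]; rewrite in_itv /= => /andP[z1 z2].
  by rewrite /wslab /= z2 andbT (lt_le_trans _ z1) // divr_gt0.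
have clK : closed (h @` (K `&` ~` O°)).
  apply: compact_closed; first exact: manifold_hausdorff.
  by apply: continuous_compact => //; exact: continuous_subspaceW hD.
have N1 : nbhs (h a) (h @` wopen) by apply: open_nbhs_nbhs; split=> //; exists a.
have N2 : nbhs (h a) (~` (h @` (K `&` ~` O°))).
  apply: open_nbhs_nbhs; split; first exact/closed_openC.
  move=> [z [Kz nz] E]; have E' := hinj (KD z (conj Kz nz)) (wopen_slab oa) E.
  by apply: nz; rewrite E'.
have N3 : nbhs (h a) [set p | a.1.1 / 2 < tau p].
  have ct : {within h @` wopen, continuous tau}.
    by apply: continuous_subspaceW ctau => _ [z oz <-]; exists z => //; exact: wopen_slab.
  move: ct; rewrite continuous_open_subspace // => /(_ (h a)).
  rewrite inE => /(_ (ex_intro2 _ _ a oa erefl)).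
  have : nbhs (tau (h a)) [set t | a.1.1 / 2 < t].
    by apply: open_nbhs_nbhs; split; [exact: (@open_gt R _)|rewrite /= tauh; [rewrite ltr_pdivrMr // ltr_pMr // ltr1n|exact: wopen_slab]].
  by move=> H ct; exact: ct H.
apply: filterS (filterI N1 (filterI N2 N3)) => _ [[z oz <-] [nz /=]].
rewrite (tauh (wopen_slab oz)) => tz; exists z => //; split=> //.
apply: contrapT => nO; apply: nz; exists z => //; have /andP[_ z1] := oz.
split; first by split=> //; split=> //=; rewrite in_itv /= !ltW.
by move=> /interior_subset.
Qed.

Lemma wparam_open (O : set (R * B * G)) : open O -> O `<=` wopen -> open (h @` O).
Proof.
move=> oO Oo; rewrite openE => _ [a Oa <-].
have := wparam_nbhs (Oo _ Oa) (open_nbhs_nbhs (conj oO Oa)).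
by apply: filterS => _ [z [Oz _] <-]; exists z.
Qed.

(** The default triple is returned only off the image of the slab. *)
Definition wparam_inv (p : M) : R * B * G :=
  xget (0, point, point) [set a | wslab a /\ h a = p].

Lemma wparam_invK a : wslab a -> wparam_inv (h a) = a.
Proof.
move=> Da; have [|D' E] := @xgetPex _ (0, point, point) [set z | wslab z /\ h z = h a].
  by exists a.
exact: hinj E.
Qed.

Lemma wparam_inv_continuous a : wopen a -> {for h a, continuous wparam_inv}.
Proof.
move=> oa O; rewrite (wparam_invK (wopen_slab oa)) => Oa.
apply: filterS (wparam_nbhs oa Oa) => _ [z [Oz oz] <-] /=.
by rewrite (wparam_invK (wopen_slab oz)).
Qed.

Section WedgeChart.
Variables (cB : chart R B b) (cG : chart R G q).
Hypotheses (AB : atlas cB) (AG : atlas cG).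

Definition wpoint (x : 'rV[R]_(1 + (b + q))) : R * B * G :=
  (lsubmx x 0 0, cinv cB (lsubmx (rsubmx x)), cinv cG (rsubmx (rsubmx x))).

Definition wcoord (a : R * B * G) : 'rV[R]_(1 + (b + q)) :=
  row_mx (a.1.1%:M : 'rV[R]_1) (row_mx (cmap cB a.1.2) (cmap cG a.2)).

Definition wdom : set (R * B * G) := wopen `&` [set a | cdom cB a.1.2 /\ cdom cG a.2].

Definition wimg : set 'rV[R]_(1 + (b + q)) := [set x | [/\ 0 < lsubmx x 0 0 < 1,
  cimg cB (lsubmx (rsubmx x)) & cimg cG (rsubmx (rsubmx x))]].

Definition wedge_chart : chart R M (1 + (b + q)) :=
  Chart (h @` wdom) (wcoord \o wparam_inv) (h \o wpoint).

Lemma wpointK x : wimg x -> wcoord (wpoint x) = x.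
Proof.
move=> [_ xB xG]; rewrite /wcoord /=.
have [_ ->] := cimg_cinv (atlas_chart AB) xB; have [_ ->] := cimg_cinv (atlas_chart AG) xG.
by rewrite hsubmxK -mx11_scalar hsubmxK.
Qed.

Lemma wcoordK a : wdom a -> wpoint (wcoord a) = a.
Proof.
case: a => [[t y] z] [_ [/= yB zG]]; rewrite /wpoint /wcoord /= row_mxKl !row_mxKr row_mxKl.
by rewrite mxE mulr1n (cinv_cmap (atlas_chart AB)) // (cinv_cmap (atlas_chart AG)).
Qed.

Lemma wpoint_dom x : wimg x -> wdom (wpoint x).
Proof.
move=> [x0 xB xG]; have [? _] := cimg_cinv (atlas_chart AB) xB.
by have [? _] := cimg_cinv (atlas_chart AG) xG.
Qed.

Lemma wcoord_img a : wdom a -> wimg (wcoord a).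
Proof.
move=> [oa [aB aG]]; rewrite /wimg /wcoord /= row_mxKl !row_mxKr row_mxKl mxE mulr1n.
by split=> //; exact: cimg_cmap.
Qed.

Lemma cimg_wedge_chart : cimg wedge_chart = wimg.
Proof.
apply/seteqP; split=> x.
  move=> [_ [a [oa da] <-] <-] /=; rewrite (wparam_invK (wopen_slab oa)).
  exact: wcoord_img.
move=> wx; exists (h (wpoint x)); first by exists (wpoint x) => //; exact: wpoint_dom.
by rewrite /= wparam_invK ?wpointK //; apply: wopen_slab; have [] := wpoint_dom wx.
Qed.

Lemma open_wdom : open wdom.
Proof.
apply: openI; first exact: open_wopen.
apply: (@openI _ [set a | cdom cB a.1.2] [set a | cdom cG a.2]).
  apply: (@open_preimage _ _ (fun a : R * B * G => a.1.2)); last exact: open_cdom.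
  move=> a; apply: (@continuous_comp _ _ _ (@fst (R * B) G) (@snd R B)); [exact: cvg_fst|exact: cvg_snd].
apply: (@open_preimage _ _ (fun a : R * B * G => a.2)); last exact: open_cdom.
by move=> a; exact: cvg_snd.
Qed.

Lemma open_wimg : open wimg.
Proof.
apply: (@open_block3 _ _ _ [set t : R | 0 < t < 1]); try exact: boundaryless_cimg.
have -> : [set t : R | 0 < t < 1] = [set t | 0 < t] `&` [set t | t < 1].
  by apply/seteqP; split=> t; [move=> /andP[]|move=> [H1 H2]; apply/andP].
by apply: openI; [exact: (@open_gt R 0)|exact: (@open_lt R 1)].
Qed.

Lemma wpoint_continuous x : wimg x -> {for x, continuous wpoint}.
Proof.
move=> [_ xB xG]; have iB := open_nbhs_nbhs (conj (boundaryless_cimg B0 AB) xB).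
have iG := open_nbhs_nbhs (conj (boundaryless_cimg G0 AG) xG).
have c1 : {for x, continuous (fun v : 'rV[R]_(1 + (b + q)) => lsubmx v 0 0)}.
  exact: continuous_block1.
have cr := @continuous_rsubmx R 1 (b + q) x.
have c2 : {for x, continuous (fun v : 'rV[R]_(1 + (b + q)) => cinv cB (lsubmx (rsubmx v)))}.
  apply: (@continuous_comp _ _ _ (@rsubmx R 1 1 (b + q)) (fun w => cinv cB (lsubmx w))) => //.
  apply: (@continuous_comp _ _ _ (@lsubmx R 1 b q) (cinv cB)); first exact: continuous_lsubmx.
  exact: (cinv_continuous (atlas_chart AB) iB).
have c3 : {for x, continuous (fun v : 'rV[R]_(1 + (b + q)) => cinv cG (rsubmx (rsubmx v)))}.
  apply: (@continuous_comp _ _ _ (@rsubmx R 1 1 (b + q)) (fun w => cinv cG (rsubmx w))) => //.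
  apply: (@continuous_comp _ _ _ (@rsubmx R 1 b q) (cinv cG)); first exact: continuous_rsubmx.
  exact: (cinv_continuous (atlas_chart AG) iG).
have F := nbhs_filter x.
exact: (cvg_pair (cvg_pair c1 c2) c3).
Qed.

Lemma wcoord_continuous a : wdom a -> {for a, continuous wcoord}.
Proof.
move=> [_ [aB aG]]; apply: continuous_row_mx.
  apply: continuous_rV => i.
  rewrite (_ : (fun s : R * B * G => (s.1.1%:M : 'rV[R]_1) 0 i) = fun s => s.1.1).
    exact: continuous_time.
  by apply/funext => s; rewrite ord1 mxE mulr1n.
apply: continuous_row_mx.
  apply: (@continuous_comp _ _ _ (fun s : R * B * G => s.1.2) (cmap cB)).
    by apply: (@continuous_comp _ _ _ (@fst (R * B) G) (@snd R B)); [exact: cvg_fst|exact: cvg_snd].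
  exact: (cmap_continuous (atlas_chart AB)).
apply: (@continuous_comp _ _ _ (fun s : R * B * G => s.2) (cmap cG)); first exact: cvg_snd.
exact: (cmap_continuous (atlas_chart AG)).
Qed.

Lemma is_chart_wedge : is_chart wedge_chart.
Proof.
have od : open (cdom wedge_chart) by apply: wparam_open; [exact: open_wdom|exact: subIsetl].
split=> //.
- by move=> _ [a da <-] /=; rewrite (wparam_invK (wopen_slab (proj1 da))) wcoordK.
- rewrite continuous_open_subspace // => _ /set_mem [a da <-].
  apply: continuous_comp; first exact: (wparam_inv_continuous (proj1 da)).
  by rewrite (wparam_invK (wopen_slab (proj1 da))); exact: wcoord_continuous.
- rewrite cimg_wedge_chart continuous_open_subspace; last exact: open_wimg.
  move=> x /set_mem wx; apply: continuous_comp; first exact: wpoint_continuous.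
  by apply: wparam_continuous; have [] := wpoint_dom wx.
- by exists wimg; [exact: open_wimg|left; exact: cimg_wedge_chart].
Qed.

Section Transition.
Variable c : chart R M (1 + (b + q)).
Hypothesis Ac : atlas c.

Definition wover : set 'rV[R]_(1 + (b + q)) := wimg `&` [set x | cdom c (h (wpoint x))].

Lemma open_wover : open wover.
Proof.
rewrite openE => x [wx cx]; apply: (@filterI _ (nbhs x) (nbhs_filter x)).
  by apply: open_nbhs_nbhs; split=> //; exact: open_wimg.
have [ox _] := wpoint_dom wx.
have : nbhs (h (wpoint x)) (cdom c) by apply: open_nbhs_nbhs; split=> //; exact: open_cdom.
move=> /(wparam_continuous ox) H.
exact: (wpoint_continuous wx H).
Qed.

Lemma wover_dom3 : wover `<=` dom3 h cB cG c.
Proof. by move=> x [[/andP[x0 x1] xB xG] cx]; split=> //; rewrite x0 ltW. Qed.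

Lemma coord3_Ckn l j : Ckn l wover (fun x => coord3 h cB cG c x 0 j).
Proof.
apply: (@Ck_on_Ckn _ _ None) => //; first exact: open_wover.
exact: Ck_on_sub wover_dom3 (hS AB AG Ac j).
Qed.

Lemma coord3_differentiable x : wover x -> differentiable (coord3 h cB cG c) x.
Proof.
move=> wx; apply: differentiable_rV => j; apply: C1at_diff.
exact: (Ckn_C1at open_wover wx (coord3_Ckn 1 j)).
Qed.

(** The pulled-back metric is a product of positive definite blocks, and its determinant has that of
    the Jacobian as a factor. *)
Lemma coord3_jacobian_unit x : wover x -> 'J (coord3 h cB cG c) x \in unitmx.
Proof.
move=> wx; have [[/andP[_ x1] xB xG] _] := wx.
have E := hM AB AG Ac (wover_dom3 wx) x1.
have : \det (pullback (coord3 h cB cG c) (g c) x) != 0.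
  rewrite E det_ublock det1 mul1r det_ublock.
  by rewrite mulf_neq0 // lt0r_neq0 //; apply: posdef_det_gt0; exact: metric_posdef.
by rewrite /pullback !det_mulmx unitmxE unitfE; apply: contraNneq => ->; rewrite !mul0r.
Qed.

Lemma wedge_interior a : wdom a -> cdom c (h a) -> (cimg c)° (cmap c (h a)).
Proof.
move=> da ca; have wa : wover (wcoord a).
  by split; [exact: wcoord_img|rewrite /= wcoordK].
have -> : cmap c (h a) = coord3 h cB cG c (wcoord a).
  by rewrite /coord3 -/(wpoint (wcoord a)) wcoordK.
apply: (interior_image (atlas_chart Ac) open_wover wa _ (mulVmx (coord3_jacobian_unit wa))).
move=> y wy; split; first exact: coord3_differentiable.
by apply: cimg_cmap; have [] := wy.
Qed.

Lemma wedge_smooth_compat : smooth_compat wedge_chart c.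
Proof.
move=> j; apply: Ck_on_sub (hS AB AG Ac j) => _ [_ [[a da <-] ca] <-].
have oa : wopen a by have [] := da.
rewrite /= (wparam_invK (wopen_slab oa)); apply: wover_dom3.
by split; [exact: wcoord_img|rewrite /= wcoordK].
Qed.

(** The transition from [c] is the inverse of [coord3]: it is known to be continuous, and the
    invertible Jacobian upgrades it to a smooth map. *)
Lemma wedge_smooth_compat_sym : smooth_compat c wedge_chart.
Proof.
have Hc := atlas_chart Ac; set V := cmap c @` (cdom c `&` cdom wedge_chart).
have od : open (cdom wedge_chart) by apply: wparam_open; [exact: open_wdom|exact: subIsetl].
have VE : V = (cimg c)° `&` cinv c @^-1` cdom wedge_chart.
  apply/seteqP; split=> y.
    move=> [p [cp [a da E]] <-]; rewrite -{p}E in cp *.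
    split; first exact: wedge_interior.
    by rewrite /= (cinv_cmap Hc) //; exists a.
  move=> [yi dy]; have [cy E] := cimg_cinv Hc (interior_subset yi).
  by exists (cinv c y).
have oV : open V by rewrite VE; exact: open_cinv_preimage.
pose Psi y := wcoord (wparam_inv (cinv c y)).
have VH y : V y -> exists a, [/\ wdom a, cdom c (h a), cinv c y = h a, Psi y = wcoord a & cmap c (h a) = y].
  move=> [p [cp [a da E]] <-]; exists a; rewrite -{p}E in cp *.
  by rewrite /Psi (cinv_cmap Hc) // (wparam_invK (wopen_slab (proj1 da))).
move=> j; apply: (@Ckn_Ck_on _ _ V) => // l.
apply: (@inverse_smooth R _ _ wover V (coord3 h cB cG c) Psi
  (fun x => invmx ('J (coord3 h cB cG c) x)) open_wover oV).
- move=> y /VH[a [da ca _ -> _]]; split; first exact: wcoord_img.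
  by rewrite /= wcoordK.
- by move=> y /VH[a [da ca _ -> E]]; rewrite /coord3 -/(wpoint (wcoord a)) wcoordK.
- move=> y Vy; have [a [da ca E _ _]] := VH y Vy; have oa : wopen a by have [] := da.
  have yi : (cimg c)° y by move: Vy; rewrite VE => -[].
  apply: (@continuous_comp _ _ _ (cinv c) (wcoord \o wparam_inv)).
    exact: (cinv_continuous Hc yi).
  rewrite E; apply: continuous_comp; first exact: (wparam_inv_continuous oa).
  by rewrite (wparam_invK (wopen_slab oa)); exact: wcoord_continuous.
- by move=> x; exact: coord3_differentiable.
- by move=> x wx; apply: mulmxV; exact: coord3_jacobian_unit.
move=> k i j'; apply: Ckn_invmx; [exact: open_wover|exact: coord3_jacobian_unit|].
move=> i1 j1; apply: (@Ckn_eq _ _ _ _ (pd i1 (fun x => coord3 h cB cG c x 0 j1))).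
- exact: open_wover.
- by move=> x wx; rewrite jacobianE //; exact: coord3_differentiable.
by have [_ /(_ i1)[]] := coord3_Ckn k.+1 j1.
Qed.

End Transition.

Lemma wedge_chart_atlas : atlas wedge_chart.
Proof.
apply: atlas_maximal; first exact: is_chart_wedge.
by move=> c Ac; split; [exact: wedge_smooth_compat|exact: wedge_smooth_compat_sym].
Qed.

(** Once the wedge chart belongs to the atlas it may be used as the target chart, where [coord3] is
    the identity. *)
Lemma wedge_chart_metric x : wimg x -> g wedge_chart x =
  block_mx 1%:M 0 0 (block_mx (gB cB (lsubmx (rsubmx x))) 0 0 (gG cG (rsubmx (rsubmx x)))).
Proof.
move=> wx; have wo : wover wedge_chart x.
  by split=> //; exists (wpoint x) => //; exact: wpoint_dom.
have [/andP[_ x1] _ _] := wx.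
rewrite -(hM AB AG wedge_chart_atlas (wover_dom3 wo) x1) /pullback.
have FE : \forall y \near x, id y = coord3 h cB cG wedge_chart y.
  have : nbhs x wimg by apply: open_nbhs_nbhs; split=> //; exact: open_wimg.
  apply: (@filterS _ (nbhs x) (nbhs_filter x)) => y wy.
  rewrite /coord3 -/(wpoint y) /= wparam_invK ?wpointK //.
  by apply: wopen_slab; have [] := wpoint_dom wy.
have dI : differentiable (fun y : 'rV[R]_(1 + (b + q)) => y) x by [].
have [_ <-] := near_eq_jacobian FE dI.
by rewrite jacobian_id mul1mx trmx1 mulmx1 -(nbhs_singleton FE).
Qed.

End WedgeChart.

Variable mu : {measure set (borel M) -> \bar R}.
Hypothesis hmu : is_riemannian_measure g mu.
Hypothesis rho_C1 : Ck_fun (Some 1%N) setT rho.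
Hypothesis rho_gt0 : forall p, 0 < rho p.
Hypothesis hrho : forall c0, 0 < c0 -> exists2 r, 0 < r &
  forall a, wslab a -> a.1.1 < r -> rho (h a) < c0.

Lemma boundaryless_box k (N : manifold R k) (gN : gram N) (p : N) : mboundary N = set0 ->
  is_metric gN -> exists r d D K : R, [/\ 0 < r, 0 < d &
    forall x, nearcube (cmap (chart_at p) p) r x -> cimg (chart_at p) x /\
     d <= Num.sqrt (\det (gN (chart_at p) x)) <= D /\ \tr (gN (chart_at p) x) <= K].
Proof.
move=> N0 HN; have Ac : atlas (chart_at p) := atlas_chart_at p.
have cx : cimg (chart_at p) (cmap (chart_at p) p) by apply: cimg_cmap; exact: dom_chart_at.
have oc := boundaryless_cimg N0 Ac.
have [r1 [d [D [K [r10 d0 H]]]]] := metric_bounds HN Ac cx.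
have [r2 r20 r2U] := (nbhs_cubeP _ _).1 (open_nbhs_nbhs (conj oc cx)).
exists (Num.min r1 r2), d, D, K; split=> //; first by rewrite lt_min r10.
move=> x xr; have cix : cimg (chart_at p) x.
  by apply: r2U => i; apply: lt_le_trans (xr i) _; rewrite ge_min lexx orbT.
split=> //; apply: H => // i; apply: lt_le_trans (xr i) _; rewrite ge_min lexx //.
Qed.

(** [O] restricts base and fibre only: in product coordinates the metric does not depend on time, so
    a full column [0 < t < 1] is handled at once. *)
Lemma wedge_local_good (y0 : B) (z0 : G) : exists O : set (B * G),
  [/\ open O, O (y0, z0) & good g mu (h @` (wopen `&` [set a | O (a.1.2, a.2)]))].
Proof.
set cB := chart_at y0; set cG := chart_at z0.
have AB : atlas cB := atlas_chart_at y0; have AG : atlas cG := atlas_chart_at z0.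
have HcB := atlas_chart AB; have HcG := atlas_chart AG.
have yB : cdom cB y0 := dom_chart_at y0; have zG : cdom cG z0 := dom_chart_at z0.
have [rB [dB [DB [kB [rB0 dB0 bB]]]]] := boundaryless_box y0 B0 HB.
have [rG [dG [DG [kG [rG0 dG0 bG]]]]] := boundaryless_box z0 G0 HG.
rewrite -/cB -/cG in bB bG; set xB := cmap cB y0 in bB; set xG := cmap cG z0 in bG.
(* Time is continued to negative values, beyond the tip of the cusp; the half with positive time is
   the wedge. *)
pose Q := block3 [set t : R | -1 < t < 1] (nearcube xB rB) (nearcube xG rG).
pose L (x : 'rV[R]_(1 + (b + q))) := lsubmx x 0 0.
pose O : set (B * G) := [set w | (cdom cB `&` cmap cB @^-1` nearcube xB rB) w.1 /\
  (cdom cG `&` cmap cG @^-1` nearcube xG rG) w.2].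
have oB := open_cmap_preimage HcB (@open_nearcube _ _ xB rB).
have oG := open_cmap_preimage HcG (@open_nearcube _ _ xG rG).
exists O; split.
- exact: (openI (open_preimage (fun w => @cvg_fst _ _ _ _ _) oB) (open_preimage (fun w => @cvg_snd _ _ _ _ _) oG)).
- by split; split=> // i; rewrite subrr normr0.
have QE : h @` (wopen `&` [set a | O (a.1.2, a.2)]) =
    cinv (wedge_chart cB cG) @` (Q `&` [set x | 0 < L x]).
  apply/seteqP; split=> p.
    move=> [a [oa [/= [aB nB] [aG nG]]] <-]; have da : wdom cB cG a by split.
    exists (wcoord cB cG a); last by rewrite /= wcoordK.
    have /andP[a0 a1] := oa.
    rewrite /Q /block3 /L /wcoord /= row_mxKl !row_mxKr row_mxKl mxE mulr1n.
    by split=> //; split=> //; rewrite a1 andbT (lt_trans _ a0) // oppr_lt0.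
  move=> [x [[/andP[_ x1] nB nG] x0] <-]; exists (wpoint cB cG x) => //.
  have [cB' _] := bB _ nB; have [cG' _] := bG _ nG.
  have [dB' EB] := cimg_cinv HcB cB'; have [dG' EG] := cimg_cinv HcG cG'.
  by split; [apply/andP|split; split=> //=; rewrite ?EB ?EG].
have Qw x : Q x -> 0 < L x -> wimg cB cG x.
  move=> [/andP[_ x1] nB nG] x0; split; first exact/andP.
    by have [] := bB _ nB.
  by have [] := bG _ nG.
(* Centred at time -1/2, so that the cube of radius 1/2 about it has negative time only. *)
pose a : 'rV[R]_(1 + (b + q)) := row_mx (- (1 / 2))%:M (row_mx xB xG).
have L1 : lsubmx a 0 0 = - (1 / 2) by rewrite /a row_mxKl mxE mulr1n.
have L2 : lsubmx (rsubmx a) = xB by rewrite /a row_mxKr row_mxKl.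
have L3 : rsubmx (rsubmx a) = xG by rewrite /a !row_mxKr.
rewrite QE; apply: (@vanish_good R _ M g mu Hg hmu (wedge_chart cB cG) Q L a
    (1 / 2) (2 + (rB + rG)) (dB * dG) (DB * DG) (1 + (kB + kG))).
- exact: wedge_chart_atlas.
- exact: continuous_block1.
- apply: open_block3; [|exact: open_nearcube|exact: open_nearcube].
  have -> : [set t : R | -1 < t < 1] = [set t | -1 < t] `&` [set t | t < 1].
    by apply/seteqP; split=> t; [move=> /andP[]|move=> [H1 H2]; apply/andP].
  by apply: openI; [exact: (@open_gt R (-1))|exact: (@open_lt R 1)].
- by apply: convex_block3; exact: convex_nearcube.
- rewrite /Q /block3 /= L1 L2 L3; split; first by apply/andP; split; lra.
    by move=> i; rewrite subrr normr0.
  by move=> i; rewrite subrr normr0.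
- move=> x i [/andP[x1 x2] nB nG].
  have xa0 : `|lsubmx x 0 0 - lsubmx a 0 0| <= 2 by rewrite L1 ler_norml; apply/andP; split; lra.
  have xaB k : `|lsubmx (rsubmx x) 0 k - lsubmx (rsubmx a) 0 k| < rB by rewrite L2.
  have xaG k : `|rsubmx (rsubmx x) 0 k - rsubmx (rsubmx a) 0 k| < rG by rewrite L3.
  rewrite -(splitK i); case: (fintype.split i) => j /=.
    by move: xa0; rewrite !mxE ord1; lra.
  rewrite -(splitK j); case: (fintype.split j) => k /=.
    by have := xaB k; rewrite !mxE; lra.
  by have := xaG k; rewrite !mxE; lra.
- move=> x Qx Lx; have wx := Qw x Qx Lx; have [_ nB nG] := Qx; split.
    rewrite cimg_wedge_chart //; apply: open_nbhs_nbhs; split=> //; exact: open_wimg.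
  have [cB' [/andP[B1 B2] B3]] := bB _ nB; have [cG' [/andP[G1 G2] G3]] := bG _ nG.
  have dtB : 0 <= \det (gB cB (lsubmx (rsubmx x))).
    by apply: ltW; apply: posdef_det_gt0; exact: metric_posdef.
  rewrite wedge_chart_metric // det_ublock det1 mul1r det_ublock sqrtrM //.
  rewrite !mxtrace_block mxtrace1; split; last by rewrite lerD // lerD.
  by apply/andP; split; apply: ler_pM => //; rewrite ?sqrtr_ge0 // ltW.
- exact: mulr_gt0.
- by lra.
- move=> x Qx /(_ (lshift (b + q) 0)).
  have -> : x 0 (lshift (b + q) 0) = L x by rewrite /L mxE.
  have -> : a 0 (lshift (b + q) 0) = lsubmx a 0 0 by rewrite [RHS]mxE.
  by rewrite L1 ltr_norml => /andP[_]; lra.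
move=> f tf x Qx Lx; have [c0 c00 Hc0] := real_test_rho_bound rho_C1 rho_gt0 tf.
have [r r0 Hr] := hrho c00.
have : nbhs x (L @^-1` [set t | t < r]).
  apply: open_nbhs_nbhs; split; last by rewrite /= Lx.
  exact: (open_preimage (@continuous_block1 _ _ _) (@open_lt R r)).
apply: (@filterS _ (nbhs x) (nbhs_filter x)) => y Ly Qy y0'.
apply: Hc0; apply: Hr => //; apply: wopen_slab.
by have [] := wpoint_dom AB AG (Qw y Qy y0').
Qed.

(** Compactness of base and fibre is enough, because each local piece already reaches down to the
    tip of the cusp. *)
Lemma wopen_good : good g mu (h @` wopen).
Proof.
pose P (A : set (B * G)) := exists2 A' : set (B * G), A `<=` A' &
  good g mu (h @` (wopen `&` [set a | A' (a.1.2, a.2)])).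
have KBG : compact ([set: B] `*` [set: G]) by exact: compact_setX.
have [|A1 A2 [A3 A13 g3] [A4 A24 g4]|[y z] _|A [A' AA' gA] KA] :=
    @compact_union_ind ((car B * car G)%type : ptopologicalType) _ P KBG.
- exists set0 => //; rewrite (_ : _ @` _ = set0); first exact: good0.
  by apply/seteqP; split=> // p [a [_ []]].
- exists (A3 `|` A4); first by move=> w [/A13|/A24]; [left|right].
  rewrite (_ : _ @` _ = h @` (wopen `&` [set a | A3 (a.1.2, a.2)]) `|`
    h @` (wopen `&` [set a | A4 (a.1.2, a.2)])); first exact: goodU.
  apply/seteqP; split=> p.
    by move=> [a [oa [H|H]] <-]; [left|right]; exists a.
  by move=> [[a [oa H] <-]|[a [oa H] <-]]; exists a => //; split=> //; [left|right].
- have [ O [oO Op gO]] := wedge_local_good y z.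
  by exists O; split=> //; exists O.
rewrite (_ : h @` wopen = h @` (wopen `&` [set a | A' (a.1.2, a.2)])) //.
apply/seteqP; split=> p; last by move=> [a [oa _] <-]; exists a.
by move=> [a oa <-]; exists a => //; split=> //; apply: AA'; exact: KA.
Qed.

Lemma wopen_regular a : wopen a -> regular g mu (h a).
Proof.
by move=> oa; exists (h @` wopen); split; [exact: oh|exists a|exact: wopen_good].
Qed.

(* The outer face [t = 1] lies in the closure of the open part of the wedge. *)
Lemma wslab_good : exists2 S, good g mu S & h @` wslab `<=` S.
Proof.
pose K : set (R * B * G) := ([set` `[1, 1]] `*` setT) `*` setT.
have KD : K `<=` wslab.
  move=> a [[/= + _] _]; rewrite in_itv /= => /andP[a1 a2].
  by rewrite /wslab /= a2 andbT (lt_le_trans ltr01).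
have cK : compact K by apply: compact_setX => //; apply: compact_setX => //; exact: segment_compact.
have chK : compact (h @` K).
  by apply: continuous_compact => //; exact: continuous_subspaceW hD.
have Kreg a : K a -> regular g mu (h a).
  move=> Ka; apply: closed_regular => // A nA.
  have Da := KD a Ka.
  have H : nbhs a [set s | wslab s -> A (h s)].
    by apply: ((subspace_continuousP _ h).1 hD a Da); exact: nA.
  (* Approaches the outer face by lowering time, with base and fibre points fixed. *)
  pose l (t : R) : R * B * G := (t, a.1.2, a.2).
  have cl : {for (a.1.1 : R), continuous l}.
    have F := nbhs_filter (a.1.1 : R).
    exact: (cvg_pair (cvg_pair cvg_id (cvg_cst _)) (cvg_cst _)).
  have la : l a.1.1 = a by rewrite /l -!surjective_pairing.
  have : nbhs (a.1.1 : R) (l @^-1` [set s | wslab s -> A (h s)]) by apply: cl; rewrite la.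
  move=> /nbhs_ballP[e /= e0 eH]; have /andP[a0 a1] := Da.
  (* The first bound keeps the time positive, the second keeps it within [e] of [a.1.1]; both are
     below [a.1.1]. *)
  pose t := Num.max (a.1.1 / 2) (a.1.1 - e / 2).
  have t0 : 0 < t by rewrite lt_max divr_gt0.
  have ta : t < a.1.1 by rewrite gt_max ltr_pdivrMr // ltr_pMr // ltr1n //= ltrBlDr ltrDl divr_gt0.
  have te : ball (a.1.1 : R) e t.
    rewrite -ball_normE /= gtr0_norm ?subr_gt0 // ltrBlDr -ltrBlDl.
    by rewrite /t lt_max; apply/orP; right; rewrite ltrD2l ltrN2 ltr_pdivrMr // ltr_pMr // ltr1n.
  have lo : wopen (l t) by rewrite /wopen /l /= t0 (lt_le_trans ta).
  by exists (h (l t)); split; [exact: wopen_regular|apply: eH => //; exact: wopen_slab].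
have [|A1 A2|p [a Ka <-]|S gS KS] := @compact_union_ind M _ (good g mu) chK.
- exact: good0.
- exact: goodU.
- by have [ O [oO Oa gO]] := Kreg a Ka; exists O.
exists (h @` wopen `|` S); first by apply: goodU => //; exact: wopen_good.
move=> _ [a /andP[a0 a1] <-]; have [a1'|a1'] := ltP a.1.1 1.
  by left; exists a => //; apply/andP.
by right; apply: KS; exists a => //; split=> //; split=> //=; rewrite in_itv /= a1 a1'.
Qed.

End Wedge.

Section WedgeEnd.
Context {R : realType}.

Lemma wedge_good (m : nat) (M : manifold R m) (g : gram M) (rho : M -> R)
    (mu : {measure set (borel M) -> \bar R}) (w : wedge_end g rho) :
  is_metric g -> is_riemannian_measure g mu -> Ck_fun (Some 1%N) setT rho ->
  (forall p, 0 < rho p) ->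
  regular g mu !=set0 /\ exists2 S, good g mu S & wset w `<=` S.
Proof.
move=> Hg hmu rho_C1 rho_gt0.
(* The dimension equals [1 + (b + q)] only propositionally; opening the record allows [m] to be
   replaced, so that block coordinates typecheck. *)
case: w => /= W X b d q B gB e G gG wm wi HX HB HG Em; subst m.
move=> bij smo; set h := (fun a : R * B * G => wi (cusp_param X e a.1.1 a.1.2, a.2)).
move=> smoh oh hM hrho.
have [KB B0 HgB [e_inj _ _]] := HB; have [KG _ G0 HgG] := HG.
have [[_ X0] _ Xlim _ _] := HX.
have [b1 b2 b3 b4] := bij.
have cP a : wslab a -> cusp X e (cusp_param X e a.1.1 a.1.2).
  by move=> a01; exists a.1.1, a.1.2.
have wmh a : wslab a -> wm (h a) = (cusp_param X e a.1.1 a.1.2, a.2).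
  by move=> Da; apply: b4; exact: cP.
have hinj a a' : wslab a -> wslab a' -> h a = h a' -> a = a'.
  move=> Da Da' E; have := wmh a Da; rewrite E wmh // => -[/eq_row_mx[E1 E2] E3].
  have Et : a'.1.1 = a.1.1.
    by have := congr1 (fun A : 'rV[R]_1 => A 0 0) E1; rewrite !mxE !mulr1n.
  have Ey : a'.1.2 = a.1.2.
    (* At equal times the positive value of the profile cancels, and the embedding of the base is
       injective. *)
    apply: e_inj; move: E2; rewrite Et; apply: scalerI.
    by rewrite lt0r_neq0 // X0.
  by rewrite [a]surjective_pairing [a']surjective_pairing [a.1]surjective_pairing
             [a'.1]surjective_pairing Et Ey E3.
(* Time is the first ambient coordinate of P(R,B), hence continuous on the wedge. *)
pose tau (p : M) : R := (wm p).1 0 (lshift d 0).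
have ctau : {within h @` (@wslab R b q B G), continuous tau}.
  apply: (@continuous_subspaceW _ _ _ W).
    by move=> _ [a Da <-]; apply: b2; exact: cP.
  by apply: (Ck_fun_continuous (k := None)); exact: (proj1 smo).
have tauh a : wslab a -> tau (h a) = a.1.1.
  by move=> Da; rewrite /tau wmh //= row_mxEl mxE mulr1n.
have hr c0 : 0 < c0 -> exists2 r, 0 < r & forall a, wslab a -> a.1.1 < r -> rho (h a) < c0.
  move=> c00; have [r [/andP[r0 r1] H _]] := hrho.
  have : \forall t \near 0^'+, X t < c0.
    by have /cvgrPdist_lt /(_ c0 c00) := Xlim; apply: filterS => t; rewrite sub0r normrN; apply: le_lt_trans; exact: ler_norm.
  rewrite /= near_withinE => /nbhs_ballP[r' /= r'0 H'].
  exists (Num.min r r'); first by rewrite lt_min r0.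
  move=> a Da; rewrite lt_min => /andP[ar ar']; have /andP[a0 a1] := Da.
  have -> : rho (h a) = X a.1.1.
    rewrite -(H a.1.1 a.1.2 a.2); last by rewrite a0 ltW.
    by [].
  by apply: H' => //; rewrite -ball_normE /= sub0r normrN gtr0_norm.
have [S gS WS] := wslab_good KB KG B0 G0 HgB HgG Hg (proj1 smoh) hinj ctau tauh oh (proj2 smoh) hM hmu rho_C1 rho_gt0 hr.
split.
  exists (h (1 / 2, point, point)).
  apply: (wopen_regular KB KG B0 G0 HgB HgG Hg (proj1 smoh) hinj ctau tauh oh (proj2 smoh) hM hmu rho_C1 rho_gt0 hr).
  by apply/andP; split=> /=; lra.
exists S => // p Wp; apply: WS; have [t [y [t01 E]]] := b1 p Wp.
exists (t, y, (wm p).2) => //.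
by rewrite /h /= -E -surjective_pairing b3.
Qed.

End WedgeEnd.

(** * Passage to the limit *)

Section Lnorm2.
Context {R : realType} (d : measure_display) (T : measurableType d).
Variable mu : {measure set T -> \bar R}.

Lemma Lnorm2E (f : T -> R) : (forall x, 0 <= f x) ->
  Lnorm mu 2%:E (EFin \o f) = ((\int[mu]_x ((f x) ^+ 2)%:E) `^ 2^-1)%E.
Proof.
move=> f0; rewrite unlock; congr (_ `^ _)%E; apply: eq_integral => x _ /=.
by rewrite ger0_norm // -powR_mulrn.
Qed.

Lemma Lnorm2_le (f h : T -> R) (C : R) : (forall x, 0 <= f x) -> (forall x, 0 <= h x) ->
  0 <= C -> (\int[mu]_x ((f x) ^+ 2)%:E <= C%:E * \int[mu]_x ((h x) ^+ 2)%:E)%E ->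
  (Lnorm mu 2%:E (EFin \o f) <= (Num.sqrt C)%:E * Lnorm mu 2%:E (EFin \o h))%E.
Proof.
move=> f0 h0 C0 H; rewrite !Lnorm2E //.
have int_ge0 (k : T -> R) : (0 <= \int[mu]_x ((k x) ^+ 2)%:E)%E.
  by apply: integral_ge0 => x _; rewrite lee_fin sqr_ge0.
have -> : ((Num.sqrt C)%:E = C%:E `^ 2^-1)%E by rewrite poweR_EFin powR12_sqrt.
rewrite -poweRM //; apply: gt0_ler_poweR => //; rewrite in_itv /= leey andbT //.
by rewrite mule_ge0.
Qed.

Lemma Lnorm2_mono (f h : T -> R) : (forall x, 0 <= f x) -> (forall x, f x <= h x) ->
  (Lnorm mu 2%:E (EFin \o f) <= Lnorm mu 2%:E (EFin \o h))%E.
Proof.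
move=> f0 fh; have h0 x : 0 <= h x := le_trans (f0 x) (fh x).
have := @Lnorm2_le f h 1 f0 h0 ler01; rewrite sqrtr1 !mul1e; apply.
by apply: ge0_le_integral_sup => x _; rewrite lee_fin ?sqr_ge0 // lerXn2r ?nnegrE.
Qed.

End Lnorm2.

(** * The inequality for test functions *)

Section Poincare.
Context {R : realType}.

Lemma cabs_ge0 (z : R[i]) : 0 <= cabs z.
Proof. exact: sqrtr_ge0. Qed.

Lemma cabs_triangle (z w : R[i]) : cabs z <= cabs (z - w) + cabs w.
Proof.
have := ler_normD (z - w) w; rewrite subrK !normc_def -rmorphD lecR.
by [].
Qed.

Variables (m : nat) (M : manifold R m) (g : gram M) (rho : M -> R).
Variables (ns : nat) (beta : 'I_ns -> R) (mu : {measure set (borel M) -> \bar R}).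
Hypothesis hM : compact_singular_manifold (Some 1%N) g rho beta.
Hypothesis hmu : is_riemannian_measure g mu.

Lemma good_setT : good g mu setT.
Proof.
have [Hg rho_gt0 rho_C1 _] := csm_singular hM.
have W i := wedge_good (csm_wedge (c := hM) i) Hg hmu rho_C1 rho_gt0.
have [S gS WS] : exists2 S, good g mu S & forall i, wset (csm_wedge (c := hM) i) `<=` S.
  suff [S gS WS] : exists2 S, good g mu S &
      forall i, i \in enum 'I_(csm_nwedges hM) -> wset (csm_wedge (c := hM) i) `<=` S.
    by exists S => // i; apply: WS; rewrite mem_enum.
  elim: (enum _) => [|i s [S gS IH]]; first by exists set0 => //; exact: good0.
  have [_ [S' gS' WS']] := W i; exists (S' `|` S); first exact: goodU.
  move=> k; rewrite inE => /orP[/eqP->|/IH H] p Wp; first by left; exact: WS'.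
  by right; exact: H.
have CR : core_regular (rc := csm_core hM) mu = setT.
  (* A removed hypersurface starts the propagation inside the core; if there is none, a wedge does,
     and [M] is then connected. *)
  have [ns0|ns0] := posnP ns; last exact: core_regular_singular.
  have [|[n0 conM]] := csm_ends hM; first by move=> H; exfalso; move: H; rewrite ns0.
  have [r0 _] := W (Ordinal n0).
  exact: core_regular_connected.
have [S' gS' CS'] := core_good CR.
apply: good_sub (goodU gS' gS) => [|p _]; first exact: measurableT.
by have [/CS'|[i Wp]] := csm_cover hM p; [left|right; exact: (WS i)].
Qed.

Lemma real_test_part (phi : M -> R[i]) : test_function phi ->
  real_test (Re_part phi) /\ real_test (Im_part phi).
Proof.
move=> [HR HI cphi].
have sub (f : R[i] -> R) : f 0 = 0 -> compact (closure [set p | f (phi p) != 0]).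
  move=> f0; apply: subclosed_compact cphi _; first exact: closed_closure.
  by apply: closureS => p /=; apply: contraNneq => ->; rewrite f0.
by split; split=> //; [exact: (sub (@complex.Re R))|exact: (sub (@complex.Im R))].
Qed.

Lemma test_poincare : exists2 C : R, 0 < C & forall phi : M -> R[i], test_function phi ->
  (L2norm mu phi <= C%:E *
     L2norm_vfield g mu (grad g (Re_part phi)) (grad g (Im_part phi)))%E.
Proof.
have [Hg _ _ _] := csm_singular hM.
have [_ [C C0 HC]] := good_setT.
(* The added 1 makes the constant positive. Squared norms of real and imaginary parts add up on both
   sides, so one [C] serves for both. *)
exists (Num.sqrt (C + 1)) => [|phi tphi]; first by rewrite sqrtr_gt0 ltr_wpDl.
have [tR tI] := real_test_part tphi.
apply: (@Lnorm2_le _ _ _ mu (fun p : borel M => cabs (phi p))).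
- by move=> p; exact: cabs_ge0.
- by move=> p; exact: vfield_norm_ge0.
- by rewrite addr_ge0.
have E1 : (\int[mu]_p ((cabs (phi p)) ^+ 2)%:E = sqint mu setT (Re_part phi) + sqint mu setT (Im_part phi))%E.
  rewrite /sqint -ge0_integralD //.
  - apply: eq_integral => p _; rewrite /cabs sqr_sqrtr ?EFinD //.
    by rewrite addr_ge0 // sqr_ge0.
  - by move=> p _; rewrite lee_fin sqr_ge0.
  - by apply/measurable_EFinP; exact: sq_measurable (proj1 tR).
  - by move=> p _; rewrite lee_fin sqr_ge0.
  - by apply/measurable_EFinP; exact: sq_measurable (proj1 tI).
have E2 : (\int[mu]_p ((vfield_norm g (grad g (Re_part phi)) (grad g (Im_part phi)) p) ^+ 2)%:E
    = energy g mu (Re_part phi) + energy g mu (Im_part phi))%E.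
  rewrite /energy -ge0_integralD //.
  - apply: eq_integral => p _; rewrite -EFinD /gnorm; congr EFin.
    have [ip|ip] := pselect (minterior M p); last first.
      by rewrite !vfield_norm_out // expr0n addr0.
    rewrite /vfield_norm indicE mem_set // !mul1r.
    have cx : cimg (chart_at p) (cmap (chart_at p) p) by apply: cimg_cmap; exact: dom_chart_at.
    have H v w := nsq_ge0 Hg v w (atlas_chart_at p) cx; rewrite /nsq in H.
    have q0 (G : 'M[R]_m) : qform G 0 = 0 by rewrite /qform !mul0mx mxE.
    by rewrite !sqr_sqrtr ?H // /zero_field !q0 !addr0.
  - by move=> p _; rewrite lee_fin gnorm_ge0.
  - by apply/measurable_EFinP; exact: gnorm_measurable (proj1 tR).
  - by move=> p _; rewrite lee_fin gnorm_ge0.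
  - by apply/measurable_EFinP; exact: gnorm_measurable (proj1 tI).
rewrite E1 E2; apply: (@le_trans _ _ (C%:E * (energy g mu (Re_part phi) + energy g mu (Im_part phi)))%E).
  by rewrite ge0_muleDr ?energy_ge0 //; apply: leeD; exact: HC.
apply: lee_wpmul2r; first by rewrite adde_ge0 // energy_ge0.
by rewrite lee_fin lerDl.
Qed.

Lemma vfield_norm_subC v1 w1 v2 w2 p :
  vfield_norm g (vfield_sub v1 v2) (vfield_sub w1 w2) p =
  vfield_norm g (vfield_sub v2 v1) (vfield_sub w2 w1) p.
Proof.
have qN (G : 'M[R]_m) (x y : 'rV[R]_m) : qform G (x - y) = qform G (y - x).
  by rewrite -opprB /qform !mulNmx linearN /= mulmxN opprK.
by rewrite /vfield_norm /vfield_sub; congr (_ * Num.sqrt (_ + _)); exact: qN.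
Qed.

End Poincare.

Theorem theorem3p8 (R : realType) (m : nat) (M : manifold R m) (g : gram M)
    (rho : M -> R) (ns : nat) (beta : 'I_ns -> R)
    (mu : {measure set (borel M) -> \bar R})
    (hM : compact_singular_manifold (Some 1%N) g rho beta)
    (hmu : is_riemannian_measure g mu) :
  exists2 C : R, 0 < C & forall (u : M -> R[i]) (v w : vfield M),
    W12 g mu u v w ->
    (L2norm mu u <= C%:E * L2norm_vfield g mu v w)%E.
Proof.
have [Hg _ _ _] := csm_singular hM.
have [C C0 HC] := test_poincare hM hmu; exists C => // u v w [mRu mIu mv mw [phi [tphi cu cv]]].
have [mv' mw'] := (measurable_field_of mv, measurable_field_of mw).
set X := L2norm_vfield g mu v w.
pose a n := L2norm mu (fun p => u p - phi n p).
pose b n := L2norm_vfield g mu (vfield_sub v (grad g (Re_part (phi n))))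
             (vfield_sub w (grad g (Im_part (phi n)))).
have mcabs (z : M -> R[i]) : measurable_fun [set: borel M] (Re_part z : borel M -> R) ->
    measurable_fun [set: borel M] (Im_part z : borel M -> R) ->
    measurable_fun [set: borel M] (fun p : borel M => cabs (z p)).
  move=> mR mI; apply: (measurableT_comp (continuous_measurable_fun (@sqrt_continuous R))).
  by apply: measurable_funD; apply: measurable_funX.
(* The triangle inequality is used twice: for [u] against [phi n], and for the gradient of [phi n]
   against the limit field. *)
have key n : (L2norm mu u <= a n + C%:E * (b n + X))%E.
  have [[HR HI _] [tR tI]] := (tphi n, real_test_part (tphi n)).
  have mphi : measurable_fun [set: borel M] (fun p : borel M => cabs (phi n p)).
    by apply: mcabs; exact: Ck_fun_measurable.
  have muphi : measurable_fun [set: borel M] (fun p : borel M => cabs (u p - phi n p)).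
    apply: mcabs.
      rewrite (_ : Re_part _ = fun p => Re_part u p - Re_part (phi n) p); last first.
        by apply/funext => p; rewrite /Re_part raddfB.
      by apply: measurable_funB => //; exact: Ck_fun_measurable.
    rewrite (_ : Im_part _ = fun p => Im_part u p - Im_part (phi n) p); last first.
      by apply/funext => p; rewrite /Im_part raddfB.
    by apply: measurable_funB => //; exact: Ck_fun_measurable.
  have gR := measurable_field_grad Hg HR; have gI := measurable_field_grad Hg HI.
  have mb := vfield_norm_measurable Hg (measurable_field_sub mv' gR) (measurable_field_sub mw' gI).
  have mX := vfield_norm_measurable Hg mv' mw'.
  apply: (@le_trans _ _ (a n + L2norm mu (phi n))%E).
    apply: le_trans (minkowski_EFin mu muphi mphi (ler1n _ 2)).
    by apply: Lnorm2_mono => p /=; [exact: cabs_ge0|exact: cabs_triangle].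
  apply: leeD2l; apply: le_trans (HC _ (tphi n)) _.
  apply: lee_wpmul2l; first by rewrite lee_fin ltW.
  apply: le_trans (minkowski_EFin mu mb mX (ler1n _ 2)).
  apply: Lnorm2_mono => p /=; first exact: vfield_norm_ge0.
  by rewrite vfield_norm_subC; exact: vfield_norm_triangle.
have X0 : (0 <= X)%E by exact: Lnorm_ge0.
(* For infinite [X] the bound is immediate; finiteness makes the limit of the sum below well
   defined. *)
have [Xoo|Xfin] := eqVneq X +oo%E; first by rewrite Xoo gt0_muley ?lte_fin // leey.
have lim : (fun n => a n + C%:E * (b n + X))%E @ \oo --> (0 + C%:E * (0 + X))%E.
  apply: cvgeD => //.
  apply: cvgeZl => //; apply: cvgeD => //; exact: cvg_cst.
have := cvge_to_ge lim (nearW _ key).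
by rewrite !add0e; apply; exact: eventually_filter.
Qed.
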